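(* Let $W$ be one of the Weyl groups $W_{A_{n-1}}$, $W_{D_n}$ or $W_{B_n}$. The multiplication of the subalgebras induces an isomorphism of vector spaces $$\mathcal C[\eta_1,\dots,\eta_n]\otimes\mathcal C_{\mathfrak h^*}\otimes\mathbb C W^-\otimes\mathbb C[\mathfrak h^*]\longrightarrow\mathbb H^{-c}_W.$$ Equivalently, the set $\{\eta^{a}c^{\epsilon}\sigma x^{b}\}$ forms a basis of $\mathbb H^{-c}_W$, where $\sigma$ runs over a basis of $\mathbb C W^-$, $\epsilon\in\mathbb Z_2^n$, and $a,b\in\mathbb Z_+^n$.
   Context: All algebras are over $\mathbb C$; $\mathbb Z_+=\{0,1,2,\dots\}$. For $X=\eta_i$ or other algebra elements, $[X,x_j]=Xx_j-x_jX$. Weyl groups: $W_{A_{n-1}}=S_n$, $W_{B_n}$ is the group of signed permutations of $1,\dots,n$, $W_{D_n}$ the subgroup of even signed permutations. $s_{ij}$ is the transposition of $i,j$; $\overline s_{ij}$ is the transposition of $i,j$ coupled with sign changes at $i,j$; $\tau_i$ is the sign change at $i$. Simple reflections: $s_i=s_{i,i+1}$ ($1\le i\le n-1$), and $s_n=\tau_n$ in type $B_n$, $s_n=\overline s_{n-1,n}$ in type $D_n$. $W$ acts on the span of symbols $a_1,\dots,a_n$ ($a=x,c$) by signed permutation of indices, $a_i\mapsto a_i^\sigma$: $s_{ij}$ swaps $a_i,a_j$; $\overline s_{ij}$ sends $a_i\mapsto-a_j$, $a_j\mapsto-a_i$; $\tau_i$ sends $a_i\mapsto-a_i$. $W\to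 S_n$, $\sigma\mapsto\sigma^*$, is the homomorphism forgetting signs ($s_{ij}^*=\overline s_{ij}^*=s_{ij}$, $\tau_i^*=1$). $\mathcal C_{\mathfrak h^*}$: Clifford algebra on pairwise anticommuting $c_1,\dots,c_n$ of square $1$. $\mathbb C[\mathfrak h^*]=\mathbb C[x_1,\dots,x_n]$. $\mathcal C[\eta_1,\dots,\eta_n]$: skew-polynomial algebra, generated by $\eta_i$ with $\eta_i\eta_j=-\eta_j\eta_i$ for $i\ne j$ (no condition on $\eta_i^2$), with basis $\eta^a=\eta_1^{a_1}\cdots\eta_n^{a_n}$, $a\in\mathbb Z_+^n$. Also $x^b=x_1^{b_1}\cdots x_n^{b_n}$, $c^\epsilon=c_1^{\epsilon_1}\cdots c_n^{\epsilon_n}$. Spin Weyl group algebra $\mathbb C W^-$: generated by $t_i$ (one for each simple reflection) with $(t_it_j)^{m_{ij}}=(-1)^{m_{ij}+1}$, where $m_{ij}$ is the order of $s_is_j$. Set $t_{i\uparrow j}=t_it_{i+1}\cdots t_j$ if $i\le j$ and $1$ otherwise; $t_{i\downarrow j}=t_it_{i-1}\cdots t_j$ if $i\ge j$ and $1$ otherwise. For $1\le i<j\le n$ put $[i,j]=(-1)^{j-i-1}t_{j-1}\cdots t_{i+1}t_it_{i+1}\cdots t_{j-1}$, $[j,i]=-[i,j]$; $\overline{[i,j]}=\overline{[j,i]}=(-1)^{j-i-1}t_{j\uparrow n-1}t_{i\uparrow n-2}\,t_n\,t_{n-2\downarrow i}t_{n-1\downarrow j}$ in type $D_n$, and $=(-1)^{j-i}t_{j\uparrow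 n-1}t_{i\uparrow n-2}\,t_nt_{n-1}t_n\,t_{n-2\downarrow i}t_{n-1\downarrow j}$ in type $B_n$; $\overline{[i]}=(-1)^{n-i}t_i\cdots t_{n-1}t_nt_{n-1}\cdots t_i$ in type $B_n$. Let $t,u,v\in\mathbb C$. The algebra $\mathbb H^{-c}_W=\mathbb H^{-c}_W(t,u,v)$ is generated by $x_i,\eta_i$ ($1\le i\le n$), $\mathcal C_{\mathfrak h^*}$ and $\mathbb C W^-$ subject to: $t_ic_j=-c_j^{s_i}t_i$; $\eta_i\eta_j=-\eta_j\eta_i$ and $x_ix_j=x_jx_i$ ($i\ne j$); $c_i\eta_j=-\eta_jc_i$, $c_ix_j=(-1)^{\delta_{ij}}x_jc_i$ (all $i,j$); $t_ix_j=x_j^{s_i}t_i$, $t_i\eta_j=-\eta_j^{s_i^*}t_i$ (where $S_n$ permutes the indices of the $\eta_j$); and, with $i\ne j$: Type $A_{n-1}$: $[\eta_i,x_j]=u(1+c_ic_j)[i,j]$, $\ [\eta_i,x_i]=tc_i+u\sum_{k\ne i}(1+c_kc_i)[k,i]$. Types $D_n$, $B_n$: $[\eta_i,x_j]=u\big((1+c_ic_j)[i,j]-(1-c_ic_j)\overline{[i,j]}\big)$, $\ [\eta_i,x_i]=tc_i+u\sum_{k\neq i}\big((1+c_kc_i)[k,i]-(1-c_kc_i)\overline{[k,i]}\big)+v\overline{[i]}$, where the term $v\overline{[i]}$ is present only in type $B_n$. (On the left-hand sides $[\eta_i,x_j]$ is a commutator.) *)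

(* Defs.v *)
From HB Require Import structures.
From mathcomp Require Import all_boot all_order all_algebra all_fingroup.
From mathcomp Require Import boolp.
From mathcomp Require Import reals complex.
From mathcomp Require Import finmap monalg.

Set Implicit Arguments.
Unset Strict Implicit.
Unset Printing Implicit Defensive.

Import GRing.Theory.
Local Notation repr := generic_quotient.repr.
Local Open Scope quotient_scope.
Local Open Scope ring_scope.

Section LinearSpan.
Variables (K : fieldType) (V : lmodType K).

Inductive lspan (S : V -> Prop) : V -> Prop :=
| lspan0 : lspan S 0
| lspan_gen v of S v : lspan S v
| lspan_lin a u v of lspan S u & lspan S v : lspan S (a *: u + v).

Variable S : V -> Prop.

Lemma lspanD u v : lspan S u -> lspan S v -> lspan S (u + v).
Proof. by move=> Su Sv; rewrite -[u]scale1r; apply: lspan_lin. Qed.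

Lemma lspanZ a u : lspan S u -> lspan S (a *: u).
Proof.
by move=> Su; rewrite -[_ *: _]addr0; apply: lspan_lin => //; apply: lspan0.
Qed.

Lemma lspanN u : lspan S u -> lspan S (- u).
Proof. by rewrite -scaleN1r; apply: lspanZ. Qed.

Lemma lspanB u v : lspan S u -> lspan S v -> lspan S (u - v).
Proof. by move=> Su /lspanN; apply: lspanD. Qed.

Definition lin_basis (I : eqType) (b : I -> V) : Prop :=
  (forall (s : seq I) (a : I -> K), uniq s ->
     \sum_(i <- s) a i *: b i = 0 -> {in s, forall i, a i = 0}) /\
  (forall v, exists (s : seq I) (a : I -> K), v = \sum_(i <- s) a i *: b i).

End LinearSpan.

(* [lquot S] is the quotient of [V] by the linear span of [S]. *)
Section LinearQuotient.
Variables (K : fieldType) (V : lmodType K) (S : V -> Prop).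

Definition lquot_rel (u v : V) : bool := `[< lspan S (u - v) >].

Lemma lquot_rel_refl : reflexive lquot_rel.
Proof. by move=> u; apply/asboolP; rewrite subrr; apply: lspan0. Qed.

Lemma lquot_rel_sym : symmetric lquot_rel.
Proof.
by move=> u v; apply/asboolP/asboolP => /lspanN; rewrite opprB.
Qed.

Lemma lquot_rel_trans : transitive lquot_rel.
Proof.
move=> v u w /asboolP uv /asboolP vw; apply/asboolP.
by have := lspanD uv vw; rewrite subrKA.
Qed.

Canonical lquot_equiv :=
  EquivRel lquot_rel lquot_rel_refl lquot_rel_sym lquot_rel_trans.

Definition lquot := {eq_quot lquot_equiv}.

HB.instance Definition _ := Choice.on lquot.
HB.instance Definition _ := EqQuotient.on lquot.

Lemma lquotP (u v : V) : reflect (lspan S (u - v)) (\pi_lquot u == \pi_lquot v).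
Proof. by rewrite piE /=; apply: asboolP. Qed.

Lemma lquotW (P : lquot -> Type) : (forall u, P (\pi_lquot u)) -> forall p, P p.
Proof. by move=> h p; rewrite -[p]reprK. Qed.

Lemma lquot_eq (u v : V) : lspan S (u - v) -> \pi_lquot u = \pi_lquot v.
Proof. by move=> h; apply/eqP/lquotP. Qed.

Lemma lquot_repr (u : V) : lspan S (repr (\pi_lquot u) - u).
Proof. by apply/lquotP; rewrite reprK. Qed.

Definition lquot_add (p q : lquot) : lquot := \pi_lquot (repr p + repr q).
Definition lquot_opp (p : lquot) : lquot := \pi_lquot (- repr p).
Definition lquot_scale (a : K) (p : lquot) : lquot := \pi_lquot (a *: repr p).

Lemma lquot_addE u v : lquot_add (\pi_lquot u) (\pi_lquot v) = \pi_lquot (u + v).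
Proof.
by apply: lquot_eq; rewrite opprD addrACA; apply: lspanD; apply: lquot_repr.
Qed.

Lemma lquot_oppE u : lquot_opp (\pi_lquot u) = \pi_lquot (- u).
Proof. by apply: lquot_eq; rewrite -opprD; apply/lspanN/lquot_repr. Qed.

Lemma lquot_scaleE a u : lquot_scale a (\pi_lquot u) = \pi_lquot (a *: u).
Proof. by apply: lquot_eq; rewrite -scalerBr; apply/lspanZ/lquot_repr. Qed.

Lemma lquot_addA : associative lquot_add.
Proof.
elim/lquotW=> u; elim/lquotW=> v; elim/lquotW=> w.
by rewrite !lquot_addE addrA.
Qed.

Lemma lquot_addC : commutative lquot_add.
Proof. by elim/lquotW=> u; elim/lquotW=> v; rewrite !lquot_addE addrC. Qed.

Lemma lquot_add0 : left_id (\pi_lquot 0) lquot_add.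
Proof. by elim/lquotW=> u; rewrite lquot_addE add0r. Qed.

Lemma lquot_addN : left_inverse (\pi_lquot 0) lquot_opp lquot_add.
Proof. by elim/lquotW=> u; rewrite lquot_oppE lquot_addE addNr. Qed.

HB.instance Definition _ := GRing.isZmodule.Build lquot
  lquot_addA lquot_addC lquot_add0 lquot_addN.

Lemma lquot_piD u v : \pi_lquot (u + v) = \pi_lquot u + \pi_lquot v.
Proof. by rewrite -lquot_addE. Qed.

Lemma lquot_scaleA a b v :
  lquot_scale a (lquot_scale b v) = lquot_scale (a * b) v.
Proof. by elim/lquotW: v => v; rewrite !lquot_scaleE scalerA. Qed.

Lemma lquot_scale1 : left_id 1 lquot_scale.
Proof. by elim/lquotW=> v; rewrite lquot_scaleE scale1r. Qed.

Lemma lquot_scaleDr : right_distributive lquot_scale +%R.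
Proof.
move=> a; elim/lquotW=> u; elim/lquotW=> v.
by rewrite -lquot_piD !lquot_scaleE scalerDr lquot_piD.
Qed.

Lemma lquot_scaleDl v :
  {morph lquot_scale^~ v : a b / a + b >-> a + b}.
Proof.
move=> a b; elim/lquotW: v => v.
by rewrite !lquot_scaleE -lquot_piD scalerDl.
Qed.

HB.instance Definition _ := GRing.Zmodule_isLmodule.Build K lquot
  lquot_scaleA lquot_scale1 lquot_scaleDr lquot_scaleDl.

Lemma lquot_piZ a u : \pi_lquot (a *: u) = a *: \pi_lquot u.
Proof. by rewrite -lquot_scaleE. Qed.

End LinearQuotient.

Section LinearExtension.
Variables (K : fieldType) (I : choiceType) (V : lmodType K) (h : I -> V).

Definition lin_ext (p : {malg K[I]}) : V := \sum_(i <- msupp p) p@_i *: h i.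

Lemma lin_extEw (d : {fset I}) (p : {malg K[I]}) :
  fsubset (msupp p) d -> lin_ext p = \sum_(i <- d) p@_i *: h i.
Proof.
move=> le_d; rewrite /lin_ext (big_fset_incl _ le_d) //= => i _.
by move=> /mcoeff_outdom ->; rewrite scale0r.
Qed.

Lemma lin_ext_is_linear : linear lin_ext.
Proof.
move=> a p q; pose d := fsetU (msupp p) (msupp q).
have dp : fsubset (msupp p) d := fsubsetUl _ _.
have dq : fsubset (msupp q) d := fsubsetUr _ _.
have dpq : fsubset (msupp (a *: p + q)) d.
  apply: (fsubset_trans (msuppD_le _ _)).
  by rewrite fsubUset dq andbT (fsubset_trans (msuppZ_le _ _) dp).
rewrite (lin_extEw dp) (lin_extEw dq) (lin_extEw dpq).
rewrite scaler_sumr -big_split /=; apply: eq_bigr => i _.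
by rewrite mcoeffD mcoeffZ scalerDl scalerA.
Qed.

HB.instance Definition _ :=
  GRing.isLinear.Build K {malg K[I]} V *:%R lin_ext lin_ext_is_linear.

Lemma lin_extU a i : lin_ext << a *g i >> = a *: h i.
Proof. by rewrite (lin_extEw msuppU_le) big_seq_fset1 mcoeffUU. Qed.

End LinearExtension.

(* [U (x) V] is the free vector space on [U * V] modulo bilinearity. *)
Section TensorProduct.
Variables (K : fieldType) (U V : lmodType K).

Inductive bilin_rel : {malg K[(U * V)%type]} -> Prop :=
| bilin_l a u u' v :
    bilin_rel (<< (a *: u + u', v) >> - (a *: << (u, v) >> + << (u', v) >>))
| bilin_r a u v v' :
    bilin_rel (<< (u, a *: v + v') >> - (a *: << (u, v) >> + << (u, v') >>)).

Definition tensor := lquot bilin_rel.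
HB.instance Definition _ := GRing.Lmodule.on tensor.

Definition tens (u : U) (v : V) : tensor := \pi_(lquot bilin_rel) << (u, v) >>.

End TensorProduct.

Lemma malg_scalerAr (K : fieldType) (M : monomType) (a : K)
  (p q : {malg K[M]}) : a *: (p * q) = p * (a *: q).
Proof.
apply/malgP=> k; rewrite mcoeffZ.
rewrite (mcoeffMlw k (fsubset_refl _) (fsubset_refl _)).
rewrite (mcoeffMlw k (fsubset_refl _) (msuppZ_le a q)).
rewrite big_distrr; apply: eq_bigr => i _; rewrite big_distrr.
by apply: eq_bigr => j _ /=; rewrite mcoeffZ mulrnAr mulrCA.
Qed.

(* [freegen], [aclass] and [aquot_mul] are locked to keep unification from
   unfolding them: see [freegenE], [aclassE], [aclassM]. *)
Section FreeAlgebra.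
Variables (K : fieldType) (G : choiceType).

Definition freealg := {malg K[{fmonom G}]}.
HB.instance Definition _ := GRing.Lalgebra.on freealg.
HB.instance Definition _ :=
  GRing.Lalgebra_isAlgebra.Build K freealg (@malg_scalerAr K {fmonom G}).

Fact freealg_key : unit. Proof. by []. Qed.

Definition freegen (g : G) : freealg := locked_with freealg_key << fmu g >>.

Lemma freegenE g : freegen g = << fmu g >>.
Proof. by rewrite /freegen unlock. Qed.

End FreeAlgebra.

(* The quotient of [A] by the two-sided ideal generated by the [l - r] with
   [rel l r].  It may be the zero ring, hence only a [pzRingType]. *)
Section AlgebraQuotient.
Variables (K : fieldType) (A : algType K) (rel : A -> A -> Prop).

Definition ideal_gens (z : A) : Prop :=
  exists a l r b, rel l r /\ z = a * (l - r) * b.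

Definition aquot := lquot ideal_gens.
HB.instance Definition _ := GRing.Lmodule.on aquot.

Definition aclass : A -> aquot :=
  locked_with freealg_key (fun p => \pi_(lquot ideal_gens) p).

Lemma aclassE p : aclass p = \pi_(lquot ideal_gens) p.
Proof. by rewrite /aclass unlock. Qed.

Lemma ideal_mull p z : lspan ideal_gens z -> lspan ideal_gens (p * z).
Proof.
elim=> [|{}z [a [l [r [b [lr ->]]]]]|a u v _ IHu _ IHv].
- by rewrite mulr0; apply: lspan0.
- by apply: lspan_gen; exists (p * a), l, r, b; rewrite !mulrA.
- by rewrite mulrDr -scalerAr; apply: lspan_lin.
Qed.

Lemma ideal_mulr p z : lspan ideal_gens z -> lspan ideal_gens (z * p).
Proof.
elim=> [|{}z [a [l [r [b [lr ->]]]]]|a u v _ IHu _ IHv].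
- by rewrite mul0r; apply: lspan0.
- by apply: lspan_gen; exists a, l, r, (b * p); rewrite !mulrA.
- by rewrite mulrDl -scalerAl; apply: lspan_lin.
Qed.

Definition aquot_mul : aquot -> aquot -> aquot :=
  locked_with freealg_key (fun p q => aclass (repr p * repr q)).

Lemma aquot_mulE u v : aquot_mul (aclass u) (aclass v) = aclass (u * v).
Proof.
rewrite /aquot_mul unlock !aclassE; apply: lquot_eq.
set u' := repr _; set v' := repr _.
have -> : u' * v' - u * v = (u' - u) * v' + u * (v' - v).
  by rewrite mulrBl mulrBr addrA subrK.
by apply: lspanD; [apply: ideal_mulr|apply: ideal_mull]; apply: lquot_repr.
Qed.

Lemma aclassW (P : aquot -> Type) : (forall p, P (aclass p)) -> forall z, P z.
Proof. by move=> h; elim/lquotW => p; rewrite -aclassE. Qed.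

Lemma aclassD p q : aclass (p + q) = aclass p + aclass q.
Proof. by rewrite !aclassE lquot_piD. Qed.

Lemma aclassZ a p : aclass (a *: p) = a *: aclass p.
Proof. by rewrite !aclassE lquot_piZ. Qed.

Lemma aquot_mulA : associative aquot_mul.
Proof.
elim/aclassW=> u; elim/aclassW=> v; elim/aclassW=> w.
by rewrite !aquot_mulE mulrA.
Qed.

Lemma aquot_mul1 : left_id (aclass 1) aquot_mul.
Proof. by elim/aclassW=> u; rewrite aquot_mulE mul1r. Qed.

Lemma aquot_mulr1 : right_id (aclass 1) aquot_mul.
Proof. by elim/aclassW=> u; rewrite aquot_mulE mulr1. Qed.

Lemma aquot_mulDl : left_distributive aquot_mul +%R.
Proof.
elim/aclassW=> u; elim/aclassW=> v; elim/aclassW=> w.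
by rewrite -aclassD !aquot_mulE mulrDl aclassD.
Qed.

Lemma aquot_mulDr : right_distributive aquot_mul +%R.
Proof.
elim/aclassW=> u; elim/aclassW=> v; elim/aclassW=> w.
by rewrite -aclassD !aquot_mulE mulrDr aclassD.
Qed.

HB.instance Definition _ := GRing.Zmodule_isPzRing.Build aquot
  aquot_mulA aquot_mul1 aquot_mulr1 aquot_mulDl aquot_mulDr.

Lemma aclass1 : aclass 1 = 1. Proof. by []. Qed.

Lemma aclassM p q : aclass (p * q) = aclass p * aclass q.
Proof. by rewrite -aquot_mulE. Qed.

Lemma aclassN p : aclass (- p) = - aclass p.
Proof. by rewrite -scaleN1r aclassZ scaleN1r. Qed.

Lemma aclassX p m : aclass (p ^+ m) = aclass p ^+ m.
Proof. by elim: m => // m IHm; rewrite !exprS aclassM IHm. Qed.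

Lemma aclass_rel l r : rel l r -> aclass l = aclass r.
Proof.
move=> lr; rewrite !aclassE; apply/lquot_eq/lspan_gen.
by exists 1, l, r, 1; rewrite mul1r mulr1.
Qed.

Lemma aquot_scalerAl (a : K) (p q : aquot) : a *: (p * q) = (a *: p) * q.
Proof.
elim/aclassW: p => p; elim/aclassW: q => q.
by rewrite -aclassM -!aclassZ -aclassM scalerAl.
Qed.

Lemma aquot_scalerAr (a : K) (p q : aquot) : a *: (p * q) = p * (a *: q).
Proof.
elim/aclassW: p => p; elim/aclassW: q => q.
by rewrite -aclassM -!aclassZ -aclassM scalerAr.
Qed.

End AlgebraQuotient.


Section MonoidExtension.
Variables (K : fieldType) (M : monomType) (A : algType K).
Variables (rel : A -> A -> Prop) (h : M -> aquot rel).
Hypotheses (h1 : h (mone : M) = 1) (hM : forall m n : M, h (mmul m n) = h m * h n).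

Lemma lin_ext1 : lin_ext h 1 = 1.
Proof. by rewrite [LHS]lin_extU scale1r. Qed.

Lemma lin_extM p q : lin_ext h (p * q) = lin_ext h p * lin_ext h q.
Proof.
rewrite malgME linear_sum /= [in RHS]/lin_ext mulr_suml; apply: eq_bigr => i _.
rewrite linear_sum mulr_sumr; apply: eq_bigr => j _ /=.
by rewrite lin_extU hM -aquot_scalerAl -aquot_scalerAr scalerA.
Qed.

End MonoidExtension.

(* The algebra morphism on a presented algebra sending each generator [g] to
   [f g].  It evaluates a representative, so it is meaningful only when [f]
   respects the relations: see [pres_mapE]. *)
Section PresentedMorphism.
Variables (K : fieldType) (G : choiceType) (A : algType K).
Variables (rel : freealg K G -> freealg K G -> Prop) (rel' : A -> A -> Prop).
Variable f : G -> aquot rel'.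

Definition free_eval : freealg K G -> aquot rel' :=
  lin_ext (fun w : {fmonom G} => \prod_(g <- w) f g).

Definition pres_map (z : aquot rel) : aquot rel' := free_eval (repr z).

Lemma free_eval_is_linear : linear free_eval.
Proof. exact: lin_ext_is_linear. Qed.

HB.instance Definition _ :=
  GRing.isLinear.Build K (freealg K G) (aquot rel') *:%R free_eval
    free_eval_is_linear.

Lemma free_eval_is_monoid_morphism : monoid_morphism free_eval.
Proof.
split; first by apply: lin_ext1; rewrite fm1 big_nil.
by apply: lin_extM => m n; rewrite fmM big_cat.
Qed.

HB.instance Definition _ :=
  GRing.isMonoidMorphism.Build (freealg K G) (aquot rel') free_eval
    free_eval_is_monoid_morphism.

Lemma free_eval_gen g : free_eval (freegen K g) = f g.
Proof. by rewrite freegenE [LHS]lin_extU scale1r fmU big_seq1. Qed.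

Hypothesis f_rel : forall l r, rel l r -> free_eval l = free_eval r.

Lemma pres_mapE p : pres_map (aclass rel p) = free_eval p.
Proof.
apply/eqP; rewrite aclassE -subr_eq0 -linearB; apply/eqP.
elim: (lquot_repr (ideal_gens rel) p) => [|z [a [l [r [b [lr ->]]]]]|a u v _ u0 _ v0].
- exact: linear0.
- by rewrite !rmorphM /= linearB /= (f_rel lr) subrr mulr0 mul0r.
- by rewrite linearP /= u0 v0 scaler0 addr0.
Qed.

Lemma pres_map_gen g : pres_map (aclass rel (freegen K g)) = f g.
Proof. by rewrite pres_mapE free_eval_gen. Qed.

Lemma pres_map_is_linear : linear pres_map.
Proof.
move=> a p q; elim/aclassW: p => p; elim/aclassW: q => q.
by rewrite -aclassZ -aclassD !pres_mapE linearP.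
Qed.

Lemma pres_map_is_monoid_morphism : monoid_morphism pres_map.
Proof.
split; first by rewrite -aclass1 pres_mapE rmorph1.
move=> p q; elim/aclassW: p => p; elim/aclassW: q => q.
by rewrite -aclassM !pres_mapE rmorphM.
Qed.

End PresentedMorphism.

(* [TypeA], [TypeD], [TypeB] with parameter [n] stand for A_{n-1}, D_n, B_n. *)
Inductive weyl_type := TypeA | TypeD | TypeB.

Definition valid_size (X : weyl_type) (n : nat) : bool :=
  if X is TypeD then (1 < n)%N else (0 < n)%N.

Definition cox_rank (X : weyl_type) (n : nat) : nat :=
  if X is TypeA then n.-1 else n.

Lemma rank_le X n : (cox_rank X n <= n)%N.
Proof. by case: X => //=; apply: leq_pred. Qed.

(* An index 1 <= i <= n is encoded by the ordinal of value i - 1.  A signed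
   permutation is a permutation of ['I_n * bool], [(i, false)] and [(i, true)]
   being the symbols [a_i] and [- a_i]. *)
Section WeylGroup.
Variables (X : weyl_type) (n : nat).

Definition signed_perm := {perm 'I_n * bool}.

Definition transp (i j : 'I_n) : signed_perm :=
  (tperm (i, false) (j, false) * tperm (i, true) (j, true))%g.

Definition transp_bar (i j : 'I_n) : signed_perm :=
  (tperm (i, false) (j, true) * tperm (i, true) (j, false))%g.

Definition sign_change (i : 'I_n) : signed_perm := tperm (i, false) (i, true).

Definition simple_refl (k : 'I_(cox_rank X n)) : signed_perm :=
  let i : 'I_n := widen_ord (rank_le X n) k in
  if (i.+1 < n)%N then transp i (ordS i)
  else if X is TypeD then transp_bar (ord_pred i) i
  else sign_change i.

Definition cox_order (i j : 'I_(cox_rank X n)) : nat :=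
  #[(simple_refl i * simple_refl j)%g]%g.

Definition unsigned (s : signed_perm) (j : 'I_n) : 'I_n := (s (j, false)).1.

Definition signed_act (A : pzRingType) (a : 'I_n -> A) (s : signed_perm)
    (j : 'I_n) : A :=
  let p := s (j, false) in (-1) ^+ p.2 * a p.1.

End WeylGroup.

Section Brackets.
Variables (X : weyl_type) (n : nat) (A : pzRingType) (t : 'I_(cox_rank X n) -> A).

(* In this section the indices are natural numbers starting at 1; [tgen k] is
   only used for k in 1, ..., cox_rank X n. *)
Definition tgen (k : nat) : A := oapp t 0 (insub k.-1).

Definition tup (i j : nat) : A := \prod_(i <= k < j.+1) tgen k.
Definition tdown (i j : nat) : A := \prod_(k <- rev (index_iota j i.+1)) tgen k.

Definition br_lt (i j : nat) : A :=
  (-1) ^+ (j - i - 1) * (tdown (j - 1) i.+1 * tup i (j - 1)).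

Definition br (i j : nat) : A := if (i < j)%N then br_lt i j else - br_lt j i.

(* The two barred brackets are 0 in the types in which they do not occur. *)
Definition br_bar_lt (i j : nat) : A :=
  match X with
  | TypeA => 0
  | TypeD => (-1) ^+ (j - i - 1) *
      (tup j (n - 1) * tup i (n - 2) * tgen n * tdown (n - 2) i *
       tdown (n - 1) j)
  | TypeB => (-1) ^+ (j - i) *
      (tup j (n - 1) * tup i (n - 2) * (tgen n * tgen (n - 1) * tgen n) *
       tdown (n - 2) i * tdown (n - 1) j)
  end.

Definition br_bar (i j : nat) : A :=
  if (i < j)%N then br_bar_lt i j else br_bar_lt j i.

Definition sbr_bar (i : nat) : A :=
  if X is TypeB then (-1) ^+ (n - i) * (tup i n * tdown (n - 1) i) else 0.

End Brackets.

Section Relations.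
Variables (X : weyl_type) (n : nat) (A : pzRingType).

Inductive skew_rel (e : 'I_n -> A) : A -> A -> Prop :=
| skew_anti i j of i != j : skew_rel e (e i * e j) (- (e j * e i)).

Inductive cliff_rel (c : 'I_n -> A) : A -> A -> Prop :=
| cliff_sq i : cliff_rel c (c i * c i) 1
| cliff_anti i j of i != j : cliff_rel c (c i * c j) (- (c j * c i)).

Inductive spin_rel (t : 'I_(cox_rank X n) -> A) : A -> A -> Prop :=
| spin_braid i j :
    spin_rel t ((t i * t j) ^+ cox_order i j) ((-1) ^+ (cox_order i j).+1).

End Relations.

Definition rcomm (A : pzRingType) (a b : A) : A := a * b - b * a.

Section HeckeRelations.
Variables (X : weyl_type) (n : nat) (K : fieldType) (t0 u0 v0 : K).

Definition hgen : choiceType := ('I_n + 'I_n + ('I_n + 'I_(cox_rank X n)))%type.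

Definition hgen_x (i : 'I_n) : hgen := inl (inl i).
Definition hgen_e (i : 'I_n) : hgen := inl (inr i).
Definition hgen_c (i : 'I_n) : hgen := inr (inl i).
Definition hgen_t (k : 'I_(cox_rank X n)) : hgen := inr (inr k).

Local Notation x i := (freegen K (hgen_x i)).
Local Notation e i := (freegen K (hgen_e i)).
Local Notation c i := (freegen K (hgen_c i)).
Local Notation t k := (freegen K (hgen_t k)).
Local Notation ts := (fun k => t k).

Inductive hecke_rel : freealg K hgen -> freealg K hgen -> Prop :=
| hecke_cliff l r of cliff_rel (fun i => c i) l r : hecke_rel l r
| hecke_spin l r of spin_rel ts l r : hecke_rel l r
| hecke_skew l r of skew_rel (fun i => e i) l r : hecke_rel l r
| hecke_x i j of i != j : hecke_rel (x i * x j) (x j * x i)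
| hecke_tc k j :
    hecke_rel (t k * c j)
              (- (signed_act (fun i => c i) (simple_refl k) j * t k))
| hecke_ce i j : hecke_rel (c i * e j) (- (e j * c i))
| hecke_cx i j : hecke_rel (c i * x j) ((-1) ^+ (i == j) * (x j * c i))
| hecke_tx k j :
    hecke_rel (t k * x j) (signed_act (fun i => x i) (simple_refl k) j * t k)
| hecke_te k j :
    hecke_rel (t k * e j) (- (e (unsigned (simple_refl k) j) * t k))
| hecke_ex i j of i != j :
    hecke_rel (rcomm (e i) (x j))
      (u0 *: ((1 + c i * c j) * br ts i.+1 j.+1
              - (1 - c i * c j) * br_bar ts i.+1 j.+1))
| hecke_exi i :
    hecke_rel (rcomm (e i) (x i))
      (t0 *: c i
       + u0 *: (\sum_(k < n | k != i)
                  ((1 + c k * c i) * br ts k.+1 i.+1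
                   - (1 - c k * c i) * br_bar ts k.+1 i.+1))
       + v0 *: sbr_bar ts i.+1).

End HeckeRelations.

Notation skewpoly K n := (aquot (skew_rel (fun i : 'I_n => freegen K i))).
Notation clifford K n := (aquot (cliff_rel (fun i : 'I_n => freegen K i))).
Notation spin_algebra K X n :=
  (aquot (spin_rel (fun k : 'I_(cox_rank X n) => freegen K k))).
Notation hecke X n t0 u0 v0 := (aquot (@hecke_rel X n _ t0 u0 v0)).

(* Imported late: it redefines notations of [monalg]. *)
From mathcomp Require Import mpoly.

Section CanonicalMaps.
Variables (X : weyl_type) (n : nat) (K : fieldType) (t0 u0 v0 : K).
Local Notation H := (hecke X n t0 u0 v0).

Definition heckegen (g : hgen X n) : H := aclass _ (freegen K g).

Definition of_skew : skewpoly K n -> H := pres_map (fun i => heckegen (hgen_e X i)).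
Definition of_cliff : clifford K n -> H := pres_map (fun i => heckegen (hgen_c X i)).
Definition of_spin : spin_algebra K X n -> H :=
  pres_map (fun k => heckegen (hgen_t k)).

Lemma of_skew_gen i : of_skew (aclass _ (freegen K i)) = heckegen (hgen_e X i).
Proof.
apply: pres_map_gen => _ _ [j k jk].
have E : @hecke_rel X n K t0 u0 v0 _ _ := hecke_skew _ _ _ (@skew_anti _ _ _ j k jk).
rewrite rmorphN !rmorphM /= !free_eval_gen.
apply: etrans (esym (aclassM _ _ _)) (etrans (aclass_rel E) _).
exact: etrans (aclassN _ _) (congr1 -%R (aclassM _ _ _)).
Qed.

Lemma of_cliff_gen i : of_cliff (aclass _ (freegen K i)) = heckegen (hgen_c X i).
Proof.
apply: pres_map_gen => _ _ [j|j k jk].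
  have E : @hecke_rel X n K t0 u0 v0 _ _ := hecke_cliff _ _ _ (@cliff_sq _ _ _ j).
  rewrite rmorphM rmorph1 /= free_eval_gen.
  exact: etrans (esym (aclassM _ _ _)) (aclass_rel E).
have E : @hecke_rel X n K t0 u0 v0 _ _ := hecke_cliff _ _ _ (@cliff_anti _ _ _ j k jk).
rewrite rmorphN !rmorphM /= !free_eval_gen.
apply: etrans (esym (aclassM _ _ _)) (etrans (aclass_rel E) _).
exact: etrans (aclassN _ _) (congr1 -%R (aclassM _ _ _)).
Qed.

Lemma of_spin_gen k : of_spin (aclass _ (freegen K k)) = heckegen (hgen_t k).
Proof.
apply: pres_map_gen => _ _ [i j].
have E : @hecke_rel X n K t0 u0 v0 _ _ := hecke_spin _ _ _ (@spin_braid _ _ _ _ i j).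
rewrite !rmorphXn /= rmorphM rmorphN1 /= !free_eval_gen.
apply: etrans (congr1 (fun z => z ^+ _) (esym (aclassM _ _ _))) _.
apply: etrans (esym (aclassX _ _ _)) (etrans (aclass_rel E) _).
by apply: etrans (aclassX _ _ _) _; rewrite aclassN aclass1.
Qed.

Definition skewmon (a : 'I_n -> nat) : H :=
  \prod_(i < n) heckegen (hgen_e X i) ^+ a i.
Definition cliffmon (d : 'I_n -> bool) : H :=
  \prod_(i < n) heckegen (hgen_c X i) ^+ d i.
Definition polymon (b : 'I_n -> nat) : H :=
  \prod_(i < n) heckegen (hgen_x X i) ^+ b i.

Definition of_poly (p : mpoly n K) : H :=
  \sum_(m <- msupp p) p@_m *: polymon m.

End CanonicalMaps.

(* Main.v *)
(** Let [V] be the space of functions of a word in the letters [eta_i], [c_i] and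
    of a point of [K^n], with values in the spin Weyl group algebra, that change
    sign when two distinct adjacent letters are exchanged and do not change when a
    square [c_i c_i] is inserted.  The algebra acts on the right of [V]: the letters
    translate words; at the empty word, [t_k] reflects the point and multiplies the
    value by [t_k], and [x_j] multiplies it by the [j]-th coordinate; the values at
    longer words are then dictated by the relations that move [t_k] and [x_j] past
    letters.  A relation holds on [V] as soon as it holds at the empty word and can
    be moved past every letter.  With [kappa_ij] the prescribed commutator
    [[eta_i, x_j]], this comes down to the equivariance of [kappa], to
    [eta_i kappa_jk + kappa_ik eta_j + (i <-> j) = 0] and to
    [[kappa_ij, x_k] = [kappa_ik, x_j]]; all of them follow from the fact that
    [p g = - s_k(g) p] for [p = t_k] and [g] the lift of a reflection.  Evaluating a
    combination of normal forms on the functions dual to the words [eta^a c^d]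
    yields polynomials in the point with coefficients in the spin algebra, whence
    the independence.  The normal forms span by straightening words. *)

Require Import Defs.
From HB Require Import structures.
From mathcomp Require Import all_boot all_order all_algebra all_fingroup cyclic.
From mathcomp Require Import boolp functions.
From mathcomp Require Import reals complex finmap monalg.
From mathcomp Require Import zify.

Set Implicit Arguments.
Unset Strict Implicit.
Unset Printing Implicit Defensive.

Import Order.TTheory GRing.Theory Num.Theory.
Local Notation repr := generic_quotient.repr.
Local Open Scope quotient_scope.
Local Open Scope ring_scope.

(** * Brackets and conjugation by the generators *)

Section Intertwining.
Variable A : pzRingType.
Implicit Types p q g h : A.

(** Why functions on words: this is a coinduced module, in which [f] stands for an equivariant map
    on the algebra and [h] sends it to [w |-> f (h w)]. The relations among letters become
    conditions on [f], so that operators are defined by recursion on arbitrary words and no normal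
    form has to be chosen. The [t_k] and [c_i] must act on all words before [x_j] is defined,
    because moving [x_j] past [eta_i] leaves [kappa_ij], which is made of brackets. The obstacle is
    that the brackets are long words in the [t_k], given by different formulas in each type, on
    which the effect of a simple reflection is not visible. They are therefore characterised by
    recursions through conjugation, and the signed intertwining relation [tw] is followed along
    these recursions with the rank two relations alone. Once the lifts are indexed by pairs of
    signed indices, ordinary and barred brackets merge and the three types share one [kappa]. Points
    take the place of polynomials, since monomials are independent as functions in characteristic
    zero. *)

Definition tw p g h := p * g = - (h * p).

Lemma tw_sym p g h : p * p = 1 -> tw p g h -> tw p h g.
Proof.
move=> pp e; rewrite /tw -[h]mulr1 -pp !mulrA -(mulrA p h) -[h * p]opprK -e.
by rewrite mulrN mulNr !mulrA pp mul1r.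
Qed.

Lemma tw_eq p g h : p * p = 1 -> tw p g h -> h = - (p * g * p).
Proof. by move=> pp ->; rewrite mulNr opprK -mulrA pp mulr1. Qed.

Lemma tw_conj p g : p * p = 1 -> tw p g (- (p * g * p)).
Proof. by move=> pp; rewrite /tw mulNr opprK -!mulrA pp mulr1. Qed.

Lemma twN p g h : tw p g h -> tw p (- g) (- h).
Proof. by rewrite /tw mulrN mulNr => ->. Qed.

(** On its way [p] passes [q] twice, and these two signs cancel. *)
Lemma tw_anti p q g h :
  tw p q q -> tw p g h -> tw p (q * g * q) (q * h * q).
Proof.
rewrite /tw => pq pg.
by rewrite !mulrA pq !mulNr -(mulrA q p) pg mulrN mulNr opprK -!mulrA pq !mulrN.
Qed.

(** The braid relation turns [p] into [q] before it reaches [g], past which [q] anticommutes, and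
    back into [p] afterwards. This covers the case where [p] does not anticommute with the outer
    factor of a conjugate. *)
Lemma tw_braid p q g :
  p * q * p = q * p * q -> tw q g g ->
  tw p (q * (p * g * p) * q) (q * (p * g * p) * q).
Proof.
rewrite /tw => pqp qg.
rewrite !mulrA pqp -(mulrA (q * p) q) qg mulrN !mulNr; congr (- _).
by rewrite -!mulrA; congr (_ * (_ * (_ * _))); rewrite !mulrA pqp.
Qed.

End Intertwining.

(** The transposition of [k] and [k + 1] on natural numbers: brackets have indices starting at 1,
    and working in [nat] leaves the index conditions to [lia]. *)
Definition nswap (k i : nat) : nat :=
  if i == k then k.+1 else if i == k.+1 then k else i.

Lemma nswap_l k : nswap k k = k.+1.
Proof. by rewrite /nswap eqxx. Qed.

Lemma nswap_r k : nswap k k.+1 = k.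
Proof. by rewrite /nswap eqxx gtn_eqF. Qed.

Lemma nswap_id k i : i != k -> i != k.+1 -> nswap k i = i.
Proof. by rewrite /nswap => /negPf-> /negPf->. Qed.

(* [r i j] and [rb i j] stand for the brackets [i, j] and their barred versions,
   for [i < j]; [b] is the barred bracket of [n - 1] and [n]. *)
Section ReflectionElements.
Variables (A : pzRingType) (n : nat) (T : nat -> A).
Hypothesis Tsq : forall k, (0 < k < n)%N -> T k * T k = 1.
Hypothesis Tanti : forall k l, (0 < k)%N -> (k.+1 < l)%N -> (l < n)%N ->
  tw (T k) (T l) (T l).
Hypothesis Tbraid : forall k, (0 < k)%N -> (k.+1 < n)%N ->
  T k * T k.+1 * T k = T k.+1 * T k * T k.+1.

Lemma Tfar k l : (0 < k < n)%N -> (0 < l < n)%N ->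
  (k.+1 < l)%N || (l.+1 < k)%N -> tw (T k) (T l) (T l).
Proof.
move=> kn ln /orP[kl|lk]; first by apply: Tanti; lia.
have := @Tanti l k; rewrite /tw => e; rewrite e ?opprK //; lia.
Qed.

Variable r : nat -> nat -> A.
Hypothesis r_base : forall i, r i i.+1 = T i.
Hypothesis r_step : forall i j, (i < j)%N -> r i j.+1 = - (T j * r i j * T j).

Definition rext i j := if (i < j)%N then r i j else - r j i.

Lemma rext_lt i j : (i < j)%N -> rext i j = r i j.
Proof. by rewrite /rext => ->. Qed.

(** The condition says that neither [k] nor [k.+1] is one of [i], [j]. By induction on [j], [T k]
    passes the two outer factors of [r i j] unless these are [T k.+1]; in that case the recursion is
    unfolded twice and [tw_braid] applies. *)
Lemma r_fix k i j : (0 < i)%N -> (i < j <= n)%N -> (0 < k < n)%N ->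
  (k.+1 < i)%N || (i < k)%N && (k.+1 < j)%N || (j < k)%N ->
  tw (T k) (r i j) (r i j).
Proof.
move=> i0; elim/ltn_ind: j k => j IH k ijn kn hk.
have [eji|] := eqVneq j i.+1.
  by rewrite eji r_base; apply: Tfar; lia.
case: j IH ijn hk => [|j] IH ijn hk ji; first by lia.
have ij : (i < j)%N by lia.
rewrite r_step //; apply: twN.
have [ekj|] := eqVneq k.+1 j; last first.
  move=> kj; apply: tw_anti; first by apply: Tfar; lia.
  by apply: IH; lia.
rewrite -ekj r_step; last lia.
rewrite mulrN mulNr; apply: twN.
by apply: tw_braid; [apply: Tbraid; lia|apply: IH; lia].
Qed.

Lemma r_up i j : (0 < i)%N -> (i < j)%N -> (j < n)%N ->
  tw (T j) (r i j) (r i j.+1).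
Proof. by move=> i0 ij jn; rewrite r_step //; apply: tw_conj; apply: Tsq; lia. Qed.

(** The recursion moves only the upper index. That conjugation by [T i] moves the lower one starts
    from the braid relation, which equates the two expressions of [r i i.+2]. *)
Lemma r_down i j : (0 < i)%N -> (i.+1 < j <= n)%N ->
  tw (T i) (r i.+1 j) (r i j).
Proof.
move=> i0; elim: j => [|j IH] ijn; first lia.
have [->|ji] := eqVneq j i.+1.
  rewrite r_base r_step // r_base /tw mulNr opprK -(Tbraid i0); last lia.
  by rewrite -!mulrA Tsq ?mulr1; last lia.
rewrite !r_step; try lia.
apply: twN; apply: tw_anti; last by apply: IH; lia.
by apply: Tfar; lia.
Qed.

(** A case distinction on how [k, k.+1] meets [i, j]. When the two pairs coincide, [r i j] is [T k]
    itself, and the antisymmetry of [rext] supplies the missing sign. *)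
Lemma r_tw_lt k i j : (0 < i)%N -> (i < j <= n)%N -> (0 < k < n)%N ->
  tw (T k) (r i j) (rext (nswap k i) (nswap k j)).
Proof.
move=> i0 ijn kn.
have [fx|nf] :=
    boolP ((k.+1 < i)%N || (i < k)%N && (k.+1 < j)%N || (j < k)%N).
  have -> : rext (nswap k i) (nswap k j) = r i j.
    by rewrite !nswap_id ?rext_lt //; lia.
  exact: r_fix.
have [ki|ki] := eqVneq k i.
  subst i; have [kj|kj] := eqVneq k.+1 j.
    subst j; rewrite r_base nswap_l nswap_r /rext ltnNge leqnSn /= r_base.
    by rewrite /tw mulNr opprK.
  rewrite ?nswap_l ?nswap_r !nswap_id ?rext_lt; try lia.
  by apply: tw_sym; [exact: Tsq|apply: r_down; lia].
have [ki'|ki'] := eqVneq k.+1 i.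
  subst i; rewrite ?nswap_l ?nswap_r !nswap_id ?rext_lt; try lia.
  by apply: r_down; lia.
have [kj|kj] := eqVneq k j.
  subst j; rewrite ?nswap_l ?nswap_r !nswap_id ?rext_lt; try lia.
  by apply: r_up; lia.
have kj' : k.+1 = j by lia.
subst j; rewrite ?nswap_l ?nswap_r !nswap_id ?rext_lt; try lia.
by apply: tw_sym; [exact: Tsq|apply: r_up; lia].
Qed.

Lemma nswap_inj k i j : nswap k i = nswap k j -> i = j.
Proof. by rewrite /nswap; do !case: eqP => ?; lia. Qed.

Lemma rextN i j : i != j -> rext i j = - rext j i.
Proof.
rewrite /rext => ij.
by case: ltnP => h; case: ltnP => h' //; rewrite ?opprK //; lia.
Qed.

Lemma r_tw k i j : (0 < i <= n)%N -> (0 < j <= n)%N -> i != j ->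
  (0 < k < n)%N -> tw (T k) (rext i j) (rext (nswap k i) (nswap k j)).
Proof.
move=> i0 j0 ij kn.
have [lij|lji] := ltnP i j; first by rewrite {1}/rext lij; apply: r_tw_lt; lia.
rewrite [rext i j]rextN // [rext (nswap _ _) _]rextN; last first.
  by apply: contra ij => /eqP/nswap_inj ->.
have lji' : (j < i)%N by lia.
by apply: twN; rewrite {1}/rext lji'; apply: r_tw_lt; lia.
Qed.

Variables (b : A) (rb : nat -> nat -> A).
Hypothesis bsq : b * b = 1.
Hypothesis rb_base : rb n.-1 n = b.
Hypothesis rb_stepn : forall i, (i.+1 < n)%N ->
  rb i n = - (T i * rb i.+1 n * T i).
Hypothesis rb_step : forall i j, (i < j)%N -> (j < n)%N ->
  rb i j = - (T j * rb i j.+1 * T j).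
Hypothesis banti : forall k, (0 < k < n)%N -> k.+2 != n -> tw (T k) b b.
Hypothesis bbraid : forall k, (0 < k)%N -> k.+2 = n -> T k * b * T k = b * T k * b.

Definition rbext i j := if (i < j)%N then rb i j else rb j i.

Lemma rbext_lt i j : (i < j)%N -> rbext i j = rb i j.
Proof. by rewrite /rbext => ->. Qed.

Lemma rbextC i j : rbext i j = rbext j i.
Proof.
by rewrite /rbext; case: (ltngtP i j) => // ->.
Qed.

Lemma rbn_fix k i : (0 < i)%N -> (i < n)%N -> (0 < k)%N -> (k.+1 < n)%N ->
  (k != i) -> (k.+1 != i) -> tw (T k) (rb i n) (rb i n).
Proof.
move=> i0 lin k0 kn.
have [m] := ubnP (n - i); elim: m => // m IH in i i0 lin k k0 kn * => lm ki ki'.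
have [e|ne] := eqVneq i n.-1.
  by rewrite e rb_base; apply: banti; lia.
have lin' : (i.+1 < n)%N by lia.
rewrite rb_stepn //; apply: twN.
have [e|ne'] := eqVneq k i.+1; last first.
  by apply: tw_anti; [apply: Tfar; lia|apply: IH; lia].
rewrite e rb_stepn; last lia.
rewrite mulrN mulNr; apply: twN; apply: tw_braid.
  by rewrite Tbraid //; lia.
by apply: IH; lia.
Qed.

Lemma rbn_down i : (0 < i)%N -> (i.+1 < n)%N -> tw (T i) (rb i.+1 n) (rb i n).
Proof. by move=> i0 ijn; rewrite (rb_stepn ijn); apply: tw_conj; apply: Tsq; lia. Qed.

Lemma rb_up i j : (0 < i)%N -> (i < j)%N -> (j < n)%N ->
  tw (T j) (rb i j.+1) (rb i j).
Proof. by move=> i0 ij jn; rewrite (rb_step ij jn); apply: tw_conj; apply: Tsq; lia. Qed.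

(** Downward induction on [j], since the recursion for [rb] starts at [rb n.-1 n]. The delicate case
    is [k = i], [k.+1 = j], where [T k] must fix [rb k k.+1]: this element is [rb k.+1 k.+2]
    conjugated by [T k] and then by [T k.+1], and the induction hypothesis that [T k.+1] fixes
    [rb k.+1 k.+2] feeds [tw_braid]. *)
Lemma rb_tw_lt k i j : (0 < i)%N -> (i < j <= n)%N -> (0 < k < n)%N ->
  tw (T k) (rb i j) (rbext (nswap k i) (nswap k j)).
Proof.
move=> i0 ijn kn.
have [m] := ubnP (n - j); elim: m => // m IH in i i0 j ijn k kn * => lm.
have [ejn|njn] := eqVneq j n.
  subst j; have [kn'|kn'] := eqVneq k.+1 n.
    have [e|ne] := eqVneq i n.-1.
      have -> : rbext (nswap k i) (nswap k n) = rb n.-1 n.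
        have -> : i = k by lia.
        by rewrite -kn' nswap_l nswap_r rbextC rbext_lt.
      by rewrite e rb_base; apply: banti; lia.
    rewrite -kn' nswap_r nswap_id ?rbext_lt; try lia.
    by apply: rb_up; lia.
  have [e|ne] := eqVneq k i.
    subst i; rewrite ?nswap_l ?nswap_r !nswap_id ?rbext_lt; try lia.
    by apply: tw_sym; [exact: Tsq|apply: rbn_down; lia].
  have [e|ne'] := eqVneq k.+1 i.
    subst i; rewrite ?nswap_l ?nswap_r !nswap_id ?rbext_lt; try lia.
    by apply: rbn_down; lia.
  rewrite !nswap_id ?rbext_lt; try lia.
  by apply: rbn_fix; lia.
have [e|ne] := eqVneq k j.
  subst j; rewrite ?nswap_l ?nswap_r !nswap_id ?rbext_lt; try lia.
  by apply: tw_sym; [exact: Tsq|apply: rb_up; lia].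
have [e|ne'] := eqVneq k.+1 j.
  have [e'|ne''] := eqVneq k i.
    have -> : rbext (nswap k i) (nswap k j) = rb i j.
      by subst i j; rewrite nswap_l nswap_r rbextC rbext_lt.
    subst i j; rewrite rb_step; try lia.
    have h2 : (k < k.+2 <= n)%N by lia.
    have h1 : (k.+1 < k.+2 <= n)%N by lia.
    have lm' : (n - k.+2 < m)%N by lia.
    have := IH k i0 _ h2 k kn lm'.
    rewrite nswap_l nswap_id ?rbext_lt; try lia.
    move=> /(tw_sym (Tsq kn)) IH1.
    have -> : rb k k.+2 = - (T k * rb k.+1 k.+2 * T k).
      by rewrite IH1 mulNr -mulrA Tsq // mulr1 opprK.
    rewrite mulrN mulNr; apply/twN/twN; apply: tw_braid; first by apply: Tbraid; lia.
    have kn' : (0 < k.+1 < n)%N by lia.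
    have := IH k.+1 isT _ h1 k.+1 kn' lm'.
    by rewrite nswap_l nswap_r rbextC rbext_lt.
  subst j; rewrite ?nswap_l ?nswap_r !nswap_id ?rbext_lt; try lia.
  by apply: rb_up; lia.
rewrite rb_step; try lia.
have [e|ne''] := eqVneq k j.+1.
  subst k; rewrite !nswap_id ?rbext_lt; try lia.
  rewrite [rb i j]rb_step; try lia.
  apply: twN; rewrite rb_step; try lia.
  rewrite mulrN mulNr; apply: twN; apply: tw_braid; first by rewrite Tbraid //; lia.
  have h2 : (i < j.+2 <= n)%N by lia.
  have jn : (0 < j < n)%N by lia.
  have lm' : (n - j.+2 < m)%N by lia.
  by have := IH i i0 _ h2 j jn lm'; rewrite !nswap_id ?rbext_lt //; lia.
have jj : nswap k j = j by rewrite nswap_id; lia.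
have jj' : nswap k j.+1 = j.+1 by rewrite nswap_id; lia.
have ij' : (nswap k i < j)%N by rewrite /nswap; do !case: eqP => ?; lia.
rewrite jj rbext_lt // [rb (nswap _ _) j]rb_step; try lia.
apply: twN; apply: tw_anti; first by apply: Tfar; lia.
have h1 : (i < j.+1 <= n)%N by lia.
have lm' : (n - j.+1 < m)%N by lia.
by have := IH i i0 _ h1 k kn lm'; rewrite jj' rbext_lt //; lia.
Qed.

Lemma rb_tw k i j : (0 < i <= n)%N -> (0 < j <= n)%N -> i != j ->
  (0 < k < n)%N -> tw (T k) (rbext i j) (rbext (nswap k i) (nswap k j)).
Proof.
move=> i0 j0 ij kn.
have [lij|lji] := ltnP i j; first by rewrite {1}/rbext lij; apply: rb_tw_lt; lia.
rewrite [rbext i j]rbextC [rbext (nswap _ _) _]rbextC.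
have lji' : (j < i)%N by lia.
by rewrite {1}/rbext lji'; apply: rb_tw_lt; lia.
Qed.

Lemma r_left i j : (0 < i)%N -> (i.+1 < j <= n)%N ->
  r i j = - (T i * r i.+1 j * T i).
Proof.
move=> i0 ijn; have h : (0 < i < n)%N by lia.
by rewrite r_down // mulNr opprK -mulrA Tsq // mulr1.
Qed.

Lemma b_anti k : (0 < k < n)%N -> k.+2 != n -> tw b (T k) (T k).
Proof. by move=> kn k2; rewrite /tw (banti kn k2) opprK. Qed.

Lemma b_r_fix i j : (0 < i)%N -> (i < j)%N -> (j.+1 < n)%N ->
  tw b (r i j) (r i j).
Proof.
move=> i0; elim: j => // j IH ij jn.
have [e|ne] := eqVneq j i; first by rewrite e r_base; apply: b_anti; lia.
rewrite r_step; last lia.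
by apply: twN; apply: tw_anti; [apply: b_anti; lia|apply: IH; lia].
Qed.

(** The reflection in [e_(n-1) + e_n] carries [e_i - e_(n-1)] to [e_i + e_n]. The base [i = n - 2]
    is the braid relation between [b] and [T i]. *)
Lemma b_r_pred i : (0 < i)%N -> (i.+1 < n)%N -> tw b (r i n.-1) (rb i n).
Proof.
have [m] := ubnP (n - i); elim: m => // m IH in i * => lm i0 lin.
have [e|ne] := eqVneq i.+2 n.
  rewrite rb_stepn // -e /= r_base /tw mulNr opprK.
  rewrite [X in T i * X]((_ : rb i.+1 i.+2 = b)); last by rewrite -[RHS]rb_base -e.
  by rewrite bbraid // -mulrA bsq mulr1.
rewrite rb_stepn // r_left //; last lia.
by apply: twN; apply: tw_anti; [apply: b_anti; lia|apply: IH; lia].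
Qed.

Lemma b_r_n i : (0 < i)%N -> (i.+1 < n)%N -> tw b (r i n) (rb i n.-1).
Proof.
move=> i0 lin; have e : n.-1.+1 = n by lia.
have -> : r i n = - (T n.-1 * r i n.-1 * T n.-1) 
  by have := @r_step i n.-1; rewrite e; apply; lia.
have -> : rb i n.-1 = - (T n.-1 * rb i n * T n.-1) 
  by have := @rb_step i n.-1; rewrite e; apply; lia.
by apply: twN; apply: tw_anti; [apply: b_anti; lia|exact: b_r_pred].
Qed.

Lemma b_rb_fix i j : (0 < i)%N -> (i < j)%N -> (j.+1 < n)%N ->
  tw b (rb i j) (rb i j).
Proof.
have [m] := ubnP (n - j); elim: m => // m IH in j * => lm i0 ij jn.
rewrite rb_step //; last lia.
apply: twN; have [e|ne] := eqVneq j.+2 n; last first.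
  by apply: tw_anti; [apply: b_anti; lia|apply: IH; lia].
(* For [j = n - 2] the barred bracket is traded for an ordinary one conjugated by [b]; [T j] fixes
   [r i n], and [T j] satisfies the braid relation with [b]. *)
have -> : rb i j.+1 = - (b * r i n * b).
  rewrite b_r_n //; last lia.
  by rewrite mulNr opprK -mulrA bsq mulr1 -e.
rewrite mulrN mulNr; apply: twN; apply: tw_braid; first by rewrite bbraid //; lia.
by apply: r_fix; lia.
Qed.

End ReflectionElements.

(** * Type B: sign changes and barred brackets *)

Section ReflectionElementsB.
Variables (A : pzRingType) (n : nat) (T : nat -> A).
Hypothesis Tsq : forall k, (0 < k <= n)%N -> T k * T k = 1.
Hypothesis Tanti : forall k l, (0 < k)%N -> (k.+1 < l)%N -> (l <= n)%N ->
  tw (T k) (T l) (T l).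
Hypothesis Tbraid : forall k, (0 < k)%N -> (k.+1 < n)%N ->
  T k * T k.+1 * T k = T k.+1 * T k * T k.+1.
Hypothesis Tbraid4 : (1 < n)%N ->
  tw (T n) (T n.-1 * T n * T n.-1) (T n.-1 * T n * T n.-1).

(** The lift of the reflection in [e_(n-1) + e_n], obtained from [T n.-1] through the sign change of
    [n]. The next lemmas show that it satisfies the relations of the last generator of type D, so
    that the results on [rb] hold in both types. *)
Let b := - (T n * T n.-1 * T n).

Lemma TnN k : (0 < k)%N -> (k.+1 < n)%N -> tw (T n) (T k) (T k).
Proof. by move=> k0 kn; rewrite /tw (Tanti k0 kn) // opprK. Qed.

Lemma b_sq : (1 < n)%N -> b * b = 1.
Proof.
move=> n1; have Tn : T n * T n = 1 by apply: Tsq; lia.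
rewrite /b mulrNN -!mulrA (mulrA (T n) (T n)) Tn mul1r.
by rewrite (mulrA (T n.-1)) Tsq ?mul1r //; lia.
Qed.

Lemma b_tw k : (0 < k < n)%N -> k.+2 != n -> tw (T k) b b.
Proof.
move=> kn k2; apply: twN.
have [e|ne] := eqVneq k.+1 n; last first.
  by apply: tw_anti; apply: Tanti; lia.
have := Tbraid4; rewrite -e /= => /(_ ltac:(lia)); rewrite /tw !mulrA.
by move=> ->; rewrite opprK.
Qed.

(** As [T n] anticommutes with [T k], the two sides are, up to a common sign, the conjugates by
    [T n] of the two sides of the braid relation between [T k] and [T k.+1]. *)
Lemma b_braid k : (0 < k)%N -> k.+2 = n -> T k * b * T k = b * T k * b.
Proof.
move=> k0 e; have Tn : T n * T n = 1 by apply: Tsq; lia.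
have En : T k * T n = - (T n * T k) by apply: Tanti; lia.
have Bk := @Tbraid k k0 ltac:(lia).
have -> : b = - (T n * T k.+1 * T n) by rewrite /b -[in T n.-1]e.
set p := T k.+1 in Bk *; set q := T k in En Bk *; set s := T n in Tn En *.
have sq : s * q = - (q * s) by rewrite En opprK.
have <- : - (s * (q * p * q) * s) = q * (- (s * p * s)) * q.
  by rewrite !(mulrN, mulNr) !mulrA sq !mulNr -(mulrA _ q s) En !(mulrN, mulNr) !opprK !mulrA.
rewrite Bk !(mulrN, mulNr) opprK !mulrA -(mulrA (s * p) s q) sq.
by rewrite !(mulrN, mulNr) !mulrA -(mulrA _ s s) Tn mulr1.
Qed.

Section SignChanges.
Variable q : nat -> A.
Hypothesis q_base : q n = T n.
Hypothesis q_step : forall i, (i < n)%N -> q i = - (T i * q i.+1 * T i).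

(** The same downward induction as for brackets, with [k = n] allowed. The generator [T n] meets a
    factor it does not anticommute with only for [i = n - 1], and there the relation of order 4
    replaces the braid relation. *)
Lemma q_fix k i : (0 < i <= n)%N -> (0 < k <= n)%N ->
  k != i -> k.+1 != i -> tw (T k) (q i) (q i).
Proof.
have [m] := ubnP (n - i); elim: m => // m IH in i k * => lm i0 k0 ki ki'.
have [e|ne] := eqVneq i n.
  by subst i; rewrite q_base; apply: Tanti; lia.
rewrite q_step; last lia; apply: twN.
have [e|ne'] := eqVneq k i.+1; last first.
  apply: tw_anti; last by apply: IH; lia.
  have [ik|ki''] := ltnP i k; last by apply: Tanti; lia.
  by rewrite /tw (@Tanti i k) ?opprK //; lia.
have [e'|ne''] := eqVneq k n.
  have -> : q i.+1 = T n by rewrite -q_base -e e'.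
  have -> : T i = T n.-1 by rewrite -e' e.
  by rewrite e'; apply: Tbraid4; lia.
rewrite q_step; last lia.
rewrite e mulrN mulNr; apply: twN; apply: tw_braid; first by rewrite Tbraid //; lia.
by apply: IH; lia.
Qed.

Lemma q_tw k i : (0 < i <= n)%N -> (0 < k < n)%N ->
  tw (T k) (q i) (q (nswap k i)).
Proof.
move=> i0 k0; have Tk : T k * T k = 1 by apply: Tsq; lia.
have [e|ne] := eqVneq i k.
  rewrite e nswap_l q_step; last lia.
  by apply: tw_sym => //; apply: tw_conj.
have [e|ne'] := eqVneq i k.+1.
  rewrite e nswap_r (@q_step k); last lia.
  exact: tw_conj.
by rewrite nswap_id //; apply: q_fix; lia.
Qed.

End SignChanges.

Variable r : nat -> nat -> A.
Hypothesis r_base : forall i, r i i.+1 = T i.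
Hypothesis r_step : forall i j, (i < j)%N -> r i j.+1 = - (T j * r i j * T j).
Variable rb : nat -> nat -> A.
Hypothesis rb_base : (1 < n)%N -> rb n.-1 n = b.
Hypothesis rb_stepn : forall i, (i.+1 < n)%N ->
  rb i n = - (T i * rb i.+1 n * T i).
Hypothesis rb_step : forall i j, (i < j)%N -> (j < n)%N ->
  rb i j = - (T j * rb i j.+1 * T j).
Let Tn : (0 < n)%N -> T n * T n = 1.
Proof. by move=> n0; apply: Tsq; lia. Qed.

Lemma Tn_r_fix i j : (0 < i)%N -> (i < j)%N -> (j < n)%N ->
  tw (T n) (r i j) (r i j).
Proof.
move=> i0; elim: j => // j IH ij jn.
have [e|ne] := eqVneq j i; first by rewrite e r_base; apply: TnN; lia.
rewrite r_step; last lia.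
by apply: twN; apply: tw_anti; [apply: TnN; lia|apply: IH; lia].
Qed.

(** The sign change of [n] carries [e_i - e_n] to [e_i + e_n]; for [i = n - 1] this is how [b] was
    defined. *)
Lemma Tn_r_n i : (0 < i)%N -> (i < n)%N -> tw (T n) (r i n) (rb i n).
Proof.
have [m] := ubnP (n - i); elim: m => // m IH in i * => lm i0 lin.
have [e|ne] := eqVneq i.+1 n.
  have -> : rb i n = b by rewrite -rb_base -?e //; lia.
  have -> : r i n = T n.-1 by rewrite -e r_base.
  by apply: tw_conj; apply: Tn; lia.
rewrite rb_stepn //; last lia.
rewrite (@r_left A n T _ _ Tbraid r) //; try lia.
- by apply: twN; apply: tw_anti; [apply: TnN; lia|apply: IH; lia].
- by move=> k kn; apply: Tsq; lia.
- by move=> k l k0 kl ln; apply: Tanti; lia.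
Qed.

(** For [j = n - 1], the element is, up to sign, [r i j] conjugated by [T j * T n * T j]. By the
    relation of order 4, [T n] anticommutes with this whole product, so [tw_anti] applies to it as
    to a single factor. *)
Lemma Tn_rb_fix i j : (0 < i)%N -> (i < j)%N -> (j < n)%N ->
  tw (T n) (rb i j) (rb i j).
Proof.
have [m] := ubnP (n - j); elim: m => // m IH in j * => lm i0 ij jn.
rewrite rb_step //; apply: twN.
have [e|ne] := eqVneq j.+1 n; last first.
  by apply: tw_anti; [apply: TnN; lia|apply: IH; lia].
have n1 : (1 < n)%N by lia.
have -> : rb i j.+1 = T n * (T j * r i j * T j) * T n.
  have n0 : (0 < n)%N by lia.
  rewrite e (tw_eq (Tn n0) (Tn_r_n i0 (ltn_trans ij jn))).
  by rewrite -[in r i n]e r_step // mulrN mulNr opprK.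
have -> : T j * (T n * (T j * r i j * T j) * T n) * T j =
   (T n.-1 * T n * T n.-1) * r i j * (T n.-1 * T n * T n.-1).
  by rewrite -!mulrA -[in T n.-1]e.
by apply: tw_anti; [apply: Tbraid4|apply: Tn_r_fix].
Qed.

End ReflectionElementsB.

(** * Recursions satisfied by the brackets of the presentation *)

Section BracketRecursion.
Variables (X : weyl_type) (n : nat) (A : pzRingType).
Variable t : 'I_(cox_rank X n) -> A.
Local Notation T := (tgen t).

Lemma tgenE (k : 'I_(cox_rank X n)) : T k.+1 = t k.
Proof. by rewrite /tgen /= valK. Qed.

Lemma tup_nil i j : (j < i)%N -> tup t i j = 1.
Proof. by move=> ji; rewrite /tup big_geq. Qed.

Lemma tdown_nil i j : (i < j)%N -> tdown t i j = 1.
Proof. by move=> ij; rewrite /tdown /index_iota (_ : i.+1 - j = 0)%N ?big_nil //; lia. Qed.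

Lemma tup_recl i j : (i <= j)%N -> tup t i j = T i * tup t i.+1 j.
Proof. by move=> ij; rewrite /tup big_ltn. Qed.

Lemma tup_recr i j : (i <= j.+1)%N -> tup t i j.+1 = tup t i j * T j.+1.
Proof. by move=> ij; rewrite /tup big_nat_recr. Qed.

Lemma tdown_recr i j : (j <= i)%N -> tdown t i j = tdown t i j.+1 * T j.
Proof.
move=> ji; rewrite /tdown /index_iota subSn // [(i.+1 - j.+1)%N]subSS.
by rewrite [iota j _]/= rev_cons big_rcons.
Qed.

Lemma tdown_recl i j : (j <= i.+1)%N -> tdown t i.+1 j = T i.+1 * tdown t i j.
Proof.
move=> ji; rewrite /tdown /index_iota subSn // -addn1 iotaD.
by rewrite rev_cat big_cat /= big_seq1 subnKC.
Qed.

Lemma br_lt_base i : br_lt t i i.+1 = T i.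
Proof.
rewrite /br_lt subSnn !subn1 tdown_nil ?ltnS // tup_recl // tup_nil //.
by rewrite expr0 !mul1r mulr1.
Qed.

Lemma br_lt_step i j : (i < j)%N ->
  br_lt t i j.+1 = - (T j * br_lt t i j * T j).
Proof.
case: j => // j ij; rewrite /br_lt !subn1 /= tdown_recl // tup_recr; last lia.
rewrite (_ : (j.+2 - i).-1 = (j.+1 - i).-1.+1)%N; last lia.
rewrite exprS mulN1r mulNr; congr (- _).
by rewrite !mulrA -(commr_sign (T j.+1)) -!mulrA.
Qed.

(** The barred bracket with its middle factor left free. Type D has [m = t_n]; type B has
    [m = - (t_n t_(n-1) t_n)], whose sign accounts for the exponent [j - i] in place of
    [j - i - 1]. *)
Definition rbm m i j := (-1) ^+ (j - i - 1) *
  (tup t j (n - 1) * tup t i (n - 2) * m * tdown t (n - 2) i * tdown t (n - 1) j).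

Lemma rbm_base m : (1 < n)%N -> rbm m n.-1 n = m.
Proof.
move=> n1; rewrite /rbm tup_nil; last lia.
rewrite tup_nil; last lia.
rewrite tdown_nil; last lia.
rewrite tdown_nil; last lia.
by rewrite (_ : n - n.-1 - 1 = 0)%N ?expr0 ?mul1r ?mulr1 //; lia.
Qed.

Lemma rbm_stepn m i : (i.+1 < n)%N ->
  rbm m i n = - (T i * rbm m i.+1 n * T i).
Proof.
move=> lin; rewrite /rbm tup_nil; last lia.
rewrite [tdown t _ n]tdown_nil; last lia.
rewrite [tup t i _]tup_recl; last lia.
rewrite [tdown t _ i]tdown_recr; last lia.
rewrite (_ : n - i - 1 = (n - i.+1 - 1).+1)%N; last lia.
rewrite exprS mulN1r mulNr; congr (- _).
by rewrite !mul1r !mulr1 !mulrA -(commr_sign (T i)) -!mulrA.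
Qed.

Lemma rbm_step m i j : (i < j)%N -> (j < n)%N ->
  rbm m i j = - (T j * rbm m i j.+1 * T j).
Proof.
move=> ij jn; rewrite /rbm [tup t j _]tup_recl; last lia.
rewrite [tdown t _ j]tdown_recr; last lia.
rewrite (_ : j.+1 - i - 1 = (j - i - 1).+1)%N; last lia.
rewrite exprS mulN1r mulNr !mulrN mulNr opprK.
by rewrite !mulrA -(commr_sign (T j)) -!mulrA.
Qed.

End BracketRecursion.

Lemma br_bar_B n (A : pzRingType) (t : 'I_(cox_rank TypeB n) -> A) i j :
  (i < j)%N ->
  br_bar_lt t i j = rbm t (- (tgen t n * tgen t n.-1 * tgen t n)) i j.
Proof.
move=> ij; rewrite /rbm /= (_ : j - i = (j - i - 1).+1)%N; last lia.
rewrite exprS mulN1r mulNr -mulrN subn1 /=; congr (_ * _).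
  by rewrite subn1.
by rewrite mulrN !mulNr subn1.
Qed.

Lemma sbr_base n (A : pzRingType) (t : 'I_(cox_rank TypeB n) -> A) :
  sbr_bar t n = tgen t n.
Proof.
rewrite /sbr_bar subnn mul1r tup_recl // tup_nil // mulr1.
case: n t => [|n] t; last by rewrite tdown_nil ?mulr1 // subn1.
(* For [n = 0] the truncated [n - 1] leaves one factor in [tdown], but there are no generators and
   [tgen] takes its default value 0 on both sides. *)
by rewrite /tdown big_seq1 /tgen insubF // mul0r.
Qed.

Lemma sbr_step n (A : pzRingType) (t : 'I_(cox_rank TypeB n) -> A) i :
  (i < n)%N -> sbr_bar t i = - (tgen t i * sbr_bar t i.+1 * tgen t i).
Proof.
move=> lin; rewrite /sbr_bar tup_recl; last lia.
rewrite [tdown t _ i]tdown_recr; last lia.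
rewrite (_ : n - i = (n - i.+1).+1)%N; last lia.
rewrite exprS mulN1r mulNr; congr (- _).
by rewrite !mulrA -(commr_sign (tgen t i)) -!mulrA.
Qed.

(** * Simple reflections as signed permutations *)

Section SimpleReflections.
Variable n : nat.
Implicit Types (i j k : 'I_n) (b : bool) (p q : 'I_n * bool).

Lemma transpE i j k b : i != j -> transp i j (k, b) = (tperm i j k, b).
Proof.
move=> ij; have D c x : tperm (i, c) (j, c) (x, ~~ c) = (x, ~~ c).
  by rewrite tpermD // xpair_eqE; case: c; rewrite andbF.
rewrite /transp permM.
case: (tpermP i j k) => [->|->|/eqP ki /eqP kj].
- by case: b; [rewrite (D false) tpermL|rewrite tpermL (D true)].
- by case: b; [rewrite (D false) tpermR|rewrite tpermR (D true)].
by rewrite !tpermD // xpair_eqE negb_and eq_sym ?ki ?kj.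
Qed.

Lemma transp_barE i j k b : i != j ->
  transp_bar i j (k, b) = (tperm i j k, b (+) ((k == i) || (k == j))).
Proof.
move=> ij; have ji : j != i by rewrite eq_sym.
have Di c : tperm (i, c) (j, ~~ c) (i, ~~ c) = (i, ~~ c).
  by rewrite tpermD // xpair_eqE negb_and ?ji //; case: c; rewrite orbT.
have Dj c : tperm (i, c) (j, ~~ c) (j, c) = (j, c).
  by rewrite tpermD // xpair_eqE negb_and ?ij //; case: c; rewrite orbT.
rewrite /transp_bar permM.
case: (tpermP i j k) => [->|->|/eqP ki /eqP kj].
- rewrite eqxx addbT; case: b.
    by rewrite (Di false) tpermL.
  by rewrite tpermL (Dj true).
- rewrite eqxx orbT addbT; case: b.
    by rewrite tpermR (Di true).
  by rewrite (Dj false) tpermR.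
rewrite (negPf ki) (negPf kj) addbF.
by rewrite !tpermD // xpair_eqE negb_and eq_sym ?ki ?kj.
Qed.

Lemma sign_changeE i k b : sign_change i (k, b) = (k, b (+) (k == i)).
Proof.
rewrite /sign_change; have [->|ki] := eqVneq k i; rewrite ?addbT ?addbF.
  by case: b; rewrite ?tpermL ?tpermR.
by rewrite tpermD // xpair_eqE eq_sym (negPf ki).
Qed.

Lemma signed_ext p q : p.1 = q.1 :> nat -> p.2 = q.2 -> p = q.
Proof. by case: p q => [p a] [q b] /= /val_inj-> ->. Qed.

End SimpleReflections.

Lemma tperm_nswap n (i j k : 'I_n) (m : nat) : i.+1 = m -> j = m :> nat ->
  (tperm i j k).+1 = nswap m k.+1.
Proof.
move=> im jm; rewrite -im; case: tpermP => [->|->|/eqP ki /eqP kj].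
- by rewrite nswap_l jm im.
- by rewrite jm -im nswap_r.
by move: ki kj; rewrite -!val_eqE /= => ki kj; rewrite nswap_id //; lia.
Qed.

(** The simple reflections as arithmetic on an index starting at 1 and a sign. In this form the
    Coxeter relations are finite case distinctions. *)
Definition swapA a (x : nat * bool) := (nswap a x.1, x.2).
Definition swapD n (x : nat * bool) :=
  (nswap n.-1 x.1, x.2 (+) ((x.1 == n) || (x.1 == n.-1))).
Definition swapB n (x : nat * bool) := (x.1, x.2 (+) (x.1 == n)).

(** Equality tests are split from the inside out: those whose left side still contains a conditional
    wait until it is evaluated. *)
Ltac swap_cases :=
  rewrite /swapA /swapD /swapB /nswap /=;
  repeat match goal with
  | |- context [?x == ?y] =>
    lazymatch x with
    | context [if _ then _ else _] => fail
    | _ => case: (@eqP _ x y) => ? /=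
    end
  end; try (exfalso; lia);
  congr (_, _); first [lia | by rewrite ?addbT ?addbF ?negbK].

Lemma swap_comm a b x : (a.+1 < b)%N ->
  swapA a (swapA b x) = swapA b (swapA a x).
Proof. by case: x => x e ab; swap_cases. Qed.

Lemma swap_braid a x :
  swapA a (swapA a.+1 (swapA a x)) = swapA a.+1 (swapA a (swapA a.+1 x)).
Proof. by case: x => x e; swap_cases. Qed.

Lemma swapD_comm n a x : (a < n)%N -> a.+2 != n ->
  swapA a (swapD n x) = swapD n (swapA a x).
Proof.
case: x => x e an a2; have [->|ne] := eqVneq a n.-1; first by swap_cases.
have {}ne : (a.+1 < n.-1)%N by lia.
by swap_cases.
Qed.

Lemma swapD_braid a x :
  swapA a (swapD a.+2 (swapA a x)) = swapD a.+2 (swapA a (swapD a.+2 x)).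
Proof. by case: x => x e; swap_cases. Qed.

Lemma swapB_comm n a x : (a.+1 < n)%N ->
  swapA a (swapB n x) = swapB n (swapA a x).
Proof. by case: x => x e an; swap_cases. Qed.

Lemma swapB_braid4 a x :
  swapA a (swapB a.+1 (swapA a (swapB a.+1 x))) =
  swapB a.+1 (swapA a (swapB a.+1 (swapA a x))).
Proof. by case: x => x e; swap_cases. Qed.

(** * Orders of products of simple reflections and the resulting spin relations *)

Section CoxeterRelations.
Variables (X : weyl_type) (n : nat).
Hypothesis Xn : valid_size X n.
Implicit Types (k l : 'I_(cox_rank X n)) (p q : 'I_n * bool).
Local Notation s := (@simple_refl X n).

Lemma simple_refl_lt k p : (k.+1 < n)%N ->
  ((s k p).1.+1 = nswap k.+1 p.1.+1) * ((s k p).2 = p.2).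
Proof.
case: p => i b kn; rewrite /simple_refl /= kn transpE /=; last first.
  by apply/eqP => /(congr1 val) /=; rewrite modn_small //; lia.
by rewrite (@tperm_nswap _ _ _ _ k.+1) // /= modn_small.
Qed.

Lemma simple_refl_D k p : X = TypeD -> k.+1 = n ->
  ((s k p).1.+1 = nswap n.-1 p.1.+1) *
  ((s k p).2 = p.2 (+) ((p.1.+1 == n) || (p.1.+1 == n.-1))).
Proof.
move=> XD; move: Xn k; rewrite XD /= => n1 k kn; case: p => i b.
rewrite /simple_refl /= kn ltnn.
have kp : ((k + n).-1 %% n = k.-1)%N.
  have k0 : (0 < k)%N by lia.
  by rewrite -(prednK k0) addSn /= modnDr modn_small //; lia.
rewrite transp_barE /=; last first.
  by apply/eqP => /(congr1 val) /=; rewrite kp; lia.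
rewrite (@tperm_nswap _ _ _ _ n.-1) /= ?kp; try lia.
by split=> //; rewrite -!val_eqE /= kp; congr (_ (+) _); lia.
Qed.

Lemma simple_refl_B k p : X = TypeB -> k.+1 = n ->
  ((s k p).1 = p.1) * ((s k p).2 = p.2 (+) (p.1.+1 == n)).
Proof.
move=> XB; move: Xn k; rewrite XB /= => n1 k kn; case: p => i b.
rewrite /simple_refl /= kn ltnn sign_changeE /=; split=> //.
by rewrite -val_eqE /=; congr (_ (+) _); lia.
Qed.

Lemma simple_refl_last k : ~~ (k.+1 < n)%N ->
  (k.+1 = n) * ((X = TypeD) + {X = TypeB}).
Proof.
move=> kn; have kr := ltn_ord k; split; first by have := rank_le X n; lia.
by move: kr; case: X k kn => /= *; [lia|left|right].
Qed.
Lemma signed_extS p q : p.1.+1 = q.1.+1 -> p.2 = q.2 -> p = q.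
Proof. by move=> [e1] e2; apply: signed_ext. Qed.

Lemma nswapK (k i : nat) : nswap k (nswap k i) = i.
Proof.
have [->|ik] := eqVneq i k; first by rewrite nswap_l nswap_r.
have [->|ik'] := eqVneq i k.+1; first by rewrite nswap_r nswap_l.
by rewrite !nswap_id.
Qed.

Lemma nswap_pair (k i : nat) :
  (nswap k i == k.+1) || (nswap k i == k) = (i == k.+1) || (i == k).
Proof.
have [->|ik] := eqVneq i k; first by rewrite nswap_l eqxx orbT.
have [->|ik'] := eqVneq i k.+1; first by rewrite nswap_r eqxx orbT.
by rewrite !nswap_id // (negPf ik) (negPf ik').
Qed.

Lemma simple_reflK k p : s k (s k p) = p.
Proof.
have [kn|] := boolP (k.+1 < n)%N.
  by apply: signed_extS; rewrite !(simple_refl_lt _ kn) ?nswapK.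
move/simple_refl_last=> [kn [XD|XB]].
  apply: signed_extS; rewrite !(simple_refl_D _ XD kn) ?nswapK // -addbA.
  have := nswap_pair n.-1 p.1.+1; rewrite (_ : n.-1.+1 = n); last by rewrite -kn.
  by move=> ->; rewrite addbb addbF.
by apply: signed_ext; rewrite !(simple_refl_B _ XB kn) // -addbA addbb addbF.
Qed.

Lemma order_two (g : signed_perm n) : (g * g = 1 -> g != 1 -> #[g] = 2)%g.
Proof.
move=> gg g1; have : (#[g]%g %| 2)%N by rewrite order_dvdn expgS expg1 gg.
by rewrite dvdn_divisors // !inE order_eq1 (negPf g1) => /eqP.
Qed.

Lemma cox_order_id k : cox_order k k = 1%N.
Proof.
rewrite /cox_order (_ : (_ * _)%g = 1%g) ?order1 //.
by apply/permP=> p; rewrite permM simple_reflK perm1.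
Qed.

(** The spin relations involve the exact order, including its parity, so an upper bound is not
    enough: a point at which the reflections differ excludes order 1. *)
Lemma cox_order_comm k l : (forall p, s k (s l p) = s l (s k p)) ->
  (exists p, s k p <> s l p) -> cox_order k l = 2.
Proof.
move=> kl [p0 np]; apply: order_two.
  by apply/permP=> p; rewrite !permM perm1 -kl !simple_reflK.
by apply/eqP=> /permP/(_ (s k p0)); rewrite permM perm1 simple_reflK => /esym.
Qed.

Lemma cox_order_braid k l : (forall p, s k (s l (s k p)) = s l (s k (s l p))) ->
  (exists p, s k p <> s l p) -> cox_order k l = 3.
Proof.
move=> kl [p0 np]; apply/eqP; rewrite /cox_order; set g := (_ * _)%g.
have g3 : (g ^+ 3 = 1)%g.
  by apply/permP=> p; rewrite !expgS expg0 !permM !perm1 -kl !simple_reflK.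
have : (#[g]%g %| 3)%N by rewrite order_dvdn g3.
rewrite dvdn_divisors // !inE => /orP[|//]; rewrite order_eq1 => /eqP g1.
case: np; have := congr1 (fun h : signed_perm n => h (s k p0)) g1.
by rewrite permM perm1 simple_reflK => /esym.
Qed.

(** The order divides 4, and a point at which the two reflections do not commute excludes 1 and
    2. *)
Lemma cox_order_braid4 k l :
  (forall p, s k (s l (s k (s l p))) = s l (s k (s l (s k p)))) ->
  (exists p, s k (s l p) <> s l (s k p)) -> cox_order k l = 4.
Proof.
move=> kl [p0 np]; apply/eqP; rewrite /cox_order; set g := (_ * _)%g.
have g4 : (g ^+ 4 = 1)%g.
  by apply/permP=> p; rewrite !expgS expg0 !permM !perm1 kl !simple_reflK.
have : (#[g]%g %| 4)%N by rewrite order_dvdn g4.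
rewrite dvdn_divisors // !inE => /or3P[|/eqP d2|//].
  rewrite order_eq1 => /eqP g1; case: np.
  have E x : s l (s k x) = x.
    by have := congr1 (fun h : signed_perm n => h x) g1; rewrite permM perm1.
  by rewrite E -[LHS](simple_reflK l) E simple_reflK.
case: np; have : (g ^+ 2 = 1)%g by apply/eqP; rewrite -order_dvdn d2.
rewrite expgS expg1 => /(congr1 (fun h : signed_perm n => h (s k p0))).
rewrite !permM perm1 simple_reflK => e.
by rewrite -[RHS](simple_reflK l) -e !simple_reflK.
Qed.

Variables (A : pzRingType) (t : 'I_(cox_rank X n) -> A).
Hypothesis t_spin : forall k l,
  (t k * t l) ^+ cox_order k l = (-1) ^+ (cox_order k l).+1.

Lemma t_sq k : t k * t k = 1.
Proof. by have := t_spin k k; rewrite cox_order_id expr1 sqrrN expr1n. Qed.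

Lemma t_comm k l : cox_order k l = 2 -> tw (t k) (t l) (t l).
Proof.
move=> e; have := t_spin k l; rewrite e => E.
have {}E : t k * t l * (t k * t l) = -1 by rewrite -expr2 E -signr_odd.
rewrite /tw -[t l * t k]mul1r -[1]opprK -E mulNr opprK !mulrA.
by rewrite -(mulrA _ (t l) (t l)) t_sq mulr1 -(mulrA _ (t k) (t k)) t_sq mulr1.
Qed.

Lemma t_braid3 k l : cox_order k l = 3 -> t k * t l * t k = t l * t k * t l.
Proof.
move=> e; have := t_spin k l; rewrite e => E.
have {}E : t k * t l * t k * (t l * t k * t l) = 1.
  by rewrite !mulrA; move: E; rewrite -signr_odd !exprS expr0 !mulr1 !mulrA.
have e' : t l * t k * t l * (t l * t k * t l) = 1.
  by rewrite !mulrA -(mulrA _ (t l) (t l)) t_sq mulr1 -(mulrA _ (t k) (t k)) t_sq mulr1 t_sq.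
by rewrite -[LHS]mulr1 -e' mulrA E mul1r.
Qed.

(** Here [(t k * t l) ^+ 4 = -1]. Since [t k * t l * t k] is an involution, this relation amounts to
    its anticommuting with [t l], the form in which [tw_anti] can use it. *)
Lemma t_braid4 k l : cox_order k l = 4 ->
  tw (t l) (t k * t l * t k) (t k * t l * t k).
Proof.
move=> e; have := t_spin k l; rewrite e => E.
have {}E : t k * t l * t k * (t l * (t k * t l * t k)) * t l = -1.
  by rewrite !mulrA; move: E; rewrite -signr_odd !exprS expr0 !mulr1 !mulrA.
have e' : t k * t l * t k * (t k * t l * t k) = 1.
  by rewrite !mulrA -(mulrA _ (t k) (t k)) t_sq mulr1 -(mulrA _ (t l) (t l)) t_sq mulr1 t_sq.
move: E e'; set P := t k * t l * t k => E e'.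
have E2 : P * (t l * P) = - t l.
  by rewrite -[LHS]mulr1 -(t_sq l) mulrA E mulN1r.
by rewrite /tw -[X in X * P]opprK -E2 mulNr -(mulrA P) -(mulrA (t l)) e' mulr1.
Qed.

Definition cd p := (p.1.+1, p.2).

Lemma cd_inj : injective cd.
Proof. by move=> p q [e1 e2]; apply: signed_ext. Qed.

Lemma cdA k p : (k.+1 < n)%N -> cd (s k p) = swapA k.+1 (cd p).
Proof. by move=> kn; rewrite /cd !(simple_refl_lt _ kn). Qed.

Lemma cdD k p : X = TypeD -> k.+1 = n -> cd (s k p) = swapD n (cd p).
Proof. by move=> XD kn; rewrite /cd !(simple_refl_D _ XD kn). Qed.

Lemma cdB k p : X = TypeB -> k.+1 = n -> cd (s k p) = swapB n (cd p).
Proof. by move=> XB kn; rewrite /cd !(simple_refl_B _ XB kn). Qed.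

Lemma cdP (x : nat * bool) : (0 < x.1 <= n)%N -> exists p, cd p = x.
Proof.
case: x => [[//|m] b] /= mn; have {}mn : (m < n)%N by lia.
by exists (Ordinal mn, b).
Qed.

Lemma tgenP a : (0 < a <= cox_rank X n)%N -> exists2 k : 'I_(cox_rank X n), k.+1 = a & tgen t a = t k.
Proof.
case: a => // a an; exists (Ordinal (an : (a < cox_rank X n)%N)) => //.
exact: (tgenE t (Ordinal (an : (a < cox_rank X n)%N))).
Qed.

Lemma rank_ge : (n.-1 <= cox_rank X n)%N.
Proof. by case: X => //=; apply: leq_pred. Qed.

Lemma T_sq a : (0 < a <= cox_rank X n)%N -> tgen t a * tgen t a = 1.
Proof. by move=> /tgenP[k _ ->]; exact: t_sq. Qed.

Lemma T_anti a b : (0 < a)%N -> (a.+1 < b)%N -> (b < n)%N ->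
  tw (tgen t a) (tgen t b) (tgen t b).
Proof.
move=> a0 ab bn; have rg := rank_ge.
have [|k ka ->] := @tgenP a; first lia.
have [|l lb ->] := @tgenP b; first lia.
apply/t_comm/cox_order_comm=> [p|].
  by apply: cd_inj; rewrite !cdA ?ka ?lb; try lia; apply: swap_comm.
have [|p ep] := @cdP (a, false); first by move=> /=; lia.
exists p => /(congr1 cd); rewrite !cdA ?ka ?lb; try lia.
by rewrite ep => -[]; rewrite nswap_l nswap_id; lia.
Qed.

Lemma T_braid a : (0 < a)%N -> (a.+1 < n)%N ->
  tgen t a * tgen t a.+1 * tgen t a = tgen t a.+1 * tgen t a * tgen t a.+1.
Proof.
move=> a0 an; have rg := rank_ge.
have [|k ka ->] := @tgenP a; first lia.
have [|l lb ->] := @tgenP a.+1; first lia.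
apply/t_braid3/cox_order_braid=> [p|].
  by apply: cd_inj; rewrite !cdA ?ka ?lb; try lia; apply: swap_braid.
have [|p ep] := @cdP (a, false); first by move=> /=; lia.
exists p => /(congr1 cd); rewrite !cdA ?ka ?lb; try lia.
by rewrite ep => -[]; rewrite nswap_l nswap_id; lia.
Qed.

Lemma T_D_anti a : X = TypeD -> (0 < a < n)%N -> a.+2 != n ->
  tw (tgen t a) (tgen t n) (tgen t n).
Proof.
move=> XD an a2; have rg := rank_ge.
have rn : cox_rank X n = n by rewrite XD.
have [|k ka ->] := @tgenP a; first lia.
have [|l lb ->] := @tgenP n; first lia.
have kn : (k.+1 < n)%N by lia.
apply/t_comm/cox_order_comm=> [p|].
  apply: cd_inj; rewrite !(cdA _ kn, cdD _ XD lb) ?ka.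
  by apply: swapD_comm => //; lia.
have [|p ep] := @cdP (n, false); first by move=> /=; lia.
exists p => /(congr1 cd); rewrite !(cdA _ kn, cdD _ XD lb) ?ka ep => -[_]; by rewrite eqxx.
Qed.

Lemma T_D_braid a : X = TypeD -> (0 < a)%N -> a.+2 = n ->
  tgen t a * tgen t n * tgen t a = tgen t n * tgen t a * tgen t n.
Proof.
move=> XD a0 an; have rg := rank_ge.
have rn : cox_rank X n = n by rewrite XD.
have [|k ka ->] := @tgenP a; first lia.
have [|l lb ->] := @tgenP n; first lia.
have kn : (k.+1 < n)%N by lia.
apply/t_braid3/cox_order_braid=> [p|].
  apply: cd_inj; rewrite !(cdA _ kn, cdD _ XD lb) ?ka.
  by rewrite -an; apply: swapD_braid.
have [|p ep] := @cdP (n, false); first by move=> /=; lia.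
exists p => /(congr1 cd); rewrite !(cdA _ kn, cdD _ XD lb) ?ka.
rewrite ep => -[_]; by rewrite eqxx.
Qed.

Lemma T_B_anti a : X = TypeB -> (0 < a)%N -> (a.+1 < n)%N ->
  tw (tgen t a) (tgen t n) (tgen t n).
Proof.
move=> XB a0 an; have rg := rank_ge.
have rn : cox_rank X n = n by rewrite XB.
have [|k ka ->] := @tgenP a; first lia.
have [|l lb ->] := @tgenP n; first lia.
have kn : (k.+1 < n)%N by lia.
apply/t_comm/cox_order_comm=> [p|].
  apply: cd_inj; rewrite !(cdA _ kn, cdB _ XB lb) ?ka.
  by apply: swapB_comm.
have [|p ep] := @cdP (n, false); first by move=> /=; lia.
exists p => /(congr1 cd); rewrite !(cdA _ kn, cdB _ XB lb) ?ka.
rewrite ep => -[_]; by rewrite eqxx.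
Qed.

Lemma T_B_braid4 : X = TypeB -> (1 < n)%N ->
  tw (tgen t n) (tgen t n.-1 * tgen t n * tgen t n.-1)
    (tgen t n.-1 * tgen t n * tgen t n.-1).
Proof.
move=> XB n1; have rg := rank_ge.
have rn : cox_rank X n = n by rewrite XB.
have [|k ka ->] := @tgenP n.-1; first lia.
have [|l lb ->] := @tgenP n; first lia.
have kn : (k.+1 < n)%N by lia.
have en : n.-1.+1 = n by lia.
apply/t_braid4/cox_order_braid4=> [p|].
  apply: cd_inj; rewrite !(cdA _ kn, cdB _ XB lb) ?ka.
  by rewrite -[n in swapB n]en; apply: swapB_braid4.
have [|p ep] := @cdP (n, false); first by move=> /=; lia.
exists p => /(congr1 cd); rewrite !(cdA _ kn, cdB _ XB lb) ?ka.
have e1 : nswap n.-1 n = n.-1 by have := nswap_r n.-1; rewrite en.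
by rewrite ep /swapA /swapB /= e1 => -[]; rewrite eqxx; lia.
Qed.

End CoxeterRelations.

(** * Lifts of reflections indexed by roots *)

Lemma tw0 (A : pzRingType) (p : A) : tw p 0 0.
Proof. by rewrite /tw mulr0 mul0r oppr0. Qed.

Lemma tw_sign (A : pzRingType) (p g h : A) (e : bool) :
  tw p g h -> tw p ((-1) ^+ e * g) ((-1) ^+ e * h).
Proof. by case: e; rewrite ?mul1r // !mulN1r; apply: twN. Qed.

Definition sneg n (p : 'I_n * bool) : 'I_n * bool := (p.1, ~~ p.2).

Section SignedBrackets.
Variables (X : weyl_type) (n : nat).
Hypothesis Xn : valid_size X n.
Variables (A : pzRingType) (t : 'I_(cox_rank X n) -> A).
Hypothesis t_spin : forall k l,
  (t k * t l) ^+ cox_order k l = (-1) ^+ (cox_order k l).+1.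
Implicit Types (k l : 'I_(cox_rank X n)) (p q : 'I_n * bool).
Local Notation s := (@simple_refl X n).

(* [Rt p q] is the lift to the spin group algebra of the reflection in the root
   [e_p - e_q], where [e_(i, true) = - e_(i, false)]; likewise [R1 p] for [e_p]. *)
Definition Rt : 'I_n * bool -> 'I_n * bool -> A := locked (fun p q =>
  (-1) ^+ p.2 *
  (if p.2 == q.2 then br t p.1.+1 q.1.+1 else br_bar t p.1.+1 q.1.+1)).
Definition R1 : 'I_n * bool -> A := locked (fun p =>
  (-1) ^+ p.2 * sbr_bar t p.1.+1).

Lemma R1E p : R1 p = (-1) ^+ p.2 * sbr_bar t p.1.+1.
Proof. by rewrite /R1 -lock. Qed.

Let Tsq a : (0 < a < n)%N -> tgen t a * tgen t a = 1.
Proof. by move=> an; apply: T_sq => //; have := rank_ge X n; lia. Qed.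

Let Tsqn a : (X = TypeD \/ X = TypeB) -> (0 < a <= n)%N -> tgen t a * tgen t a = 1.
Proof. by move=> DB an; apply: T_sq => //; case: DB => -> /=; lia. Qed.

Let Tanti a b : (0 < a)%N -> (a.+1 < b)%N -> (b < n)%N ->
  tw (tgen t a) (tgen t b) (tgen t b).
Proof. exact: T_anti. Qed.

Let Tbraid a : (0 < a)%N -> (a.+1 < n)%N ->
  tgen t a * tgen t a.+1 * tgen t a = tgen t a.+1 * tgen t a * tgen t a.+1.
Proof. exact: T_braid. Qed.

Let TDanti (XD : X = TypeD) a := @T_D_anti X n Xn A t t_spin a XD.
Let TBanti (XB : X = TypeB) a : (0 < a)%N -> (a.+1 < n)%N ->
  tw (tgen t a) (tgen t n) (tgen t n).
Proof. exact: T_B_anti. Qed.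

Let TBanti' (XB : X = TypeB) a b : (0 < a)%N -> (a.+1 < b)%N -> (b <= n)%N ->
  tw (tgen t a) (tgen t b) (tgen t b).
Proof.
move=> a0 ab bn; have [->|ne] := eqVneq b n; last by apply: Tanti; lia.
by apply: TBanti => //; have := ab; lia.
Qed.

Let TBsq (XB : X = TypeB) a : (0 < a <= n)%N -> tgen t a * tgen t a = 1.
Proof. by move=> an; apply: Tsqn => //; right. Qed.

Let TB4 (XB : X = TypeB) := @T_B_braid4 X n Xn A t t_spin XB.

Lemma br_tw k i j : (k.+1 < n)%N -> (0 < i <= n)%N -> (0 < j <= n)%N -> i != j ->
  tw (t k) (br t i j) (br t (nswap k.+1 i) (nswap k.+1 j)).
Proof.
move=> kn i0 j0 ij; rewrite -tgenE.
exact: (r_tw Tsq Tanti Tbraid (br_lt_base t) (br_lt_step t)).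
Qed.

(* The root element of [e_(n-1) + e_n], from which all barred brackets arise. *)
Definition bar_mid : A :=
  if X is TypeD then tgen t n else - (tgen t n * tgen t n.-1 * tgen t n).

Lemma mid_D : X = TypeD -> bar_mid = tgen t n.
Proof.
by rewrite /bar_mid; move: (tgen t n) (tgen t n.-1) => a b XD; rewrite XD.
Qed.

Lemma mid_B : X = TypeB -> bar_mid = - (tgen t n * tgen t n.-1 * tgen t n).
Proof.
by rewrite /bar_mid; move: (tgen t n) (tgen t n.-1) => a b XB; rewrite XB.
Qed.

Lemma typeDB : X <> TypeA -> X = TypeD \/ X = TypeB.
Proof. by case: X => [[]||] //; [left|right]. Qed.

Lemma br_barE i j : X <> TypeA -> i != j ->
  br_bar t i j = rbext (rbm t bar_mid) i j.
Proof.
move=> XA ij; rewrite /br_bar /rbext /bar_mid.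
case: X t XA => [t' []|t' _|t' _] //.
by case: ltnP => ij'; rewrite br_bar_B //; lia.
Qed.

Lemma mid_sq : X <> TypeA -> (1 < n)%N -> bar_mid * bar_mid = 1.
Proof.
move=> XA n1; have [XD|XB] := typeDB XA.
  by rewrite !(mid_D XD); apply: Tsqn; [left|lia].
rewrite !(mid_B XB); exact: b_sq (TBsq XB) (TB4 XB) n1.
Qed.

Lemma mid_anti a : X <> TypeA -> (0 < a < n)%N -> a.+2 != n ->
  tw (tgen t a) bar_mid bar_mid.
Proof.
move=> XA an a2; have [XD|XB] := typeDB XA.
  by rewrite !(mid_D XD); apply: TDanti.
rewrite !(mid_B XB); exact: (b_tw (TBanti' XB) (TB4 XB)).
Qed.

Lemma mid_braid a : X <> TypeA -> (0 < a)%N -> a.+2 = n ->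
  tgen t a * bar_mid * tgen t a = bar_mid * tgen t a * bar_mid.
Proof.
move=> XA a0 an; have [XD|XB] := typeDB XA.
  by rewrite !(mid_D XD); apply: T_D_braid.
rewrite !(mid_B XB); exact: (b_braid (TBsq XB) (TBanti' XB) Tbraid (TB4 XB)).
Qed.
Lemma br_bar_A i j : X = TypeA -> br_bar t i j = 0.
Proof.
by rewrite /br_bar /br_bar_lt; move=> XA; case: X t XA => // t' _; rewrite if_same.
Qed.

Lemma typeAP : X = TypeA \/ X <> TypeA.
Proof. by case: X; [left|right|right]. Qed.

Lemma br_bar_tw k i j : (k.+1 < n)%N -> (0 < i <= n)%N -> (0 < j <= n)%N ->
  i != j -> tw (t k) (br_bar t i j) (br_bar t (nswap k.+1 i) (nswap k.+1 j)).
Proof.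
move=> kn i0 j0 ij; have [XA|XA] := typeAP.
  by rewrite !br_bar_A //; apply: tw0.
have n1 : (1 < n)%N by lia.
rewrite !br_barE -?tgenE //; last by apply: contra ij => /eqP/nswap_inj ->.
exact: (rb_tw Tsq Tanti Tbraid (rbm_base t bar_mid n1)
  (@rbm_stepn X n A t bar_mid) (@rbm_step X n A t bar_mid) (fun a => mid_anti XA)).
Qed.

Definition Rc (x y : nat * bool) : A := (-1) ^+ x.2 *
  (if x.2 == y.2 then br t x.1 y.1 else br_bar t x.1 y.1).

Lemma RtE p q : Rt p q = Rc (cd p) (cd q).
Proof. by rewrite /Rt -lock. Qed.

Lemma RcN x y : x.1 != y.1 -> Rc y x = - Rc x y.
Proof.
case: x y => [i a] [j c] /= ij; rewrite /Rc /= eq_sym.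
have [->|ac] := eqVneq a c.
  by rewrite -mulrN; congr (_ * _); apply: rextN; rewrite eq_sym.
rewrite -mulNr /br_bar; congr (_ * _).
  by move: ac; case: a; case: c => //= _; rewrite ?opprK.
by case: (ltngtP i j) ij => // ->; rewrite eqxx.
Qed.

(** Antisymmetry reduces to increasing indices. If at most one index lies in [n - 1, n], the facts
    [F1] to [F4] apply. If both do, the root element is, up to sign, either [t_(n-1)], which
    anticommutes with [t_n], or [t_n] itself, whose root is negated. *)
Lemma Rc_D x y : X = TypeD -> (0 < x.1 <= n)%N -> (0 < y.1 <= n)%N ->
  x.1 != y.1 -> tw (tgen t n) (Rc x y) (Rc (swapD n x) (swapD n y)).
Proof.
move=> XD; wlog xy : x y / (x.1 < y.1)%N => [wl xn yn xy|].
  have [h|h] := ltnP x.1 y.1; first exact: wl.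
  rewrite (@RcN y x) 1?[Rc (swapD n x) _]RcN 1?eq_sym //.
    by apply: twN; apply: wl => //; [lia|rewrite eq_sym].
  by apply: contra xy => /eqP/nswap_inj ->.
case: x y xy => [i a] [j c] /= ij /andP[i0 _] /andP[_ jn] _.
have XA : X <> TypeA by rewrite XD.
have n1 : (1 < n)%N by lia.
have en : n.-1.+1 = n by lia.
have lt1 : (n < n.-1)%N = false by lia.
have lt2 : (n.-1 < n)%N by lia.
have bn := rbm_base t bar_mid n1.
have H1 := mid_sq XA n1.
have H2 : forall a, _ := fun a => @mid_anti a XA.
have H3 : forall a, _ := fun a => @mid_braid a XA.
have R1 := br_lt_base t; have R2 := br_lt_step t.
have B1 := @rbm_stepn X n A t bar_mid; have B2 := @rbm_step X n A t bar_mid.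
have F1 := b_r_fix R1 R2 H2.
have F2 := b_rb_fix Tsq Tanti Tbraid R1 R2 H1 bn B1 B2 H2 H3.
have F3 := b_r_pred Tsq Tanti Tbraid R1 R2 H1 bn B1 H2 H3.
have F4 := b_r_n Tsq Tanti Tbraid R1 R2 H1 bn B1 B2 H2 H3.
have eb i' j' : (i' < j')%N -> br_bar t i' j' = rbm t bar_mid i' j'.
  by move=> h; rewrite br_barE ?rbext_lt //; lia.
have er i' j' : (i' < j')%N -> br t i' j' = br_lt t i' j'.
  by move=> h; rewrite /br h.
rewrite -(mid_D XD).
have swn e : swapD n (n, e) = (n.-1, ~~ e).
  by rewrite /swapD /= eqxx addbT; congr (_, _); have := nswap_r n.-1; rewrite en.
have swp e : swapD n (n.-1, e) = (n, ~~ e).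
  by rewrite /swapD /= eqxx orbT addbT nswap_l en.
have sw i' e : (i' < n.-1)%N -> swapD n (i', e) = (i', e).
  move=> h; rewrite /swapD /= nswap_id; try lia.
  by rewrite (_ : (i' == n) || (i' == n.-1) = false) ?addbF //; lia.
have eN e : (e == ~~ c) = (e != c) by case: e; case: (c).
have [ejn|jn'] := eqVneq j n.
  subst j; rewrite swn; have [ein|in'] := eqVneq i n.-1.
    subst i; rewrite swp /Rc /= (inj_eq negb_inj); case: ifP => _.
      rewrite signrN mulNr -mulrN; apply: tw_sign.
      have -> : - br t n n.-1 = br t n.-1 n.
        by rewrite /br lt1 lt2 opprK.
      rewrite er //; have -> : br_lt t n.-1 n = tgen t n.-1 by have := R1 n.-1; rewrite en.
      by apply: (b_anti H2); lia.
    rewrite signrN mulNr -mulrN; apply: tw_sign.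
    have -> : br_bar t n n.-1 = br_bar t n.-1 n by rewrite /br_bar lt1 lt2.
    by rewrite eb // bn /tw mulNr opprK.
  rewrite sw; last lia.
  rewrite /Rc /= eN; apply: tw_sign; case: eqP => _ /=.
    by rewrite er // eb; [apply: F4; lia|lia].
  by rewrite er ?eb; [apply/tw_sym/F3 => //; lia|lia..].
have [ejn|jn''] := eqVneq j n.-1.
  subst j; rewrite swp sw; last lia.
  rewrite /Rc /= eN; apply: tw_sign; case: eqP => _ /=.
    by rewrite er // eb; [apply: F3; lia|lia].
  by rewrite er ?eb; [apply/tw_sym/F4 => //; lia|lia..].
rewrite !sw; try lia.
rewrite /Rc; apply: tw_sign => /=; case: ifP => _.
  by rewrite er //; apply: F1; lia.
by rewrite eb //; apply: F2; lia.
Qed.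

(** The sign change of [n] affects only the roots that involve [n], exchanging [e_i - e_n] with
    [e_i + e_n], that is, an ordinary bracket with a barred one. *)
Lemma Rc_B x y : X = TypeB -> (0 < x.1 <= n)%N -> (0 < y.1 <= n)%N ->
  x.1 != y.1 -> tw (tgen t n) (Rc x y) (Rc (swapB n x) (swapB n y)).
Proof.
move=> XB; wlog xy : x y / (x.1 < y.1)%N => [wl xn yn xy|].
  have [h|h] := ltnP x.1 y.1; first exact: wl.
  rewrite (@RcN y x) 1?[Rc (swapB n x) _]RcN 1?eq_sym //.
  by apply: twN; apply: wl => //; [lia|rewrite eq_sym].
case: x y xy => [i a] [j c] /= ij /andP[i0 _] /andP[_ jn] _.
have XA : X <> TypeA by rewrite XB.
have n0 : (0 < n <= n)%N by lia.
have bn : (1 < n)%N -> rbm t bar_mid n.-1 n = - (tgen t n * tgen t n.-1 * tgen t n).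
  by move=> n1; rewrite rbm_base // mid_B.
have R1 := br_lt_base t; have R2 := br_lt_step t.
have B1 := @rbm_stepn X n A t bar_mid; have B2 := @rbm_step X n A t bar_mid.
have F1 := Tn_r_fix (TBsq XB) (TBanti' XB) (TB4 XB) R1 R2 bn.
have F2 := Tn_rb_fix (TBsq XB) (TBanti' XB) Tbraid (TB4 XB) R1 R2 bn B1 B2.
have F3 := Tn_r_n (TBsq XB) (TBanti' XB) Tbraid (TB4 XB) R1 R2 bn B1.
have eb i' j' : (i' < j')%N -> br_bar t i' j' = rbm t bar_mid i' j'.
  by move=> h; rewrite br_barE ?rbext_lt //; lia.
have er i' j' : (i' < j')%N -> br t i' j' = br_lt t i' j'.
  by move=> h; rewrite /br h.
have sw i' e : (i' < n)%N -> swapB n (i', e) = (i', e).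
  by move=> h; rewrite /swapB /= (_ : (i' == n) = false) ?addbF //; lia.
have eN e : (e == ~~ c) = (e != c) by case: e; case: (c).
rewrite sw; last lia.
have [ejn|jn'] := eqVneq j n.
  subst j; rewrite /swapB /= eqxx addbT.
  rewrite /Rc /= eN; apply: tw_sign; case: eqP => _ /=.
    by rewrite er // eb //; apply: F3.
  by rewrite er ?eb //; apply/tw_sym/F3 => //; exact: (TBsq XB n0).
rewrite sw; last lia.
rewrite /Rc; apply: tw_sign => /=; case: ifP => _.
  by rewrite er //; apply: F1; lia.
by rewrite eb //; apply: F2; lia.
Qed.

Lemma Rt_tw k p q : p.1 != q.1 -> tw (t k) (Rt p q) (Rt (s k p) (s k q)).
Proof.
move=> pq; have pq' : p.1.+1 != q.1.+1 by [].
have pn : (0 < p.1.+1 <= n)%N by rewrite ltn_ord.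
have qn : (0 < q.1.+1 <= n)%N by rewrite ltn_ord.
have [kn|] := boolP (k.+1 < n)%N; last first.
  move=> /(simple_refl_last Xn)[kn [XD|XB]].
    rewrite !RtE !(cdD Xn _ XD kn).
    by rewrite -tgenE [X in tgen t X]kn; apply: Rc_D.
  rewrite !RtE !(cdB Xn _ XB kn).
  by rewrite -tgenE [X in tgen t X]kn; apply: Rc_B.
rewrite !RtE /Rc /cd !(simple_refl_lt Xn _ kn). apply: tw_sign.
by case: ifP => _; [apply: br_tw|apply: br_bar_tw].
Qed.

Lemma RtN p q : p.1 != q.1 -> Rt q p = - Rt p q.
Proof. by move=> pq; rewrite !RtE RcN. Qed.

Lemma Rt_neg p q : Rt (sneg p) (sneg q) = - Rt p q.
Proof.
by rewrite !RtE /Rc /= (inj_eq negb_inj) signrN mulNr.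
Qed.

Lemma R1_neg p : R1 (sneg p) = - R1 p.
Proof. by rewrite !R1E /= signrN mulNr. Qed.

Lemma sbr_not_B i : X <> TypeB -> sbr_bar t i = 0.
Proof. by rewrite /sbr_bar => XB; case: X t XB => // t' []. Qed.

Lemma sbr_baseB : X = TypeB -> sbr_bar t n = tgen t n.
Proof. by move=> XB; move: t; rewrite XB; apply: sbr_base. Qed.

Lemma sbr_stepB i : X = TypeB -> (i < n)%N ->
  sbr_bar t i = - (tgen t i * sbr_bar t i.+1 * tgen t i).
Proof. by move=> XB lin; move: t; rewrite XB => t'; apply: sbr_step. Qed.

Lemma R1_tw k p : tw (t k) (R1 p) (R1 (s k p)).
Proof.
have [XB|XB] : X = TypeB \/ X <> TypeB by case: X; [right|right|left].
  have pn : (0 < p.1.+1 <= n)%N by rewrite ltn_ord.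
  have Q1 := sbr_baseB XB; have Q2 := fun i => @sbr_stepB i XB.
  have n0 : (0 < n <= n)%N by lia.
  have [kn|/(simple_refl_last Xn)[kn _]] := boolP (k.+1 < n)%N.
    rewrite !R1E !(simple_refl_lt Xn _ kn) -tgenE; apply: tw_sign.
    exact: (q_tw (TBsq XB) (TBanti' XB) Tbraid (TB4 XB) Q1 Q2).
  rewrite !R1E !(simple_refl_B Xn _ XB kn) -tgenE [X in tgen t X]kn.
  have [->|pn'] := eqVneq p.1.+1 n.
    rewrite addbT signrN mulNr -mulrN; apply: tw_sign.
    by rewrite Q1 /tw mulNr opprK.
  rewrite addbF; apply: tw_sign.
  by apply: (q_fix (TBanti' XB) Tbraid (TB4 XB) (q := sbr_bar t) Q1 Q2 pn n0); rewrite ?[n == _]eq_sym //; lia.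
by rewrite !R1E !sbr_not_B // !mulr0; apply: tw0.
Qed.

End SignedBrackets.

(** The reflection in the root [e_p - e_q], acting on signed indices; [refl1] is the reflection in
    [e_p]. *)
Definition refl n (p q r : 'I_n * bool) : 'I_n * bool :=
  if r == p then q else if r == q then p else
  if r == sneg p then sneg q else if r == sneg q then sneg p else r.

Definition refl1 n (p r : 'I_n * bool) : 'I_n * bool :=
  if r.1 == p.1 then sneg r else r.

Lemma snegK n : involutive (@sneg n).
Proof. by case=> i b; rewrite /sneg /= negbK. Qed.

Lemma sneg_eq n (p q : 'I_n * bool) : (sneg p == sneg q) = (p == q).
Proof. exact: (inj_eq (can_inj (@snegK n))). Qed.

Lemma sneg_neq n (p : 'I_n * bool) : (sneg p == p) = false.
Proof. by case: p => i [] /=; rewrite /sneg xpair_eqE andbF. Qed.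

Lemma refl_sym n (p q r : 'I_n * bool) : p.1 != q.1 -> refl p q r = refl q p r.
Proof.
move=> pq; rewrite /refl.
have [->|rp] := eqVneq r p.
  by have [->|//] := eqVneq p q.
have [//|rq] := eqVneq r q.
have [->|//] := eqVneq r (sneg p).
by rewrite sneg_eq; case: eqP => [->|].
Qed.

Lemma refl_neg n (p q r : 'I_n * bool) : p.1 != q.1 ->
  refl (sneg p) (sneg q) r = refl p q r.
Proof.
move=> pq; rewrite /refl !snegK.
have pNq : (p == sneg q) = false by apply: contraNF pq => /eqP->.
have qNp : (q == sneg p) = false by apply: contraNF pq => /eqP->.
have [->|rp] := eqVneq r p; first by rewrite eq_sym sneg_neq pNq.
by have [->|rq] := eqVneq r q; first by rewrite qNp [q == _]eq_sym sneg_neq.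
Qed.

Definition cneg (x : nat * bool) := (x.1, ~~ x.2).

Definition crefl (x y z : nat * bool) : nat * bool :=
  if z == x then y else if z == y then x else
  if z == cneg x then cneg y else if z == cneg y then cneg x else z.

Lemma swapA_refl k z : swapA k z = crefl (k, false) (k.+1, false) z.
Proof.
case: z => i b; rewrite /swapA /crefl /cneg /nswap !xpair_eqE /=.
rewrite eqbF_neg eqb_id; case: b; rewrite /= ?andbF ?andbT;
  by case: (i == k) => //; case: (i == k.+1).
Qed.

Lemma swapD_refl n z : (0 < n)%N -> swapD n z = crefl (n.-1, false) (n, true) z.
Proof.
move=> n0; have en : n.-1.+1 = n by lia.
have pn : (n == n.-1) = false by lia.
case: z => i b; rewrite /swapD /crefl /cneg /nswap !xpair_eqE /= en.
rewrite eqbF_neg eqb_id; case: b; rewrite /= ?andbF ?andbT; case: (i =P n) => [->|_];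
  by rewrite ?pn ?eqxx //=; case: eqP.
Qed.

(** * Lifts of reflections pass the generators through their reflections *)

Section ReflectionAction.
Variables (X : weyl_type) (n : nat).
Hypothesis Xn : valid_size X n.
Variables (A : pzRingType) (t : 'I_(cox_rank X n) -> A).
Hypothesis t_spin : forall k l,
  (t k * t l) ^+ cox_order k l = (-1) ^+ (cox_order k l).+1.
Implicit Types (k l : 'I_(cox_rank X n)) (p q r : 'I_n * bool).
Local Notation s := (@simple_refl X n).
Local Notation Rt := (Rt t).
Local Notation R1 := (R1 t).

Lemma simple_refl_neg k p : s k (sneg p) = sneg (s k p).
Proof.
have cdN q : cd (sneg q) = cneg (cd q) by [].
apply: cd_inj; rewrite cdN; have [kn|] := boolP (k.+1 < n)%N.
  by rewrite !(cdA Xn _ kn).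
move/(simple_refl_last Xn)=> [kn [XD|XB]].
  by rewrite !(cdD Xn _ XD kn) /swapD /cneg /= addNb.
by rewrite !(cdB Xn _ XB kn) /swapB /cneg /= addNb.
Qed.

Lemma simple_refl_fst k p q : ((s k p).1 == (s k q).1) = (p.1 == q.1).
Proof.
have [kn|] := boolP (k.+1 < n)%N.
  rewrite -val_eqE -[LHS]eqSS !(simple_refl_lt Xn _ kn) (inj_eq (@nswap_inj _)).
  by rewrite eqSS.
move/(simple_refl_last Xn)=> [kn [XD|XB]]; last by rewrite !(simple_refl_B Xn _ XB kn).
rewrite -val_eqE -[LHS]eqSS !(simple_refl_D Xn _ XD kn) (inj_eq (@nswap_inj _)).
by rewrite eqSS.
Qed.

Lemma simple_refl_inj k : injective (s k).
Proof. exact: can_inj (simple_reflK Xn k). Qed.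

Lemma refl_equiv k p q r : refl (s k p) (s k q) (s k r) = s k (refl p q r).
Proof.
rewrite /refl -!simple_refl_neg !(inj_eq (@simple_refl_inj k)).
by do !case: ifP => _ //; rewrite simple_refl_neg.
Qed.

Lemma refl1_equiv k p r : refl1 (s k p) (s k r) = s k (refl1 p r).
Proof. by rewrite /refl1 simple_refl_fst; case: ifP; rewrite ?simple_refl_neg. Qed.

Variables (e : bool) (y : 'I_n * bool -> A).
Hypothesis t_y : forall k r, t k * y r = (-1) ^+ e * (y (s k r) * t k).

(** The family [y] will be the [c_i] with signs, the [x_i] with signs, or the [eta_i] without; [e]
    records whether a lift passes them with a sign. *)
Definition acts_by (g : A) (f : 'I_n * bool -> 'I_n * bool) :=
  forall r, g * y r = (-1) ^+ e * (y (f r) * g).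

Lemma acts_byN g f : acts_by g f -> acts_by (- g) f.
Proof. by move=> h r; rewrite mulNr h !mulrN. Qed.

(** Each of the three factors contributes [(-1) ^+ e], and two of these cancel. Hence all conjugates
    of a generator pass [y] with the same sign, whatever their length. *)
Lemma acts_conj k g f f' : acts_by g f -> (forall r, f' (s k r) = s k (f r)) ->
  acts_by (t k * g * t k) f'.
Proof.
move=> h ff r; have E : f' r = s k (f (s k r)) by rewrite -ff (simple_reflK Xn).
have sC (x z : A) : x * ((-1) ^+ e * z) = (-1) ^+ e * (x * z).
  by rewrite !mulrA (commr_sign x).
rewrite -mulrA t_y E sC mulrA -(mulrA (t k) g) h sC (mulrA (t k) (y _)) t_y.
by case: e; rewrite ?mul1r ?mulN1r ?(mulNr, mulrN) ?opprK !mulrA.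
Qed.

Lemma Rt_act_step k p q : p.1 != q.1 -> acts_by (Rt p q) (refl p q) ->
  acts_by (Rt (s k p) (s k q)) (refl (s k p) (s k q)).
Proof.
move=> pq h.
rewrite (tw_eq (t_sq Xn t_spin k) (Rt_tw Xn t_spin k pq)).
by apply/acts_byN/(acts_conj h) => r; rewrite refl_equiv.
Qed.

Lemma Rt_act_sym p q : p.1 != q.1 -> acts_by (Rt p q) (refl p q) ->
  acts_by (Rt q p) (refl q p).
Proof.
move=> pq h; rewrite RtN //; apply: acts_byN => r; rewrite h refl_sym //.
Qed.

Lemma Rt_act_neg p q : p.1 != q.1 -> acts_by (Rt p q) (refl p q) ->
  acts_by (Rt (sneg p) (sneg q)) (refl (sneg p) (sneg q)).
Proof.
by move=> pq h; rewrite Rt_neg; apply: acts_byN => r; rewrite h refl_neg.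
Qed.

Definition act_at (x x' : nat * bool) := forall p q, cd p = x -> cd q = x' ->
  acts_by (Rt p q) (refl p q).

Lemma cd_refl p q r : cd (refl p q r) = crefl (cd p) (cd q) (cd r).
Proof.
have cdN w : cneg (cd w) = cd (sneg w) by [].
rewrite /refl /crefl !cdN !(inj_eq (@cd_inj n)).
by do !case: ifP.
Qed.

Lemma act_at_step k x x' z z' (f : nat * bool -> nat * bool) :
  (forall p, cd (s k p) = f (cd p)) -> f z = x -> f z' = x' -> x.1 != x'.1 ->
  act_at x x' -> act_at z z'.
Proof.
move=> cf fz fz' xx h p q ep eq.
rewrite -(simple_reflK Xn k p) -(simple_reflK Xn k q).
have e1 : cd (s k p) = x by rewrite cf ep.
have e2 : cd (s k q) = x' by rewrite cf eq.
apply: Rt_act_step; last exact: h.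
by move: xx; rewrite -e1 -e2.
Qed.

Lemma act_at_lt i j : (0 < i)%N -> (i < j)%N -> (j <= n)%N ->
  act_at (i, false) (j, false).
Proof.
move=> i0; elim: j => // j IH ij jn.
have [|k kj _] := @tgenP X n A t j; first by have := rank_ge X n; lia.
have kn : (k.+1 < n)%N by lia.
have [e'|ne] := eqVneq i j.
  subst i => p q ep eq r.
  have -> : Rt p q = t k.
    move: ep eq; rewrite RtE => -> ->; rewrite /Rc /= /br ltnSn expr0 mul1r.
    by rewrite br_lt_base -kj tgenE.
  rewrite t_y; congr (_ * (y _ * _)); apply: cd_inj.
  by rewrite cd_refl ep eq (cdA Xn _ kn) kj swapA_refl.
apply: (@act_at_step k (i, false) (j, false) _ _ (swapA j)).
- by move=> p; rewrite (cdA Xn _ kn) kj.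
- by rewrite /swapA /= nswap_id //; lia.
- by rewrite /swapA /= nswap_r.
- by rewrite /=.
by apply: IH; lia.
Qed.

Lemma act_at_bar_last : X <> TypeA -> (1 < n)%N ->
  act_at (n.-1, false) (n, true).
Proof.
move=> XA n1; have rn : cox_rank X n = n by case: X XA => [[]||].
have [|k kn _] := @tgenP X n A t n; first lia.
have [XD|XB] := typeDB XA.
  move=> p q ep eq r.
  have -> : Rt p q = t k.
    move: ep eq; rewrite RtE => -> ->; rewrite /Rc /= expr0 mul1r.
    rewrite br_barE //; last lia.
    rewrite rbext_lt; last lia.
    by rewrite rbm_base // (mid_D _ XD) -tgenE kn.
  rewrite t_y; congr (_ * (y _ * _)); apply: cd_inj.
  by rewrite cd_refl ep eq (cdD Xn _ XD kn) swapD_refl //; lia.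
apply: (@act_at_step k (n.-1, false) (n, false) _ _ (swapB n)).
- by move=> p; rewrite (cdB Xn _ XB kn).
- by rewrite /swapB /= (_ : (n.-1 == n) = false) //; lia.
- by rewrite /swapB /= eqxx.
- by move=> /=; lia.
by apply: act_at_lt; lia.
Qed.

Lemma act_at_bar i j : X <> TypeA -> (0 < i)%N -> (i < j)%N -> (j <= n)%N ->
  act_at (i, false) (j, true).
Proof.
move=> XA i0 ij jn; have n1 : (1 < n)%N by lia.
have stp (k i' j' : nat) : (0 < k < n)%N -> nswap k i' != nswap k j' ->
    act_at (nswap k i', false) (nswap k j', true) ->
    act_at (i', false) (j', true).
  move=> kn ij' h.
  have [|k' kk _] := @tgenP X n A t k; first by have := rank_ge X n; lia.
  apply: (@act_at_step k' _ _ _ _ (swapA k) _ erefl erefl) => // p.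
  by rewrite (cdA Xn) kk //; lia.
have Hn i' : (0 < i')%N -> (i' < n)%N -> act_at (i', false) (n, true).
  have [m] := ubnP (n - i'); elim: m => // m IH in i' * => lm i0' lin.
  have [->|ne] := eqVneq i' n.-1; first exact: act_at_bar_last.
  by apply: (stp i'); rewrite ?nswap_l ?[nswap i' n]nswap_id; try lia; apply: IH; lia.
have [m] := ubnP (n - j); elim: m => // m IH in j ij jn * => lm.
have [->|ne] := eqVneq j n; first by apply: Hn; lia.
by apply: (stp j); rewrite ?nswap_l ?[nswap j i]nswap_id; try lia; apply: IH; lia.
Qed.

(** Symmetry and negation reduce to [p] positive with the smaller index. Every such root is reached
    by simple reflections from one whose lift is a generator; in type B the root [e_(n-1) + e_n] is
    first obtained from [e_(n-1) - e_n] by the sign change of [n]. In type A the barred lifts are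
    0. *)
Lemma Rt_act p q : p.1 != q.1 -> acts_by (Rt p q) (refl p q).
Proof.
have H1 p' q' : p'.2 = false -> (p'.1 < q'.1)%N -> acts_by (Rt p' q') (refl p' q').
  case: p' q' => [i a] [j c] /= -> ij; have jn := ltn_ord j.
  case: c; last by apply: (@act_at_lt i.+1 j.+1).
  have [XA|XA] := typeAP X; last by apply: (@act_at_bar i.+1 j.+1).
  by move=> r; rewrite RtE /Rc /= br_bar_A // mulr0 mul0r !mulr0.
have H2 p' q' : (p'.1 < q'.1)%N -> acts_by (Rt p' q') (refl p' q').
  move=> pq'; case E: p'.2; last exact: H1.
  rewrite -[p']snegK -[q']snegK; apply: Rt_act_neg.
    by rewrite -val_eqE /=; lia.
  by apply: H1; rewrite //= E.
move=> pq; have [lpq|lqp] := ltnP p.1 q.1; first exact: H2.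
apply: Rt_act_sym; first by rewrite eq_sym.
by apply: H2; move: pq; rewrite -val_eqE /=; lia.
Qed.

Lemma R1_act p : acts_by (R1 p) (refl1 p).
Proof.
have [XB|XB] : X = TypeB \/ X <> TypeB by case: (X); [right|right|left].
  have stp k q : acts_by (R1 q) (refl1 q) -> acts_by (R1 (s k q)) (refl1 (s k q)).
    move=> h; rewrite (tw_eq (t_sq Xn t_spin k) (R1_tw Xn t_spin k q)).
    by apply/acts_byN/(acts_conj h) => r; rewrite refl1_equiv.
  case: p => i b; have rn : cox_rank X n = n by rewrite XB.
  have [m] := ubnP (n - i); elim: m => // m IH in i b * => lm.
  have lin := ltn_ord i.
  have [|k kn tk] := @tgenP X n A t i.+1; first lia.
  have [e'|ne] := eqVneq i.+1 n.
    have kn' : k.+1 = n by rewrite kn.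
    have tn : tgen t n = t k by rewrite -tgenE kn'.
    move=> r; rewrite !R1E /= e' sbr_baseB // tn -!mulrA t_y.
    rewrite !mulrA (commr_sign ((-1) ^+ b)) -!mulrA; congr (_ * _).
    rewrite mulrA -commr_sign -mulrA; congr (y _ * _).
    apply: signed_ext; rewrite !(simple_refl_B Xn _ XB kn') /refl1 /=.
      by case: ifP.
    by rewrite -[X in _ == X]e' eqSS val_eqE; case: ifP => _; rewrite ?addbT ?addbF.
  have lin' : (i.+1 < n)%N by lia.
  rewrite -[(i, b)](simple_reflK Xn k); apply: stp.
  have e1 : s k (i, b) = (Ordinal lin', b).
    apply: cd_inj; rewrite (cdA Xn) kn //.
    by rewrite /swapA /cd /= nswap_l.
  by rewrite e1; apply: IH => /=; lia.
by move=> r; rewrite !R1E sbr_not_B // mulr0 mul0r !mulr0.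
Qed.

End ReflectionAction.

(** * The commutators of the eta's and the x's *)

(** The inner product of [e_p] and [e_r], where [e_(i, true) = - e_(i, false)]. *)
Definition pairing n : 'I_n * bool -> 'I_n * bool -> int :=
  locked (fun p r => (p == r)%:Z - (p == sneg r)%:Z).

Lemma pairingE n (p r : 'I_n * bool) :
  pairing p r = (p == r)%:Z - (p == sneg r)%:Z.
Proof. by rewrite /pairing -lock. Qed.

Section Pairing.
Variable n : nat.
Implicit Types p q r w : 'I_n * bool.

Lemma pairing_negr p r : pairing p (sneg r) = - pairing p r.
Proof. by rewrite !pairingE snegK opprB. Qed.

Lemma pairing_negl p r : pairing (sneg p) r = - pairing p r.
Proof.
by rewrite !pairingE sneg_eq -(sneg_eq (sneg p)) snegK opprB.
Qed.

Lemma pairing_neq p r : p.1 != r.1 -> pairing p r = 0.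
Proof.
move=> pr; have ne x : p.1 != x.1 -> (p == x) = false.
  by move=> px; apply: contraNF px => /eqP->.
by rewrite pairingE !ne.
Qed.

Lemma pairing_id p : pairing p p = 1.
Proof. by rewrite pairingE eqxx eq_sym sneg_neq subr0. Qed.

Lemma pairing_refl1 p w r :
  pairing p (refl1 w r) = if p.1 == w.1 then - pairing p r else pairing p r.
Proof.
rewrite /refl1; case: (eqVneq r.1 w.1) => [rw|rw].
  rewrite pairing_negr; case: eqVneq => // pw; rewrite pairing_neq ?oppr0 //.
  by rewrite rw.
by case: eqP => // pw; rewrite pairing_neq ?oppr0 // pw eq_sym.
Qed.

End Pairing.

Definition signed (A : pzRingType) n (a : 'I_n -> A) : 'I_n * bool -> A :=
  locked (fun p : 'I_n * bool => (-1) ^+ p.2 * a p.1).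

Lemma signedE (A : pzRingType) n (a : 'I_n -> A) p :
  signed a p = (-1) ^+ p.2 * a p.1.
Proof. by rewrite /signed -lock. Qed.

(** The [eta_i] are permuted through the map that forgets signs; reading them on signed indices lets
    them share the results on [acts_by] with the [c_i] and [x_i]. *)
Definition unsign (A : pzRingType) n (a : 'I_n -> A) (p : 'I_n * bool) : A := a p.1.

Lemma signed_neg (A : pzRingType) n (a : 'I_n -> A) p :
  signed a (sneg p) = - signed a p.
Proof. by rewrite !signedE /= signrN mulNr. Qed.

Lemma signed_f (A : pzRingType) n (a : 'I_n -> A) i : signed a (i, false) = a i.
Proof. by rewrite !signedE mul1r. Qed.

Lemma sum_signed (A : nmodType) n (P : pred 'I_n) (F : 'I_n * bool -> A) :
  \sum_(q | P q.1) F q = \sum_(i | P i) (F (i, true) + F (i, false)).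
Proof.
rewrite (eq_bigl (fun q : 'I_n * bool => P q.1 && true)); last first.
  by move=> q; rewrite andbT.
rewrite (eq_bigr (fun q : 'I_n * bool => F (q.1, q.2))); last by case.
rewrite -(pair_big_dep P (fun _ _ => true) (fun i b => F (i, b))) /=.
by apply: eq_bigr => i _; rewrite big_bool.
Qed.

Section SignedExtension.
Variables (X : weyl_type) (n : nat).
Hypothesis Xn : valid_size X n.
Variables (A : pzRingType) (e : bool) (a : 'I_n -> A) (k : 'I_(cox_rank X n)) (g : A).

Lemma signed_ext_comm :
  (forall j, g * a j = (-1) ^+ e * (signed_act a (simple_refl k) j * g)) ->
  forall r, g * signed a r = (-1) ^+ e * (signed a (simple_refl k r) * g).
Proof.
move=> h [j b].
have {}h : g * signed a (j, false) = (-1) ^+ e * (signed a (simple_refl k (j, false)) * g).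
  by rewrite signed_f h signedE.
case: b => //; have -> : (j, true) = sneg (j, false) by [].
by rewrite (simple_refl_neg Xn) !signed_neg mulrN h mulNr mulrN.
Qed.

Lemma unsign_ext_comm :
  (forall j, g * a j = - (a (unsigned (simple_refl k) j) * g)) ->
  forall r, g * unsign a r = (-1) ^+ true * (unsign a (simple_refl k r) * g).
Proof.
move=> h [j b]; rewrite expr1 mulN1r /unsign /= h /unsigned.
case: b => //; have -> : (j, true) = sneg (j, false) by [].
by rewrite (simple_refl_neg Xn).
Qed.

End SignedExtension.

(** * The prescribed commutators and their symmetries *)

Section DeformationTerms.
Variables (X : weyl_type) (n : nat).
Hypothesis Xn : valid_size X n.
Variables (A : pzRingType) (t : 'I_(cox_rank X n) -> A) (c : 'I_n -> A).
Hypothesis t_spin : forall k l,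
  (t k * t l) ^+ cox_order k l = (-1) ^+ (cox_order k l).+1.
Hypothesis t_c : forall k j, t k * c j = - (signed_act c (simple_refl k) j * t k).
Hypothesis c_sq : forall i, c i * c i = 1.
Hypothesis c_anti : forall i j, i != j -> c i * c j = - (c j * c i).
Variables tt uu vv : A.
Hypothesis tt_comm : forall z, z * tt = tt * z.
Hypothesis uu_comm : forall z, z * uu = uu * z.
Hypothesis vv_comm : forall z, z * vv = vv * z.
Implicit Types (k l : 'I_(cox_rank X n)) (p q r w : 'I_n * bool).
Local Notation s := (@simple_refl X n).
Local Notation Rt := (Rt t).
Local Notation R1 := (R1 t).
Local Notation sc := (signed c).

(** The contribution of the root [e_p - e_q] to the commutator with [x_r]. The factor [Rt p q] moves
    the [x] by the reflection in [e_p - e_q], and [c_p c_q Rt p q] moves them by the reflection in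
    [e_p + e_q]; each coefficient is, up to sign, the pairing of [e_r] with the corresponding root.
    This is the shape that [xcomm_refl] exploits. *)
Definition kterm : 'I_n * bool -> 'I_n * bool -> 'I_n * bool -> A :=
  locked (fun p q r =>
    Rt p q *~ (pairing q r - pairing p r) +
    sc p * sc q * Rt p q *~ (pairing q r + pairing p r)).

Lemma ktermE p q r : kterm p q r =
  Rt p q *~ (pairing q r - pairing p r) +
  sc p * sc q * Rt p q *~ (pairing q r + pairing p r).
Proof. by rewrite /kterm -lock. Qed.

(* The commutator of [eta_p] with [x_r], for signed indices. *)
Definition kappa p r : A :=
  tt * (sc p *~ pairing p r) + uu * (\sum_(q | q.1 != p.1) kterm p q r)
  + vv * (R1 p *~ pairing p r).

Lemma t_sc k r : t k * sc r = - (sc (s k r) * t k).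
Proof.
have := @signed_ext_comm X n Xn A true c k (t k) _ r.
by rewrite expr1 mulN1r; apply=> j; rewrite mulN1r t_c.
Qed.

Lemma sc_sq p : sc p * sc p = 1.
Proof.
by case: p => i []; rewrite !signedE /= ?mul1r ?mulN1r ?mulrNN c_sq.
Qed.

Lemma sc_anti p q : p.1 != q.1 -> sc p * sc q = - (sc q * sc p).
Proof.
move=> pq; have H i j (b b' : bool) : i != j -> (-1) ^+ b * c i * ((-1) ^+ b' * c j) =
   - ((-1) ^+ b' * c j * ((-1) ^+ b * c i)) :> A.
  move=> ij; case: b; case: b' => /=; rewrite ?expr0 ?expr1 ?mulN1r ?mul1r ?mulrNN ?mulNr ?mulrN;
    by rewrite (c_anti ij) ?opprK.
by rewrite !signedE; apply: H.
Qed.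

Lemma pairing_simple k p r : pairing (s k p) (s k r) = pairing p r.
Proof.
by rewrite !pairingE -(simple_refl_neg Xn) !(inj_eq (@simple_refl_inj X n Xn k)).
Qed.

Lemma kterm_tw k p q r : p.1 != q.1 ->
  tw (t k) (kterm p q r) (kterm (s k p) (s k q) (s k r)).
Proof.
move=> pq; rewrite /tw !ktermE mulrDr mulrDl opprD !pairing_simple.
rewrite !mulrzAr !mulrzAl -!mulNrz (Rt_tw Xn t_spin) //; congr (_ + _ *~ _).
rewrite !mulrA t_sc !mulNr; congr (- _); rewrite -!mulrA; congr (_ * _).
by rewrite mulrA t_sc mulNr -mulrA (Rt_tw Xn t_spin) // mulrN opprK.
Qed.

Lemma kappa_tw k p r : tw (t k) (kappa p r) (kappa (s k p) (s k r)).
Proof.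
rewrite /tw /kappa !mulrDr !mulrDl !opprD !pairing_simple; congr (_ + _ + _).
- rewrite !mulrA tt_comm -!mulrA -mulrN; congr (_ * _).
  by rewrite mulrzAr mulrzAl t_sc mulNrz.
- rewrite !mulrA uu_comm -!mulrA -mulrN; congr (_ * _).
  rewrite mulr_sumr mulr_suml -sumrN.
  rewrite [RHS](reindex_inj (@simple_refl_inj X n Xn k)).
  apply: eq_big => [q|q qp]; first by rewrite (simple_refl_fst Xn).
  by rewrite kterm_tw // eq_sym.
rewrite !mulrA vv_comm -!mulrA -mulrN; congr (_ * _).
by rewrite mulrzAr mulrzAl (R1_tw Xn t_spin) mulNrz.
Qed.

Lemma Rt_sc p q r : p.1 != q.1 -> Rt p q * sc r = - (sc (refl p q r) * Rt p q).
Proof.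
move=> pq; have := @Rt_act X n Xn A t t_spin true sc _ p q pq r.
by rewrite expr1 mulN1r; apply=> k r'; rewrite mulN1r t_sc.
Qed.

Lemma R1_sc p r : R1 p * sc r = - (sc (refl1 p r) * R1 p).
Proof.
have := @R1_act X n Xn A t t_spin true sc _ p r.
by rewrite expr1 mulN1r; apply=> k r'; rewrite mulN1r t_sc.
Qed.

Lemma refl_l p q : refl p q p = q. Proof. by rewrite /refl eqxx. Qed.
Lemma refl_r p q : p.1 != q.1 -> refl p q q = p.
Proof. by move=> pq; rewrite refl_sym // refl_l. Qed.
Lemma refl_id p q r : r.1 != p.1 -> r.1 != q.1 -> refl p q r = r.
Proof.
have ne x : r.1 != x.1 -> ((r == x) = false) * ((r == sneg x) = false).
  by move=> rx; split; apply: contraNF rx => /eqP->.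
by move=> rp rq; rewrite /refl !(ne p rp) !(ne q rq).
Qed.

Lemma refl1_sneg w r : refl1 (sneg w) r = refl1 w r. Proof. by []. Qed.

(** For [w] equal to [p] or [q], moving [sc w] across exchanges the two halves of [kterm], and
    changing the sign of the pairing of [w] with [r] exchanges their coefficients up to sign. When
    the index of [w] differs from both, each half anticommutes with [sc w]. *)
Lemma kterm_sc w p q r : p.1 != q.1 ->
  sc w * kterm p q r = - (kterm p q (refl1 w r) * sc w).
Proof.
move=> pq; have qp : q.1 != p.1 by rewrite eq_sym.
have [cp cq] := (sc_sq p, sc_sq q).
have Hp : sc p * kterm p q r = - (kterm p q (refl1 p r) * sc p).
  rewrite !ktermE !pairing_refl1 eqxx (negPf qp) opprK.
  have E1 : sc p * (sc p * sc q * Rt p q) = sc q * Rt p q.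
    by rewrite (mulrA (sc p)) (mulrA (sc p) (sc p)) cp mul1r.
  have E2 : Rt p q * sc p = - (sc q * Rt p q) by rewrite Rt_sc // refl_l.
  have E3 : sc p * sc q * Rt p q * sc p = - (sc p * Rt p q).
    by rewrite -mulrA E2 mulrN mulrA -(mulrA (sc p) (sc q)) cq mulr1.
  rewrite mulrDr mulrDl !mulrzAr !mulrzAl E1 E2 E3 !mulNrz opprD !opprK.
  by rewrite addrC.
have Hq : sc q * kterm p q r = - (kterm p q (refl1 q r) * sc q).
  rewrite !ktermE !pairing_refl1 eqxx (negPf pq).
  have E1 : sc q * (sc p * sc q * Rt p q) = - (sc p * Rt p q).
    by rewrite (mulrA (sc q)) (mulrA (sc q) (sc p)) (sc_anti qp) mulNr
       -(mulrA (sc p)) cq mulr1 mulNr.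
  have E2 : Rt p q * sc q = - (sc p * Rt p q) by rewrite Rt_sc // refl_r.
  have E3 : sc p * sc q * Rt p q * sc q = sc q * Rt p q.
    by rewrite -mulrA E2 (sc_anti pq) mulrN mulNr opprK (mulrA _ (sc p))
       -(mulrA (sc q) (sc p)) cp mulr1.
  rewrite mulrDr mulrDl !mulrzAr !mulrzAl E1 E2 E3 -opprD.
  have -> : - pairing q r + pairing p r = - (pairing q r - pairing p r).
    by rewrite opprB addrC.
  by rewrite !mulrNz !mulNrz opprK opprB.
have [/eqP wp|wp] := boolP (w.1 == p.1).
  have [->//|] := eqVneq w p; have [-> _|wNp wp'] := eqVneq w (sneg p).
    by rewrite refl1_sneg signed_neg mulNr mulrN Hp.
  case: w p wp wNp wp' {Hp Hq pq qp cp} => [i []] [j []] /= -> ;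
    by rewrite /sneg /= ?eqxx.
have [/eqP wq|wq] := boolP (w.1 == q.1).
  have [->//|] := eqVneq w q; have [-> _|wNq wq'] := eqVneq w (sneg q).
    by rewrite refl1_sneg signed_neg mulNr mulrN Hq.
  case: w q wq wNq wq' {Hp Hq pq qp cq wp} => [i []] [j []] /= -> ;
    by rewrite /sneg /= ?eqxx.
have Rw : Rt p q * sc w = - (sc w * Rt p q) by rewrite Rt_sc // refl_id.
rewrite !ktermE !pairing_refl1 ![_ == w.1]eq_sym (negPf wp) (negPf wq).
rewrite mulrDr mulrDl !mulrzAr !mulrzAl -(mulrA (sc p * sc q)) Rw.
rewrite (mulrA (sc w)) (mulrA (sc w)) (sc_anti wp) mulNr -(mulrA (sc p)) (sc_anti wq).
by rewrite !mulrN opprK (mulrA (sc p)) mulrA !mulNrz opprD !opprK.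
Qed.

Lemma kappa_sc w p r : sc w * kappa p r = - (kappa p (refl1 w r) * sc w).
Proof.
have Z z x y : (forall a, a * z = z * a) -> sc w * x = - (y * sc w) ->
    sc w * (z * x) = - (z * y * sc w).
  by move=> zc h; rewrite mulrA zc -mulrA h mulrN mulrA.
have Y x : sc w * x = (if p.1 == w.1 then x * sc w else - (x * sc w)) ->
    sc w * (x *~ pairing p r) = - (x *~ pairing p (refl1 w r) * sc w).
  rewrite pairing_refl1 mulrzAr mulrzAl => ->; case: ifP => _.
    by rewrite mulrNz opprK.
  by rewrite mulNrz.
rewrite /kappa !mulrDr !mulrDl !opprD; congr (_ + _ + _).
- apply: Z => //; apply: Y; case: eqVneq => [e|ne]; last by rewrite sc_anti // eq_sym.
  have [->//|wp] := eqVneq w p; have [-> //|wNp] := eqVneq w (sneg p).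
    by rewrite signed_neg mulNr mulrN.
  by case: w p e wp wNp => [i []] [j []] /= ->; rewrite /sneg /= ?eqxx.
- apply: Z => //; rewrite mulr_sumr mulr_suml -sumrN; apply: eq_bigr => q qp.
  by rewrite kterm_sc // eq_sym.
apply: Z => //; apply: Y; case: eqVneq => [e|ne].
  by rewrite R1_sc /refl1 e eqxx signed_neg mulNr opprK.
by rewrite R1_sc /refl1 eq_sym (negPf ne) opprK.
Qed.

Lemma kterm_neg p q r : kterm (sneg p) (sneg q) r = kterm p q r.
Proof.
rewrite !ktermE !pairing_negl Rt_neg !signed_neg mulrNN -!opprD mulrN.
by rewrite !mulrNz !mulNrz !opprK.
Qed.

Lemma kterm_sym p q r : p.1 != q.1 -> kterm q p r = kterm p q r.
Proof.
move=> pq; rewrite !ktermE (RtN t pq) (sc_anti (p := q)) 1?eq_sym //.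
by rewrite mulrNN -(opprB (pairing q r)) mulrNz mulNrz opprK [pairing p r + _]addrC.
Qed.

(** Consistent with [eta_p] carrying no sign: the sign of [sc p] or [R1 p] compensates that of the
    pairing. *)
Lemma kappa_neg p r : kappa (sneg p) r = kappa p r.
Proof.
rewrite /kappa signed_neg R1_neg !pairing_negl !mulrNz !mulNrz !opprK.
congr (_ + _ * _ + _).
rewrite [LHS](reindex_inj (can_inj (@snegK n))) /=.
by apply: eq_bigr => q _; rewrite kterm_neg.
Qed.

Lemma kappa_negr p r : kappa p (sneg r) = - kappa p r.
Proof.
rewrite /kappa !pairing_negr !mulrNz !mulrN !opprD; congr (_ + _ + _).
rewrite -mulrN -sumrN; congr (_ * _); apply: eq_bigr => q _.
by rewrite !ktermE !pairing_negr -!opprD !mulrNz opprD.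
Qed.

(** Only [q = (j, false)] and [q = (j, true)] pair with [x_j]; they yield the ordinary and the
    barred bracket of the presentation. *)
Lemma kappa_offdiag i j : i != j ->
  kappa (i, false) (j, false) =
  uu * ((1 + c i * c j) * br t i.+1 j.+1 - (1 - c i * c j) * br_bar t i.+1 j.+1).
Proof.
move=> ij; have p0 b : pairing (i, b) (j, false) = 0 by rewrite pairing_neq.
rewrite /kappa p0 !mulr0z !mulr0 addr0 add0r; congr (_ * _).
have ji : j != i by rewrite eq_sym.
rewrite (sum_signed (predC1 i)) (bigD1 j) //= [X in _ + X]big1 ?addr0; last first.
  move=> k /andP[_ kj].
  by rewrite !ktermE !p0 ![pairing (k, _) _]pairing_neq // subr0 addr0 !mulr0z !addr0.
have e : (j, true) = sneg (j, false) by [].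
rewrite !ktermE e !pairing_negl pairing_id p0 !subr0 ?addr0 !mulrN1z !mulr1z.
rewrite !RtE /Rc /= !mul1r signed_neg !signed_f addrC mulrN mulNr opprK.
by rewrite mulrDl mulrBl !mul1r opprB; congr (_ + _); rewrite addrC.
Qed.

Lemma kappa_diag i :
  kappa (i, false) (i, false) =
  tt * c i + uu * (\sum_(k < n | k != i) ((1 + c k * c i) * br t k.+1 i.+1
     - (1 - c k * c i) * br_bar t k.+1 i.+1)) + vv * sbr_bar t i.+1.
Proof.
rewrite /kappa pairing_id !mulr1z R1E /= mul1r signed_f; congr (_ + _ * _ + _).
rewrite (sum_signed (predC1 i)).
apply: eq_bigr => k ki; have ik : i != k by rewrite eq_sym.
rewrite !ktermE pairing_id !pairing_neq // !add0r !mulrN1z !mulr1z.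
have e : (k, true) = sneg (k, false) by [].
rewrite e !signed_neg !signed_f !RtE /Rc /= !mul1r.
have -> : br t k.+1 i.+1 = - br t i.+1 k.+1.
  by apply: (rextN (br_lt t)); rewrite eqSS.
have -> : br_bar t k.+1 i.+1 = br_bar t i.+1 k.+1.
  by rewrite /br_bar; case: ltngtP => // -[/val_inj e']; move: ki; rewrite e' /= eqxx.
rewrite (c_anti ki) mulrN !mulNr opprK addrC; congr (_ + _).
  by rewrite mulrN mulrBl mul1r opprB addrC.
by rewrite mulrDl mul1r opprD.
Qed.

(** * The commutators and the eta's *)

Section Odd.
Variable eta : 'I_n -> A.
Hypothesis t_eta : forall k j, t k * eta j = - (eta (unsigned (s k) j) * t k).
Hypothesis c_eta : forall i j, c i * eta j = - (eta j * c i).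

Lemma Rt_eta p q r : p.1 != q.1 ->
  Rt p q * eta r.1 = - (eta (refl p q r).1 * Rt p q).
Proof.
move=> pq; have := @Rt_act X n Xn A t t_spin true (unsign eta) _ p q pq r.
by rewrite expr1 mulN1r; apply=> k r'; apply: (unsign_ext_comm Xn).
Qed.

Lemma R1_eta p r : R1 p * eta r.1 = - (eta r.1 * R1 p).
Proof.
have := @R1_act X n Xn A t t_spin true (unsign eta) _ p r.
rewrite expr1 mulN1r /unsign => ->; last first.
  by move=> k r'; apply: (unsign_ext_comm Xn).
by rewrite /refl1; case: ifP.
Qed.

Lemma sc_eta p j : sc p * eta j = - (eta j * sc p).
Proof.
by case: p => i []; rewrite signedE /= ?mul1r // mulN1r mulNr mulrN c_eta.
Qed.

Lemma kterm_eta p q r w : p.1 != q.1 ->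
  kterm p q r * eta w.1 = - (eta (refl p q w).1 * kterm p q r).
Proof.
move=> pq; rewrite !ktermE mulrDl mulrDr opprD !mulrzAl !mulrzAr -!mulNrz.
rewrite -(mulrA (sc p * sc q)) Rt_eta //; congr (_ + _ *~ _).
rewrite mulrN mulrA -(mulrA (sc p)) sc_eta mulrN mulrA sc_eta !mulNr opprK.
by rewrite -!mulrA.
Qed.

Lemma kterm_eta_far p q r j : p.1 != q.1 -> j != p.1 -> j != q.1 ->
  kterm p q r * eta j = - (eta j * kterm p q r).
Proof.
move=> pq jp jq; have := @kterm_eta p q r (j, false) pq.
by rewrite refl_id.
Qed.

Lemma kterm_eta_r i q r : i != q.1 ->
  kterm (i, false) q r * eta q.1 = - (eta i * kterm (i, false) q r).
Proof. by move=> iq; rewrite kterm_eta // refl_r. Qed.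

Lemma scalar_eta z x y j : (forall a, a * z = z * a) ->
  x * eta j + eta j * x = y -> z * x * eta j + eta j * (z * x) = z * y.
Proof. by move=> zc <-; rewrite mulrDr mulrA zc !mulrA. Qed.

(** Every term whose reflection does not involve [j] anticommutes with [eta j] and drops out. The
    two roots joining [i] and [j] remain, and their lifts turn [eta j] into [- eta i]. *)
Lemma kappa_eta i j r : i != j ->
  kappa (i, false) r * eta j + eta j * kappa (i, false) r =
  uu * ((eta j - eta i) *
    (kterm (i, false) (j, true) r + kterm (i, false) (j, false) r)).
Proof.
move=> ij; have ji : j != i by rewrite eq_sym.
set Y := (Y in _ = Y); rewrite /kappa !mulrDl !mulrDr.
rewrite addrACA [X in X + _ = _]addrACA.
rewrite (@scalar_eta _ _ 0 j tt_comm); last first.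
  by rewrite mulrzAl mulrzAr sc_eta mulNrz addNr.
rewrite (@scalar_eta _ _ 0 j vv_comm); last first.
  rewrite mulrzAl mulrzAr (R1_eta (i, false) (j, false)) mulNrz addNr //.
rewrite !mulr0 add0r addr0; apply: scalar_eta => //.
rewrite (sum_signed (predC1 i)) (bigD1 j) //=.
set S := \sum_(k | _) _.
have S0 : S * eta j + eta j * S = 0.
  rewrite mulr_suml mulr_sumr -big_split /= big1 // => k /andP[ki kj].
  rewrite mulrDl mulrDr !kterm_eta_far //= 1?[i == k]eq_sym 1?[j == k]eq_sym //.
  by rewrite -opprD addNr.
rewrite mulrDl mulrDr addrACA S0 addr0 mulrDl (kterm_eta_r (q := (j, true))) //.
rewrite (kterm_eta_r (q := (j, false))) // -opprD -mulrDr addrC.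
by rewrite mulrBl.
Qed.

(** The surviving [kterm] sum of [kappa_eta] is symmetric in [i] and [j], whereas its factor
    [eta j - eta i] is antisymmetric. *)
Lemma kappa_eta_eta i j r : i != j ->
  eta i * kappa (j, false) r + kappa (i, false) r * eta j
  + (eta j * kappa (i, false) r + kappa (j, false) r * eta i) = 0.
Proof.
move=> ij; have ji : j != i by rewrite eq_sym.
rewrite addrC -addrA [kappa (j, _) r * _ + _]addrA [X in _ + X]addrC addrA.
rewrite [eta j * _ + _]addrC kappa_eta // kappa_eta //.
have -> : kterm (j, false) (i, true) r = kterm (i, false) (j, true) r.
  by rewrite -kterm_sym // -kterm_neg.
have -> : kterm (j, false) (i, false) r = kterm (i, false) (j, false) r.
  by rewrite kterm_sym.
by rewrite -mulrDr -mulrDl addrA subrK subrr mul0r mulr0.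
Qed.

End Odd.

(** * The commutators and the x's *)

Section Even.
Variable x : 'I_n -> A.
Hypothesis t_x : forall k j, t k * x j = signed_act x (s k) j * t k.
Hypothesis c_x : forall i j, c i * x j = (-1) ^+ (i == j) * (x j * c i).
Local Notation sx := (signed x).

Lemma t_sx k r : t k * sx r = sx (s k r) * t k.
Proof.
have := @signed_ext_comm X n Xn A false x k (t k) _ r.
by rewrite expr0 mul1r; apply=> j; rewrite mul1r t_x.
Qed.

Lemma sc_sx p r : sc p * sx r = sx (refl1 p r) * sc p.
Proof.
have H i r' : c i * sx r' = sx (refl1 (i, false) r') * c i.
  have Hj j : c i * sx (j, false) = sx (refl1 (i, false) (j, false)) * c i.
    rewrite signed_f c_x /refl1 /= [j == i]eq_sym.
    by case: (i == j); rewrite ?signed_neg signed_f ?mul1r // mulN1r mulNr.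
  case: r' => j []; last exact: Hj.
  have -> : (j, true) = sneg (j, false) by [].
  rewrite signed_neg mulrN Hj /refl1 /=; case: ifP => _;
    by rewrite -mulNr -signed_neg.
case: p => i b; have [-> // |] : b = false \/ b = true by case: b; [right|left].
  by rewrite signed_f H.
move=> ->; have -> : (i, true) = sneg (i, false) by [].
by rewrite signed_neg signed_f mulNr mulrN H.
Qed.

Lemma Rt_sx p q r : p.1 != q.1 -> Rt p q * sx r = sx (refl p q r) * Rt p q.
Proof.
move=> pq; have := @Rt_act X n Xn A t t_spin false sx _ p q pq r.
by rewrite expr0 mul1r; apply=> k r'; rewrite mul1r t_sx.
Qed.

Lemma R1_sx p r : R1 p * sx r = sx (refl1 p r) * R1 p.
Proof.
have := @R1_act X n Xn A t t_spin false sx _ p r.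
by rewrite expr0 mul1r; apply=> k r'; rewrite mul1r t_sx.
Qed.

Lemma signed_cases p r : [\/ r = p, r = sneg p | r.1 != p.1].
Proof.
have [rp|rp] := eqVneq r.1 p.1; last by constructor 3.
have [->|rp1] := eqVneq r p; first by constructor 1.
constructor 2; case: r p rp rp1 => [i []] [j []] /= -> //;
  by rewrite /sneg /= ?eqxx.
Qed.

Lemma sx_refl1 p r : sx (refl1 p r) - sx r = - sx p *~ (pairing p r *+ 2).
Proof.
have H : sx (refl1 p p) - sx p = - sx p *~ (pairing p p *+ 2).
  by rewrite /refl1 eqxx signed_neg pairing_id mulrz_nat mulr2n.
have [->|->|rp] := signed_cases p r; first exact: H.
- rewrite pairing_negr signed_neg mulNrn mulrNz -H opprB.
  by rewrite /refl1 /= eqxx snegK signed_neg opprK addrC.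
by rewrite /refl1 (negPf rp) subrr pairing_neq ?mulr0z // eq_sym.
Qed.

Lemma sx_refl p q r : p.1 != q.1 ->
  sx (refl p q r) - sx r = (sx p - sx q) *~ (pairing q r - pairing p r).
Proof.
move=> pq; have qp : q.1 != p.1 by rewrite eq_sym.
have [->|->|rp] := signed_cases p r.
- by rewrite refl_l pairing_id pairing_neq // sub0r mulrN1z opprB.
- rewrite -refl_neg // refl_l !signed_neg !pairing_negr pairing_id.
  by rewrite pairing_neq // oppr0 sub0r !opprK mulr1z addrC.
have pr : p.1 != r.1 by rewrite eq_sym.
rewrite [pairing p r]pairing_neq // subr0.
have [->|->|rq] := signed_cases q r.
- by rewrite refl_r // pairing_id mulr1z.
- rewrite -refl_neg // refl_r // !signed_neg pairing_negr pairing_id.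
  by rewrite mulrN1z opprB opprK addrC.
by rewrite refl_id // subrr pairing_neq ?mulr0z // eq_sym.
Qed.

Lemma sx_refl_flip p q r : p.1 != q.1 ->
  sx (refl1 p (refl1 q (refl p q r))) - sx r =
  - (sx p + sx q) *~ (pairing q r + pairing p r).
Proof.
move=> pq; have qp : q.1 != p.1 by rewrite eq_sym.
have [->|->|rp] := signed_cases p r.
- rewrite refl_l /refl1 eqxx /= (negPf qp) signed_neg pairing_id.
  by rewrite pairing_neq // add0r mulr1z opprD addrC.
- rewrite -refl_neg // refl_l /refl1 /= eqxx snegK (negPf qp) !signed_neg.
  by rewrite !pairing_negr pairing_id pairing_neq // oppr0 add0r mulrN1z !opprK addrC.
have pr : p.1 != r.1 by rewrite eq_sym.
rewrite [pairing p r]pairing_neq // addr0.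
have [->|->|rq] := signed_cases q r.
- rewrite refl_r // /refl1 (negPf pq) eqxx signed_neg pairing_id.
  by rewrite mulr1z opprD.
- rewrite -refl_neg // refl_r // /refl1 /= (negPf pq) eqxx snegK signed_neg.
  by rewrite pairing_negr pairing_id mulrN1z !opprK.
by rewrite refl_id // /refl1 (negPf rq) (negPf rp) subrr pairing_neq ?mulr0z // eq_sym.
Qed.

Definition xcomm (a : A) r := a * sx r - sx r * a.

Lemma xcommD a b r : xcomm (a + b) r = xcomm a r + xcomm b r.
Proof. by rewrite /xcomm mulrDl mulrDr opprD addrACA. Qed.

Lemma xcomm_scalar z a r : (forall b, b * z = z * b) ->
  xcomm (z * a) r = z * xcomm a r.
Proof. by move=> zc; rewrite /xcomm mulrBr !mulrA zc. Qed.

Lemma xcomm_sum (I : finType) (P : pred I) (F : I -> A) r :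
  xcomm (\sum_(i | P i) F i) r = \sum_(i | P i) xcomm (F i) r.
Proof. by rewrite /xcomm mulr_suml mulr_sumr -sumrB. Qed.

(* [g] acts on the [x_r] by a reflection, so [[g, x_r]] is proportional to a
   linear form independent of [r], with the coefficient with which [g] itself
   occurs in [kappa]. *)
Lemma xcomm_refl g (f : 'I_n * bool -> 'I_n * bool) (m : 'I_n * bool -> int) z a :
  (forall r, g * sx r = sx (f r) * g) ->
  (forall r, sx (f r) - sx r = z *~ (m r *+ a)) ->
  forall r r', xcomm (g *~ m r) r' = xcomm (g *~ m r') r.
Proof.
move=> gf fz r r'.
have H b b' : xcomm (g *~ m b) b' = (z * g) *~ (m b * m b' *+ a).
  rewrite /xcomm mulrzAl mulrzAr -mulrzBl gf -mulrBl fz mulrzAl -mulrzA.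
  by congr (_ *~ _); rewrite mulrC mulrnAr.
by rewrite !H [m r * _]mulrC.
Qed.

Lemma xcomm_kterm p q r r' : p.1 != q.1 ->
  xcomm (kterm p q r) r' = xcomm (kterm p q r') r.
Proof.
move=> pq; rewrite !ktermE !xcommD; congr (_ + _).
  apply: (@xcomm_refl _ (refl p q) (fun r => pairing q r - pairing p r) (sx p - sx q) 1) => //.
    by move=> b; apply: Rt_sx.
  by move=> b; rewrite mulr1n; apply: sx_refl.
apply: (@xcomm_refl _ (fun r => refl1 p (refl1 q (refl p q r)))
   (fun r => pairing q r + pairing p r) (- (sx p + sx q)) 1) => //.
  by move=> b; rewrite -mulrA Rt_sx // mulrA -(mulrA (sc p)) sc_sx mulrA sc_sx !mulrA.
by move=> b; rewrite mulr1n; apply: sx_refl_flip.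
Qed.

Lemma kappa_x p r r' : xcomm (kappa p r) r' = xcomm (kappa p r') r.
Proof.
rewrite /kappa !xcommD !xcomm_scalar //; congr (_ * _ + _ * _ + _ * _).
- apply: (@xcomm_refl _ (refl1 p) (pairing p) (- sx p) 2) => // b.
    exact: sc_sx.
  exact: sx_refl1.
- rewrite !xcomm_sum; apply: eq_bigr => q qp.
  by apply: xcomm_kterm; rewrite eq_sym.
apply: (@xcomm_refl _ (refl1 p) (pairing p) (- sx p) 2) => // b.
  exact: R1_sx.
exact: sx_refl1.
Qed.

End Even.

End DeformationTerms.

(** * Right operators and functions on words *)

Section RightOperators.
Variables (K : fieldType) (V : lmodType K).

Definition linear_fun : {pred V -> V} := fun f => `[< linear f >].

Lemma linear_funP (f : V -> V) : reflect (linear f) (f \in linear_fun).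
Proof. exact: asboolP. Qed.

Fact linear_fun_closed : submod_closed linear_fun.
Proof.
split.
  by apply/linear_funP => a u v; change (0 = a *: 0 + 0 :> V); rewrite scaler0 addr0.
move=> a f g /linear_funP lf /linear_funP lg; apply/linear_funP => b u v.
change (a *: f (b *: u + v) + g (b *: u + v) =
  b *: (a *: f u + g u) + (a *: f v + g v)).
by rewrite lf lg !scalerDr !scalerA [b * a]mulrC addrACA.
Qed.

HB.instance Definition _ :=
  GRing.isSubmodClosed.Build K (V -> V) linear_fun linear_fun_closed.

(** Operators act on the right: in the product defined below [f * g] applies [f] before [g], so that
    a product of letters prefixes words in reading order. *)
Record rop := Rop { rop_fun :> V -> V; rop_lin : rop_fun \in linear_fun }.

HB.instance Definition _ := [isSub for rop_fun].
HB.instance Definition _ := [Choice of rop by <:].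
HB.instance Definition _ := [SubChoice_isSubLmodule of rop by <:].

Lemma ropP (f g : rop) : (forall v, f v = g v) -> f = g.
Proof. by move=> fg; apply/val_inj/funext. Qed.

Lemma rop_linear (f : rop) : linear f.
Proof. exact/linear_funP/rop_lin. Qed.

Lemma rop_linE (f : rop) a u v : f (a *: u + v) = a *: f u + f v.
Proof. exact: rop_linear. Qed.

Lemma ropD (f : rop) u v : f (u + v) = f u + f v.
Proof. by have := rop_linear f 1 u v; rewrite !scale1r. Qed.

Lemma rop0 (f : rop) : f 0 = 0.
Proof. by have := rop_linear f (-1) 0 0; rewrite !scaleN1r !addNr. Qed.

Lemma ropZ (f : rop) a u : f (a *: u) = a *: f u.
Proof. by have := rop_linear f a u 0; rewrite rop0 !addr0. Qed.

Lemma ropN (f : rop) u : f (- u) = - f u.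
Proof. by rewrite -!scaleN1r ropZ. Qed.

Definition rop_mk (f : V -> V) (lf : linear f) : rop := Rop (introT (linear_funP f) lf).

Fact rop_one_lin : linear (@id V). Proof. by []. Qed.
Definition rop_one := rop_mk rop_one_lin.

Fact rop_mul_lin (f g : rop) : linear (g \o f).
Proof. by move=> a u v; rewrite /= !rop_linear. Qed.
Definition rop_mul f g := rop_mk (rop_mul_lin f g).

Fact rop_mulA : associative rop_mul. Proof. by move=> f g h; apply: ropP. Qed.
Fact rop_mul1 : left_id rop_one rop_mul. Proof. by move=> f; apply: ropP. Qed.
Fact rop_mulr1 : right_id rop_one rop_mul. Proof. by move=> f; apply: ropP. Qed.
Fact rop_mulDl : left_distributive rop_mul +%R.
Proof. by move=> f g h; apply: ropP => v; exact: ropD. Qed.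
Fact rop_mulDr : right_distributive rop_mul +%R.
Proof. by move=> f g h; apply: ropP => v. Qed.

HB.instance Definition _ := GRing.Zmodule_isPzRing.Build rop
  rop_mulA rop_mul1 rop_mulr1 rop_mulDl rop_mulDr.

Lemma rop_addE (f g : rop) v : (f + g) v = f v + g v. Proof. by []. Qed.
Lemma rop_oppE (f : rop) v : (- f) v = - f v. Proof. by []. Qed.
Lemma rop_scaleE a (f : rop) v : (a *: f) v = a *: f v. Proof. by []. Qed.
Lemma rop_oneE v : (1 : rop) v = v. Proof. by []. Qed.
Lemma rop_mulE (f g : rop) v : (f * g) v = g (f v). Proof. by []. Qed.

Lemma rop_scaleAl a (f g : rop) : a *: (f * g) = (a *: f) * g.
Proof. by apply: ropP => v; rewrite !(rop_scaleE, rop_mulE) ropZ. Qed.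

Lemma rop_scaleAr a (f g : rop) : a *: (f * g) = f * (a *: g).
Proof. exact: ropP. Qed.

End RightOperators.

Definition letter n := ('I_n + 'I_n)%type.

(** * Functions on words compatible with the relations among letters *)

Section WordFunctions.
Variables (K : fieldType) (n : nat) (M : lmodType K).
Local Notation L := (letter n).
Local Notation pt := ('I_n * bool -> K).
Local Notation Phi := (seq L -> pt -> M).
Implicit Types (u w : seq L) (y z : L) (phi : Phi).

Definition word_ok phi : Prop :=
  (forall u w y z, y != z ->
     phi (u ++ y :: z :: w) = - phi (u ++ z :: y :: w)) /\
  (forall u w i, phi (u ++ inr i :: inr i :: w) = phi (u ++ w)).

Definition word_fun : {pred Phi} := fun phi => `[< word_ok phi >].

Lemma word_funP phi : reflect (word_ok phi) (phi \in word_fun).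
Proof. exact: asboolP. Qed.

Fact word_fun_closed : submod_closed word_fun.
Proof.
split.
  by apply/word_funP; split=> //= u w y z _; change (0 = - 0 :> (pt -> M)); rewrite oppr0.
move=> a f g /word_funP[f1 f2] /word_funP[g1 g2]; apply/word_funP; split.
  move=> u w y z yz; change (a *: f (u ++ y :: z :: w) + g (u ++ y :: z :: w) =
    - (a *: f (u ++ z :: y :: w) + g (u ++ z :: y :: w))).
  by rewrite f1 // g1 // scalerN -opprD.
move=> u w i; change (a *: f (u ++ inr i :: inr i :: w) + g (u ++ inr i :: inr i :: w)
  = a *: f (u ++ w) + g (u ++ w)).
by rewrite f2 g2.
Qed.

HB.instance Definition _ :=
  GRing.isSubmodClosed.Build K Phi word_fun word_fun_closed.

Record wfun := WFun { wfun_val :> Phi; wfun_ok : wfun_val \in word_fun }.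

HB.instance Definition _ := [isSub for wfun_val].
HB.instance Definition _ := [Choice of wfun by <:].
HB.instance Definition _ := [SubChoice_isSubLmodule of wfun by <:].

Implicit Types f g : wfun.

Lemma wfunP f g : (forall w, f w = g w) -> f = g.
Proof. by move=> fg; apply/val_inj/funext. Qed.

Lemma wfun_anti f u w y z : y != z -> f (u ++ y :: z :: w) = - f (u ++ z :: y :: w).
Proof. by have /word_funP[h _] := wfun_ok f; apply: h. Qed.

Lemma wfun_sq f u w i : f (u ++ inr i :: inr i :: w) = f (u ++ w).
Proof. by have /word_funP[_ h] := wfun_ok f; apply: h. Qed.

Lemma wfun_addE f g w : (f + g) w = f w + g w. Proof. by []. Qed.
Lemma wfun_oppE f w : (- f) w = - f w. Proof. by []. Qed.
Lemma wfun_scaleE a f w : (a *: f) w = a *: f w. Proof. by []. Qed.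

Section MkOperator.
Variable F : wfun -> Phi.
Hypothesis F_ok : forall f, word_ok (F f).
Hypothesis F_lin : forall a f g w, F (a *: f + g) w = a *: F f w + F g w.

Definition wop_fun f : wfun := WFun (introT (word_funP _) (F_ok f)).
Fact wop_lin : linear wop_fun.
Proof. by move=> a f g; apply: wfunP => w; rewrite [LHS]F_lin. Qed.
Definition wop : rop wfun := rop_mk wop_lin.

End MkOperator.

Section Letters.
Variable y : L.
Let F f w := f (y :: w).
Fact letter_ok f : word_ok (F f).
Proof.
by split=> [u w a b ab|u w i]; rewrite /F -!cat_cons; [apply: wfun_anti|apply: wfun_sq].
Qed.
Fact letter_lin a f g w : F (a *: f + g) w = a *: F f w + F g w.
Proof. by []. Qed.
Definition lop : rop wfun := wop letter_ok letter_lin.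
Lemma lopE f w : lop f w = f (y :: w). Proof. by []. Qed.
End Letters.

Lemma lop_anti y z : y != z -> lop y * lop z = - (lop z * lop y).
Proof.
move=> yz; apply: ropP => f; apply: wfunP => w.
by rewrite !(rop_oppE, rop_mulE) wfun_oppE !lopE (@wfun_anti f [::]).
Qed.

Lemma lop_sq i : lop (inr i) * lop (inr i) = 1.
Proof.
by apply: ropP => f; apply: wfunP => w; rewrite rop_mulE !lopE (@wfun_sq f [::]).
Qed.

(** Induction on words: the value at [y :: w] is the value at [w] after the letter [y], past which
    [F a] becomes another member of the family. A family is needed because the defect of a relation
    may change its index when a letter is passed. *)
Lemma rop_vanish (I : Type) (F : I -> rop wfun) :
  (forall a f, F a f [::] = 0) ->
  (forall a y, exists b h, F a * lop y = h * F b) -> forall a, F a = 0.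
Proof.
move=> F0 FS a; apply: ropP => f; apply: wfunP => w.
elim: w a f => [|y w IH] a f; first exact: F0.
have [b [h e]] := FS a y.
by rewrite -lopE -rop_mulE e rop_mulE IH.
Qed.

End WordFunctions.

(** * The induced right module *)

Lemma expr_shift (A : pzRingType) (I : Type) (g : A) (y : I -> A) (h : I -> I) m r :
  (forall r, g * y r = y (h r) * g) -> g ^+ m * y r = y (iter m h r) * g ^+ m.
Proof.
move=> gy; elim: m r => [|m IH] r; first by rewrite !expr0 mul1r mulr1.
by rewrite exprSr -mulrA gy mulrA IH -iterSr -mulrA -exprSr.
Qed.

Lemma sign_ropE (K : fieldType) (U : lmodType K) (b : bool) (F : rop U) f :
  ((-1) ^+ b * F) f = (-1) ^+ b *: F f.
Proof.
have e1 (R : pzRingType) : (-1) ^+ true = -1 :> R := expr1 _.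
by case: b; [rewrite !e1 mulN1r scaleN1r|rewrite !expr0 mul1r scale1r].
Qed.

Lemma sign_rop1 (K : fieldType) (U : lmodType K) m (f : U) :
  ((-1) ^+ m : rop U) f = (-1) ^+ m *: f.
Proof. by rewrite -signr_odd -[X in rop_fun X]mulr1 sign_ropE signr_odd. Qed.

Lemma refl1K n (p r : 'I_n * bool) : refl1 p (refl1 p r) = r.
Proof.
rewrite /refl1; have [h|h] := boolP (r.1 == p.1); last by rewrite (negPf h).
by rewrite /= h snegK.
Qed.

Section ScalarOperators.
Variables (K : fieldType) (U : lmodType K).

Definition scal_op (a : K) : rop U := a *: (1 : rop U).

Lemma scal_opE a (F : rop U) : scal_op a * F = a *: F.
Proof. by rewrite -rop_scaleAl mul1r. Qed.

Lemma scal_op_comm a (F : rop U) : F * scal_op a = scal_op a * F.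
Proof. by rewrite scal_opE -rop_scaleAr mulr1. Qed.

End ScalarOperators.

Section InducedModule.
Variables (X : weyl_type) (n : nat).
Hypothesis Xn : valid_size X n.
Variables (K : fieldType) (M : lmodType K) (tau : 'I_(cox_rank X n) -> rop M).
Hypothesis tau_spin : forall k l,
  (tau k * tau l) ^+ cox_order k l = (-1) ^+ (cox_order k l).+1.
Variables t0 u0 v0 : K.
Implicit Types (k l : 'I_(cox_rank X n)) (p q r : 'I_n * bool).
Local Notation L := (letter n).
Local Notation pt := ('I_n * bool -> K).
Local Notation s := (@simple_refl X n).
Local Notation V := (wfun n M).
Implicit Types (f g : V) (w : seq L).

Definition eta_op (i : 'I_n) : rop V := lop M (inl i).
Definition c_op (i : 'I_n) : rop V := lop M (inr i).

Lemma eta_opE i f w : eta_op i f w = f (inl i :: w). Proof. by []. Qed.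
Lemma c_opE i f w : c_op i f w = f (inr i :: w). Proof. by []. Qed.

Definition lact k (y : L) : L :=
  match y with inl i => inl (s k (i, false)).1 | inr i => inr (s k (i, false)).1 end.
(** Whether [t_k] changes sign in passing the letter: always for [eta_i]; for [c_i], the sign of
    [s k] is combined with one more. *)
Definition lsgn k (y : L) : bool :=
  if y is inr i then ~~ (s k (i, false)).2 else true.
Definition wsgn k w : bool := foldr (fun y b => lsgn k y (+) b) false w.

Lemma lact_inj k : injective (lact k).
Proof.
have H i j : (s k (i, false)).1 = (s k (j, false)).1 -> i = j.
  by move=> /eqP; rewrite (simple_refl_fst Xn) => /eqP.
by move=> [i|i] [j|j] //= [/H->].
Qed.

Lemma wsgn_cat k u w : wsgn k (u ++ w) = wsgn k u (+) wsgn k w.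
Proof. by elim: u => //= y u ->; rewrite addbA. Qed.

Definition Tfun k f w (x : pt) : M :=
  (-1) ^+ wsgn k w *: tau k (f (map (lact k) w) (x \o s k)).

Fact Tfun_ok k f : word_ok (Tfun k f).
Proof.
split=> [u w y z yz|u w i]; apply/funext => x; rewrite /Tfun !map_cat /= !wsgn_cat /=.
  rewrite wfun_anti ?(inj_eq (@lact_inj k)) // -[(- _) _]/(- (f _ _)) ropN scalerN.
  by rewrite [lsgn k y (+) _]addbCA.
by rewrite wfun_sq addKb.
Qed.

Fact Tfun_lin k a f g w : Tfun k (a *: f + g) w = a *: Tfun k f w + Tfun k g w.
Proof.
apply/funext => x; rewrite /Tfun.
rewrite -[RHS]/(a *: Tfun k f w x + Tfun k g w x) /Tfun.
rewrite -[X in tau k X]/(a *: f _ _ + g _ _) rop_linear scalerDr !scalerA.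
by rewrite [a * _]mulrC.
Qed.

Definition t_op k : rop V := wop (@Tfun_ok k) (@Tfun_lin k).

Lemma t_opE k f w x : t_op k f w x = Tfun k f w x. Proof. by []. Qed.

Lemma t_c_op k j : t_op k * c_op j = - (signed_act c_op (s k) j * t_op k).
Proof.
apply: ropP => f; apply: wfunP => w; apply/funext => x.
rewrite /signed_act -mulrA rop_mulE rop_oppE sign_ropE rop_mulE lopE t_opE.
rewrite -[RHS]/(- ((-1) ^+ (s k (j, false)).2 *: t_op k (c_op (s k (j, false)).1 f) w x)).
by rewrite t_opE /Tfun /= signr_addb signrN mulNr scaleNr -scalerA.
Qed.

Lemma t_eta_op k j : t_op k * eta_op j = - (eta_op (unsigned (s k) j) * t_op k).
Proof.
apply: ropP => f; apply: wfunP => w; apply/funext => x.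
rewrite rop_mulE rop_oppE rop_mulE lopE t_opE.
rewrite -[RHS]/(- (t_op k (eta_op (s k (j, false)).1 f) w x)).
by rewrite t_opE /Tfun /= signrN scaleNr.
Qed.

Lemma simple_refl_iter k l r : iter (cox_order k l) (fun r => s k (s l r)) r = r.
Proof.
have e p : s k (s l p) = (s k * s l)^-1%g p.
  apply: (@perm_inj _ (s k * s l)%g); rewrite permKV permM.
  by rewrite !(simple_reflK Xn).
rewrite (eq_iter e) -permX expgVn expg_order invg1 perm1 //.
Qed.

Lemma t_pow_nil k l m f x : ((t_op k * t_op l) ^+ m) f [::] x =
  ((tau k * tau l) ^+ m) (f [::] (x \o ((s k * s l) ^+ m)%g)).
Proof.
elim: m f => [|m IH] f.
  rewrite !expr0 !rop_oneE; congr (f [::] _); apply/funext => p /=.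
  by rewrite expg0 perm1.
rewrite !exprS !rop_mulE IH; congr (_ _).
rewrite !t_opE /Tfun /= !scale1r /Tfun /= scale1r; congr (tau l (tau k (f [::] _))).
by apply/funext => p /=; rewrite expgS !permM.
Qed.

(** Past a letter, [t_k t_l] moves the index by [s k] and [s l] with two cancelling signs, and the
    power given by the Coxeter order restores it. At the empty word the point is restored for the
    same reason, and [tau_spin] gives the scalar. *)
Lemma t_spin_op k l :
  (t_op k * t_op l) ^+ cox_order k l = (-1) ^+ (cox_order k l).+1.
Proof.
apply/eqP; rewrite -subr_eq0; apply/eqP.
set m := cox_order k l.
pose F (_ : unit) := (t_op k * t_op l) ^+ m - (-1) ^+ m.+1.
apply: (@rop_vanish K n M unit F _ _ tt) => [a f|a y].
  apply/funext => x; rewrite -[LHS]/(((t_op k * t_op l) ^+ m) f [::] x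
    - ((-1) ^+ m.+1 : rop V) f [::] x).
  rewrite t_pow_nil expg_order tau_spin -/m !sign_rop1.
  apply/eqP; rewrite subr_eq0; apply/eqP.
  rewrite -[RHS]/((-1) ^+ m.+1 *: f [::] x); congr (_ *: f [::] _).
  by apply/funext => p /=; rewrite perm1.
exists tt, (lop M y).
rewrite /F mulrBl mulrBr commr_sign; congr (_ - _).
case: y => i.
  have -> : lop M (inl i) = unsign eta_op (i, false) by [].
  rewrite (@expr_shift _ _ _ _ (fun r => s k (s l r))) ?simple_refl_iter //.
  move=> r; rewrite -mulrA.
  have E k' r' : t_op k' * unsign eta_op r' = - (unsign eta_op (s k' r') * t_op k').
    by rewrite (unsign_ext_comm Xn (t_eta_op k')) expr1 mulN1r.
  by rewrite E mulrN mulrA E mulNr opprK mulrA.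
have -> : lop M (inr i) = signed c_op (i, false) by rewrite signed_f.
rewrite (@expr_shift _ _ _ _ (fun r => s k (s l r))) ?simple_refl_iter //.
move=> r; rewrite -mulrA !(t_sc Xn t_c_op) mulrN mulrA (t_sc Xn t_c_op).
by rewrite mulNr opprK mulrA.
Qed.

Lemma c_op_sq i : c_op i * c_op i = 1. Proof. exact: lop_sq. Qed.

Lemma c_op_anti i j : i != j -> c_op i * c_op j = - (c_op j * c_op i).
Proof. by move=> ij; apply: lop_anti; rewrite (inj_eq (@inr_inj _ _)). Qed.

Lemma eta_op_anti i j : i != j -> eta_op i * eta_op j = - (eta_op j * eta_op i).
Proof. by move=> ij; apply: lop_anti; rewrite (inj_eq (@inl_inj _ _)). Qed.

Lemma c_eta_op i j : c_op i * eta_op j = - (eta_op j * c_op i).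
Proof. exact: lop_anti. Qed.

Definition kappa_op : 'I_n * bool -> 'I_n * bool -> rop V :=
  locked (kappa t_op c_op (scal_op V t0) (scal_op V u0) (scal_op V v0)).

Lemma kappa_opE p r :
  kappa_op p r = kappa t_op c_op (scal_op V t0) (scal_op V u0) (scal_op V v0) p r.
Proof. by rewrite /kappa_op -lock. Qed.

(* The [j]-th coordinate of the point [x] is [x (j, false) - x (j, true)], so that a
   signed permutation acts on points by permuting their values. *)
Fixpoint Xfun (j : 'I_n) w f : pt -> M :=
  match w with
  | [::] => fun x => (x (j, false) - x (j, true)) *: f [::] x
  | inl i :: w' => Xfun j w' (eta_op i f) - kappa_op (i, false) (j, false) f w'
  | inr i :: w' => (-1) ^+ (i == j) *: Xfun j w' (c_op i f)
  end.

Lemma Xfun_eta j i w f : Xfun j (inl i :: w) f =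
  Xfun j w (eta_op i f) - kappa_op (i, false) (j, false) f w.
Proof. by []. Qed.

Lemma Xfun_c j i w f :
  Xfun j (inr i :: w) f = (-1) ^+ (i == j) *: Xfun j w (c_op i f).
Proof. by []. Qed.

Lemma Xfun_lin j a f g w : Xfun j w (a *: f + g) = a *: Xfun j w f + Xfun j w g.
Proof.
elim: w f g => [|[i|i] w IH] f g; rewrite ?Xfun_eta ?Xfun_c.
- apply/funext => x; pose d := x (j, false) - x (j, true).
  change (d *: (a *: f [::] x + g [::] x) = a *: (d *: f [::] x) + d *: g [::] x).
  by rewrite scalerDr !scalerA mulrC.
- rewrite !rop_linE IH wfun_addE wfun_scaleE scalerBr opprD.
  by rewrite addrACA.
by rewrite rop_linE IH scalerDr !scalerA [a * _]mulrC.
Qed.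

Lemma Xfun0 j w : Xfun j w 0 = 0.
Proof. by have := Xfun_lin j (-1) 0 0 w; rewrite !scaleN1r !addNr. Qed.

Lemma XfunN j f w : Xfun j w (- f) = - Xfun j w f.
Proof. by have := Xfun_lin j (-1) f 0 w; rewrite Xfun0 !addr0 !scaleN1r. Qed.

Lemma c_kappa_op (k i j : 'I_n) : (-1) ^+ (k == j) * (c_op k * kappa_op (i, false) (j, false)) =
  - (kappa_op (i, false) (j, false) * c_op k).
Proof.
have := kappa_sc Xn t_spin_op t_c_op c_op_sq c_op_anti (@scal_op_comm _ _ t0)
  (@scal_op_comm _ _ u0) (@scal_op_comm _ _ v0) (k, false) (i, false) (j, false).
rewrite -!kappa_opE signed_f mulr_sign => ->.
rewrite /refl1 -[(j, false).1]/j -[(k, false).1]/k [j == k]eq_sym.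
case: (k == j) => //.
by rewrite !kappa_opE kappa_negr mulNr !opprK.
Qed.

(** Exchanging two leading [eta] is compatible with the recursion by [kappa_eta_eta], exchanging
    [eta] and [c] by [c_kappa_op]; a common prefix is peeled off letter by letter. *)
Fact Xfun_ok j f : word_ok (Xfun j ^~ f).
Proof.
split=> [u w y z yz|u w i]; last first.
  change (Xfun j (u ++ inr i :: inr i :: w) f = Xfun j (u ++ w) f).
  elim: u f => [|[i'|i'] u IH] f.
  - rewrite !cat0s !Xfun_c scalerA -expr2 sqrr_sign scale1r; congr Xfun.
    by rewrite -rop_mulE c_op_sq.
  - by rewrite !cat_cons !Xfun_eta IH wfun_sq.
  by rewrite !cat_cons !Xfun_c IH.
change (Xfun j (u ++ y :: z :: w) f = - Xfun j (u ++ z :: y :: w) f).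
elim: u f => [|[i|i] u IH] f; rewrite ?cat0s ?cat_cons ?Xfun_eta ?Xfun_c; last 2 first.
- by rewrite IH (wfun_anti _ _ _ yz); exact: esym (opprD _ _).
- by rewrite IH scalerN.
have X2 (P Q : rop V) (P' Q' : rop V) g : P = - P' -> Q = - Q' ->
    Xfun j w (P g) - Q g w = - (Xfun j w (P' g) - Q' g w).
  by move=> -> ->; rewrite !rop_oppE XfunN wfun_oppE !opprK opprB addrC.
have H1 (i k : 'I_n) g : i != k -> Xfun j (inl i :: inl k :: w) g =
    - Xfun j (inl k :: inl i :: w) g.
  move=> ik; have E a b : Xfun j (inl a :: inl b :: w) g =
      Xfun j w ((eta_op a * eta_op b) g) -
      (eta_op a * kappa_op (b, false) (j, false) +
       kappa_op (a, false) (j, false) * eta_op b) g w.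
    by rewrite !Xfun_eta rop_addE wfun_addE !rop_mulE eta_opE opprD addrA.
  rewrite !E; apply: X2; first exact: eta_op_anti.
  apply/eqP; rewrite -addr_eq0; apply/eqP.
  rewrite !kappa_opE; exact: (kappa_eta_eta Xn t_spin_op c_op_anti (@scal_op_comm _ _ t0)
    (@scal_op_comm _ _ u0) (@scal_op_comm _ _ v0) t_eta_op c_eta_op).
have H2 (i k : 'I_n) g : Xfun j (inl i :: inr k :: w) g =
    - Xfun j (inr k :: inl i :: w) g.
  rewrite Xfun_eta !Xfun_c Xfun_eta scalerBr.
  rewrite -wfun_scaleE -c_opE -!(rop_mulE _ _ g).
  have -> : (-1) ^+ (k == j) *: (c_op k * kappa_op (i, false) (j, false)) g =
      (- (kappa_op (i, false) (j, false) * c_op k)) g.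
    by rewrite -sign_ropE c_kappa_op.
  have -> : eta_op i * c_op k = - (c_op k * eta_op i) by rewrite c_eta_op opprK.
  by rewrite !rop_oppE XfunN wfun_oppE opprK scalerN opprD.
case: y z yz => i [] k yz; rewrite ?cat0s.
- by apply: H1; apply: contra yz => /eqP->.
- exact: H2.
- by rewrite H2 opprK.
rewrite !Xfun_c !scalerA mulrC -scalerN; congr (_ *: _).
rewrite -!(rop_mulE _ _ f) c_op_anti ?rop_oppE ?XfunN //.
Qed.

Definition x_op j : rop V := wop (Xfun_ok j) (fun a f g w => Xfun_lin j a f g w).

Lemma x_opE j f w : x_op j f w = Xfun j w f. Proof. by []. Qed.

Lemma x_eta_op i j :
  x_op j * eta_op i = eta_op i * x_op j - kappa_op (i, false) (j, false).
Proof. by apply: ropP => f; apply: wfunP => w. Qed.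

Lemma c_x_op i j : c_op i * x_op j = (-1) ^+ (i == j) * (x_op j * c_op i).
Proof.
apply: ropP => f; apply: wfunP => w; rewrite sign_ropE wfun_scaleE !rop_mulE.
by rewrite c_opE !x_opE Xfun_c scalerA -expr2 sqrr_sign scale1r.
Qed.

Local Notation sx := (signed x_op).

Lemma sx_nil r f x : sx r f [::] x = (x r - x (sneg r)) *: f [::] x.
Proof.
case: r => j b; rewrite signedE sign_ropE -[LHS]/((-1) ^+ b *: x_op j f [::] x).
rewrite x_opE /= scalerA; congr (_ *: _).
by case: b; rewrite /sneg /= ?expr0 ?mul1r // expr1 mulN1r opprB.
Qed.

Lemma sx_eta_op r i :
  sx r * eta_op i = eta_op i * sx r - kappa_op (i, false) r.
Proof.
case: r => j []; last by rewrite signed_f x_eta_op.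
have -> : (j, true) = sneg (j, false) by [].
rewrite signed_neg signed_f !kappa_opE kappa_negr -kappa_opE mulNr x_eta_op mulrN.
by rewrite opprB opprK addrC.
Qed.

Lemma kappa_op_fst p r : kappa_op (p.1, false) r = kappa_op p r.
Proof.
case: p => i [] //; have -> : (i, true) = sneg (i, false) by [].
by rewrite !kappa_opE kappa_neg.
Qed.

Lemma t_kappa_op k p r :
  t_op k * kappa_op p r = - (kappa_op (s k p) (s k r) * t_op k).
Proof.
rewrite !kappa_opE; exact: (kappa_tw Xn t_spin_op t_c_op (@scal_op_comm _ _ t0)
  (@scal_op_comm _ _ u0) (@scal_op_comm _ _ v0)).
Qed.

(** Past [eta_i] the defect for [r] reproduces itself, because [kappa] is equivariant. Past [c_i] it
    becomes the defect for [refl1 (i, false) r], which is why all signed indices are treated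
    together. *)
Lemma t_sx_op k r : t_op k * sx r = sx (s k r) * t_op k.
Proof.
apply/eqP; rewrite -subr_eq0; apply/eqP.
pose F r := t_op k * sx r - sx (s k r) * t_op k.
apply: (@rop_vanish K n M _ F).
  move=> {}r f; apply/funext => x.
  change (sx r (t_op k f) [::] x - t_op k (sx (s k r) f) [::] x = 0).
  rewrite sx_nil !t_opE /Tfun !scale1r sx_nil ropZ /=.
  by rewrite -(simple_refl_neg Xn) !(simple_reflK Xn) subrr.
move=> {}r [] i.
  set j := unsigned (s k) i; exists r, (- eta_op j).
  have te : t_op k * eta_op i = - (eta_op j * t_op k) by apply: t_eta_op.
  have tk : t_op k * kappa_op (i, false) r = - (kappa_op (j, false) (s k r) * t_op k).
    by rewrite t_kappa_op -kappa_op_fst.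
  have e1 : t_op k * sx r * eta_op i =
      - (eta_op j * (t_op k * sx r)) + kappa_op (j, false) (s k r) * t_op k.
    by rewrite -mulrA sx_eta_op mulrBr (mulrA (t_op k)) te tk opprK mulNr mulrA.
  have e2 : sx (s k r) * t_op k * eta_op i =
      - (eta_op j * (sx (s k r) * t_op k)) + kappa_op (j, false) (s k r) * t_op k.
    by rewrite -mulrA te mulrN (mulrA (sx _)) sx_eta_op mulrBl opprB addrC mulrA.
  rewrite -/(eta_op i) /F mulrBl e1 e2 opprD opprK addrACA subrr addr0.
  by rewrite mulNr mulrBr opprB addrC.
set c' := signed c_op (s k (i, false)).
exists (refl1 (i, false) r), (- c').
have tc : t_op k * c_op i = - (c' * t_op k).
  by rewrite -[c_op i]signed_f (t_sc Xn t_c_op).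
have cx q r' : signed c_op q * sx r' = sx (refl1 q r') * signed c_op q.
  exact: sc_sx c_x_op q r'.
have e1 : t_op k * sx r * c_op i = - (c' * (t_op k * sx (refl1 (i, false) r))).
  rewrite -mulrA -[in sx r](refl1K (i, false) r).
  by rewrite -[c_op i]signed_f -cx signed_f (mulrA (t_op k)) tc mulNr mulrA.
have e2 : sx (s k r) * t_op k * c_op i =
    - (c' * (sx (s k (refl1 (i, false) r)) * t_op k)).
  rewrite -mulrA tc mulrN !mulrA; congr (- (_ * _)).
  by rewrite cx (refl1_equiv Xn) refl1K.
rewrite -/(c_op i) /F mulrBl e1 e2 opprK mulNr mulrBr opprB.
by rewrite addrC.
Qed.

Lemma t_x_op k j : t_op k * x_op j = signed_act x_op (s k) j * t_op k.
Proof. by rewrite -[x_op j]signed_f t_sx_op signedE. Qed.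

(** Past [eta_k] the leftover terms cancel by [kappa_x]; past [c_k] both products acquire the same
    sign. *)
Lemma x_op_comm i j : x_op i * x_op j = x_op j * x_op i.
Proof.
apply/eqP; rewrite -subr_eq0; apply/eqP.
pose F (_ : unit) := x_op i * x_op j - x_op j * x_op i.
apply: (@rop_vanish K n M unit F _ _ Datatypes.tt) => [a f|a [] k].
- apply/funext => x; change (x_op j (x_op i f) [::] x - x_op i (x_op j f) [::] x = 0).
  by rewrite !x_opE /= !scalerA mulrC subrr.
- exists Datatypes.tt, (eta_op k); rewrite -/(eta_op k) /F.
  have e a' b : x_op a' * x_op b * eta_op k = eta_op k * (x_op a' * x_op b)
      - (kappa_op (k, false) (a', false) * x_op b + x_op a' * kappa_op (k, false) (b, false)).
    rewrite -mulrA x_eta_op mulrBr (mulrA (x_op a')) x_eta_op mulrBl -!mulrA.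
    by rewrite opprD addrA.
  have AB : kappa_op (k, false) (i, false) * x_op j + x_op i * kappa_op (k, false) (j, false)
      = kappa_op (k, false) (j, false) * x_op i + x_op j * kappa_op (k, false) (i, false).
    have := kappa_x Xn t_spin_op (@scal_op_comm _ _ t0) (@scal_op_comm _ _ u0)
      (@scal_op_comm _ _ v0) t_x_op c_x_op (k, false) (i, false) (j, false).
    rewrite /xcomm !signed_f -!kappa_opE => /eqP.
    by rewrite subr_eq addrAC eq_sym subr_eq => /eqP <-.
  by rewrite mulrBl !e AB mulrBr opprB addrA subrK.
have xc a' : x_op a' * c_op k = (-1) ^+ (k == a') * (c_op k * x_op a').
  by rewrite c_x_op mulrA -expr2 sqrr_sign mul1r.
have e a' b : x_op a' * x_op b * c_op k =
    (-1) ^+ ((k == a') (+) (k == b)) * (c_op k * (x_op a' * x_op b)).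
  rewrite -mulrA xc signr_addb -[RHS]mulrA !mulr_sign.
  by case: (k == b); rewrite ?mulrN (mulrA (x_op a')) xc mulr_sign;
    case: (k == a'); rewrite ?mulNr ?opprK -?mulrA.
exists Datatypes.tt, ((-1) ^+ ((k == i) (+) (k == j)) * c_op k).
by rewrite -/(c_op k) /F mulrBl mulrBr !e [(k == j) (+) _]addbC -!mulrA.
Qed.

End InducedModule.

(** * From operators satisfying the relations to a representation *)

Section BracketMorphism.
Variables (n : nat) (A B : pzRingType) (f : {rmorphism A -> B}).

Lemma tgen_map X (t : 'I_(cox_rank X n) -> A) k : f (tgen t k) = tgen (fun i => f (t i)) k.
Proof. by rewrite /tgen; case: insub => //=; rewrite rmorph0. Qed.

Lemma tup_map X (t : 'I_(cox_rank X n) -> A) i j : f (tup t i j) = tup (fun i => f (t i)) i j.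
Proof. by rewrite rmorph_prod; apply: eq_bigr => k _; apply: tgen_map. Qed.

Lemma tdown_map X (t : 'I_(cox_rank X n) -> A) i j : f (tdown t i j) = tdown (fun i => f (t i)) i j.
Proof. by rewrite rmorph_prod; apply: eq_bigr => k _; apply: tgen_map. Qed.

Variables (X : weyl_type) (t : 'I_(cox_rank X n) -> A).

Lemma br_map i j : f (br t i j) = br (fun i => f (t i)) i j.
Proof.
have H a b : f (br_lt t a b) = br_lt (fun i => f (t i)) a b.
  by rewrite /br_lt !rmorphM rmorph_sign tup_map tdown_map.
by rewrite /br; case: ifP; rewrite ?rmorphN H.
Qed.

Lemma br_bar_map i j : f (br_bar t i j) = br_bar (fun i => f (t i)) i j.
Proof.
have H a b : f (br_bar_lt t a b) = br_bar_lt (fun i => f (t i)) a b.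
  rewrite /br_bar_lt; case: X t => t0; first exact: rmorph0.
    by rewrite !rmorphM rmorph_sign !tup_map !tdown_map tgen_map.
  by rewrite !rmorphM rmorph_sign !tup_map !tdown_map !tgen_map.
by rewrite /br_bar; case: ifP; rewrite H.
Qed.

Lemma sbr_bar_map i : f (sbr_bar t i) = sbr_bar (fun i => f (t i)) i.
Proof.
rewrite /sbr_bar; case: X t => t0; try exact: rmorph0.
by rewrite !rmorphM rmorph_sign tup_map tdown_map.
Qed.

End BracketMorphism.

Lemma rmul_lin (K : fieldType) (A : algType K) (rel : A -> A -> Prop) (a : aquot rel) :
  linear (fun z : aquot rel => z * a).
Proof. by move=> k u v; rewrite mulrDl -aquot_scalerAl. Qed.

Definition rmul (K : fieldType) (A : algType K) (rel : A -> A -> Prop)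
  (a : aquot rel) : rop (aquot rel) := rop_mk (rmul_lin a).

Section RightMultiplication.
Variables (K : fieldType) (A : algType K) (rel : A -> A -> Prop).
Local Notation S := (aquot rel).
Implicit Types a b : S.

Lemma rmulE a z : rmul a z = z * a. Proof. by []. Qed.

Lemma rmulM a b : rmul (a * b) = rmul a * rmul b.
Proof. by apply: ropP => z; rewrite rop_mulE !rmulE mulrA. Qed.

Lemma rmulX a m : rmul (a ^+ m) = rmul a ^+ m.
Proof.
elim: m => [|m IH]; last by rewrite !exprS rmulM IH.
by apply: ropP => z; rewrite rmulE expr0 mulr1.
Qed.

Lemma rmul_sign m : rmul ((-1) ^+ m : S) = (-1) ^+ m.
Proof.
rewrite rmulX; congr (_ ^+ m); apply: ropP => z.
by rewrite rmulE mulrN1.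
Qed.
End RightMultiplication.

Section Evaluation.
Variables (K : fieldType) (G : choiceType) (U : lmodType K) (op : G -> rop U).

Definition word_eval (w : {fmonom G}) : rop U := \prod_(g <- w) op g.
Definition rop_eval : freealg K G -> rop U := lin_ext word_eval.

HB.instance Definition _ :=
  GRing.isLinear.Build K (freealg K G) (rop U) *:%R rop_eval (@lin_ext_is_linear K _ _ word_eval).

Lemma rop_eval_is_monoid_morphism : monoid_morphism rop_eval.
Proof.
split; first by rewrite [LHS]lin_extU scale1r /word_eval fm1 big_nil.
move=> p q; rewrite malgME linear_sum /= [in RHS]/rop_eval /lin_ext mulr_suml.
apply: eq_bigr => i _; rewrite linear_sum mulr_sumr; apply: eq_bigr => j _ /=.
rewrite [LHS]lin_extU /word_eval fmM big_cat /=.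
by rewrite -rop_scaleAl -rop_scaleAr scalerA.
Qed.

HB.instance Definition _ :=
  GRing.isMonoidMorphism.Build (freealg K G) (rop U) rop_eval rop_eval_is_monoid_morphism.

Lemma rop_eval_gen g : rop_eval (freegen K g) = op g.
Proof. by rewrite freegenE [LHS]lin_extU scale1r /word_eval fmU big_seq1. Qed.

Variable rel : freealg K G -> freealg K G -> Prop.
Hypothesis op_rel : forall l r, rel l r -> rop_eval l = rop_eval r.

(** The counterpart of [pres_map], whose values lie in a quotient algebra, for values in the ring of
    operators of a module. *)
Definition quot_eval (z : aquot rel) : rop U := rop_eval (repr z).

Lemma quot_evalE p : quot_eval (aclass rel p) = rop_eval p.
Proof.
apply/eqP; rewrite aclassE -subr_eq0 -linearB; apply/eqP.
elim: (lquot_repr (ideal_gens rel) p) => [|z [a [l [r [b [lr ->]]]]]|a u v _ u0 _ v0].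
- exact: linear0.
- by rewrite !rmorphM /= linearB /= (op_rel lr) subrr mulr0 mul0r.
- by rewrite linearP /= u0 v0 scaler0 addr0.
Qed.

Lemma quot_eval_is_linear : linear quot_eval.
Proof.
move=> a p q; elim/aclassW: p => p; elim/aclassW: q => q.
by rewrite -aclassZ -aclassD !quot_evalE linearP.
Qed.

Lemma quot_eval_is_monoid_morphism : monoid_morphism quot_eval.
Proof.
split; first by rewrite -aclass1 quot_evalE rmorph1.
move=> p q; elim/aclassW: p => p; elim/aclassW: q => q.
by rewrite -aclassM !quot_evalE rmorphM.
Qed.

End Evaluation.

Section Representation.
Variables (X : weyl_type) (n : nat) (K : fieldType) (t0 u0 v0 : K) (U : lmodType K).
Variables (x e c : 'I_n -> rop U) (t : 'I_(cox_rank X n) -> rop U).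
Hypothesis c_sq : forall i, c i * c i = 1.
Hypothesis c_anti : forall i j, i != j -> c i * c j = - (c j * c i).
Hypothesis t_spin : forall k l,
  (t k * t l) ^+ cox_order k l = (-1) ^+ (cox_order k l).+1.
Hypothesis e_anti : forall i j, i != j -> e i * e j = - (e j * e i).
Hypothesis x_comm : forall i j, x i * x j = x j * x i.
Hypothesis t_c : forall k j, t k * c j = - (signed_act c (simple_refl k) j * t k).
Hypothesis c_e : forall i j, c i * e j = - (e j * c i).
Hypothesis c_x : forall i j, c i * x j = (-1) ^+ (i == j) * (x j * c i).
Hypothesis t_x : forall k j, t k * x j = signed_act x (simple_refl k) j * t k.
Hypothesis t_e : forall k j, t k * e j = - (e (unsigned (simple_refl k) j) * t k).
Hypothesis e_x : forall i j, rcomm (e i) (x j) =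
  kappa t c (scal_op U t0) (scal_op U u0) (scal_op U v0) (i, false) (j, false).

(* Stated over an abstract algebra, as unification would compute with the
   multiplication of the free algebra. *)
Section AbstractPresentation.
Variables (A : algType K) (ev : {rmorphism A -> rop U}).
Variables (xs es cs : 'I_n -> A) (ts : 'I_(cox_rank X n) -> A).
Hypothesis evZ : forall a p, ev (a *: p) = a *: ev p.
Hypotheses (ev_x : forall i, ev (xs i) = x i) (ev_e : forall i, ev (es i) = e i).
Hypotheses (ev_c : forall i, ev (cs i) = c i) (ev_t : forall k, ev (ts k) = t k).

Let et : (fun k => ev (ts k)) = t. Proof. exact/funext. Qed.

Let ev_term a b i j : ev ((1 + a * b) * br ts i j - (1 - a * b) * br_bar ts i j) =
  (1 + ev a * ev b) * br t i j - (1 - ev a * ev b) * br_bar t i j.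
Proof.
by rewrite rmorphB !rmorphM rmorphD rmorphB rmorph1 rmorphM br_map br_bar_map et.
Qed.

Let ev_rcomm a b : ev (rcomm a b) = rcomm (ev a) (ev b).
Proof. by rewrite /rcomm rmorphB !rmorphM. Qed.

Lemma ev_relations :
  [/\ [/\ forall l r, cliff_rel cs l r -> ev l = ev r,
     forall l r, spin_rel ts l r -> ev l = ev r,
     forall l r, skew_rel es l r -> ev l = ev r &
     forall i j, ev (xs i * xs j) = ev (xs j * xs i)],
   [/\ forall k j, ev (ts k * cs j) = ev (- (signed_act cs (simple_refl k) j * ts k)),
     forall i j, ev (cs i * es j) = ev (- (es j * cs i)) &
     forall i j, ev (cs i * xs j) = ev ((-1) ^+ (i == j) * (xs j * cs i))],
   forall k j, ev (ts k * xs j) = ev (signed_act xs (simple_refl k) j * ts k),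
   forall k j, ev (ts k * es j) = ev (- (es (unsigned (simple_refl k) j) * ts k)) &
   (forall i j, i != j -> ev (rcomm (es i) (xs j)) =
      ev (u0 *: ((1 + cs i * cs j) * br ts i.+1 j.+1
              - (1 - cs i * cs j) * br_bar ts i.+1 j.+1))) /\
   (forall i, ev (rcomm (es i) (xs i)) = ev (t0 *: cs i
       + u0 *: (\sum_(k < n | k != i)
                  ((1 + cs k * cs i) * br ts k.+1 i.+1
                   - (1 - cs k * cs i) * br_bar ts k.+1 i.+1))
       + v0 *: sbr_bar ts i.+1))].
Proof.
split; [split|split| | |split].
- move=> l r [i|i j ij]; first by rewrite rmorphM rmorph1 !ev_c c_sq.
  by rewrite rmorphN !rmorphM !ev_c c_anti.
- by move=> l r [k l']; rewrite rmorph_sign rmorphXn rmorphM !ev_t t_spin.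
- by move=> l r [i j ij]; rewrite rmorphN !rmorphM !ev_e e_anti.
- by move=> i j; rewrite !rmorphM !ev_x x_comm.
- move=> k j; rewrite /signed_act rmorphN !rmorphM rmorph_sign ev_t !ev_c.
  exact: t_c.
- by move=> i j; rewrite rmorphN !rmorphM ev_c ev_e c_e.
- by move=> i j; rewrite !rmorphM rmorph_sign ev_c ev_x c_x.
- move=> k j; rewrite /signed_act !rmorphM rmorph_sign ev_t !ev_x.
  exact: t_x.
- by move=> k j; rewrite rmorphN !rmorphM ev_t !ev_e t_e.
- move=> i j ij; rewrite evZ ev_term !ev_c ev_rcomm ev_e ev_x.
  by rewrite e_x kappa_offdiag // scal_opE.
move=> i; rewrite ev_rcomm ev_e ev_x e_x kappa_diag // !scal_opE.
rewrite !rmorphD !evZ ev_c rmorph_sum sbr_bar_map et; congr (_ + _ *: _ + _).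
by apply: eq_bigr => k ki; rewrite ev_term !ev_c.
Qed.

End AbstractPresentation.

Definition hecke_op (g : hgen X n) : rop U :=
  match g with
  | inl (inl i) => x i
  | inl (inr i) => e i
  | inr (inl i) => c i
  | inr (inr k) => t k
  end.

Lemma hecke_op_rel l r :
  @hecke_rel X n K t0 u0 v0 l r -> rop_eval hecke_op l = rop_eval hecke_op r.
Proof.
have evZ a p : rop_eval hecke_op (a *: p) = a *: rop_eval hecke_op p.
  exact: linearZ.
have [] := @ev_relations (freealg K (hgen X n)) (rop_eval hecke_op)
  (fun i => freegen K (hgen_x X i)) (fun i => freegen K (hgen_e X i))
  (fun i => freegen K (hgen_c X i)) (fun k => freegen K (hgen_t k))
  evZ (fun i => rop_eval_gen _ _) (fun i => rop_eval_gen _ _)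
  (fun i => rop_eval_gen _ _) (fun i => rop_eval_gen _ _).
move=> [H1 H2 H3 H4] [H5 H6 H7] H8 H9 [H10 H11].
case=> {l r} [l r|l r|l r|i j _|k j|i j|i j|k j|k j|i j|i].
- exact: H1.
- exact: H2.
- exact: H3.
- exact: H4.
- exact: H5.
- exact: H6.
- exact: H7.
- exact: H8.
- exact: H9.
- exact: H10.
- exact: H11.
Qed.

Definition hecke_rep : hecke X n t0 u0 v0 -> rop U :=
  quot_eval hecke_op (rel := @hecke_rel X n K t0 u0 v0).

Lemma hecke_rep_is_linear : linear hecke_rep.
Proof. exact: quot_eval_is_linear hecke_op_rel. Qed.

Lemma hecke_rep_is_monoid_morphism : monoid_morphism hecke_rep.
Proof. exact: quot_eval_is_monoid_morphism hecke_op_rel. Qed.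

Lemma hecke_rep_gen g : hecke_rep (heckegen t0 u0 v0 g) = hecke_op g.
Proof. by rewrite /hecke_rep /heckegen (quot_evalE hecke_op_rel) rop_eval_gen. Qed.

End Representation.

(** * Independence of the normal forms *)

Lemma free_ind (K : fieldType) (G : choiceType) (P : freealg K G -> Prop) :
  P 1 -> (forall g p, P p -> P (freegen K g * p)) ->
  (forall a p q, P p -> P q -> P (a *: p + q)) -> forall p, P p.
Proof.
move=> P1 PM PL; have P0 : P 0 by rewrite -[0](addNr 1) -scaleN1r; apply: PL.
have Pw (w : seq G) : P << FMonom w >>.
  elim: w => [|g w IH].
    by have -> : FMonom [::] = mone :> {fmonom G} by apply/val_inj; rewrite /= fm1.
  have -> : << FMonom (g :: w) >> = freegen K g * << FMonom w >> :> freealg K G.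
    rewrite freegenE [RHS]fgmulUU mul1r; congr << _ >>.
    by apply/val_inj; rewrite /= fmM fmU.
  exact: PM.
move=> p; rewrite (monalgE p).
have PD u v : P u -> P v -> P (u + v).
  by move=> Pu Pv; rewrite -[u]scale1r; apply: PL.
elim/big_ind: _ => // w _.
have -> : << p@_w *g w >> = p@_w *: << w >> + 0 :> freealg K G.
  by rewrite addr0; apply/malgP => k; rewrite mcoeffZ !mcoeffU mulr_natr.
by apply: PL => //; case: w.
Qed.

(** * Independence of monomials as functions *)

Section Dedekind.
Variables (K : fieldType) (S : lmodType K) (n : nat).
Hypothesis K0 : [pchar K] =i pred0.

Lemma pchar0_natr_inj : injective (fun m => m%:R : K).
Proof.
suff H a b : (a <= b)%N -> a%:R = b%:R :> K -> a = b.
  by move=> a b ab; have [/H|/ltnW/H] := leqP a b => h; [apply: h|symmetry; apply: h].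
move=> ab e; apply/eqP; rewrite eqn_leq ab -subn_eq0.
by rewrite -((pcharf0P K).1 K0) natrB // e subrr eqxx.
Qed.

(** As in the independence of characters: doubling the coordinate [i] multiplies the monomial of [b]
    by [2 ^+ b i], so subtracting [2 ^+ b0 i] times the original relation eliminates [b0]. Some [i]
    separates [b] from [b0], and distinct powers of 2 remain distinct in characteristic zero. *)
Lemma monomials_free (s : seq {ffun 'I_n -> nat}) (v : {ffun 'I_n -> nat} -> S) :
  uniq s -> (forall y : 'I_n -> K, \sum_(b <- s) (\prod_i y i ^+ b i) *: v b = 0) ->
  {in s, forall b, v b = 0}.
Proof.
elim: s v => // b0 s IH v /= /andP[b0s us] H.
have Hs i : {in s, forall b : {ffun 'I_n -> nat}, (2 ^+ b i - 2 ^+ b0 i) *: v b = 0}.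
  apply: (IH (fun b : {ffun 'I_n -> nat} => (2 ^+ b i - 2 ^+ b0 i) *: v b) us) => y.
  have e (b : {ffun 'I_n -> nat}) : \prod_j (if j == i then y j * 2 else y j) ^+ b j =
      (\prod_j y j ^+ b j) * 2 ^+ b i.
    rewrite (bigD1 i) //= [in RHS](bigD1 i) //= eqxx exprMn -!mulrA; congr (_ * _).
    rewrite mulrC; congr (_ * _); apply: eq_bigr => j ji.
    by rewrite (negPf ji).
  have H1 := H (fun j => if j == i then y j * 2 else y j).
  have := H y; rewrite !big_cons => /(congr1 (fun z => 2 ^+ b0 i *: z)).
  rewrite scaler0 scalerDr => H2.
  move: H1; rewrite big_cons e mulrC -scalerA => H1.
  have := congr1 (fun z => z - (2 ^+ b0 i *: ((\prod_j y j ^+ b0 j) *: v b0) + 2 ^+ b0 i *: (\sum_(b <- s) (\prod_j y j ^+ b j) *: v b))) H1.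
  rewrite {2}H2 subr0 opprD addrACA subrr add0r scaler_sumr -sumrB => H3.
  rewrite -[RHS]H3; apply: eq_bigr => b _.
  by rewrite e !scalerA -scalerBl mulrC mulrBl [_ * 2 ^+ b i]mulrC.
have vs : {in s, forall b, v b = 0}.
  move=> b bs; have [i bi] : exists i, b i != b0 i.
    apply/existsP; apply: contraNT b0s; rewrite negb_exists => /forallP h.
    by have <- : b = b0 by apply/ffunP => i; apply/eqP; have := h i; rewrite negbK.
  have := Hs i b bs => /eqP; rewrite scaler_eq0 subr_eq0 => /orP[/eqP e|/eqP //].
  case/negP: bi; apply/eqP; move: e; rewrite -!natrX => /pchar0_natr_inj.
  by apply: expnI.
move=> b; rewrite inE => /orP[/eqP ->|]; last exact: vs.
(* At the point with all coordinates 1 every monomial is 1, and the other coefficients are already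
   0. *)
have := H (fun _ => 1); rewrite big_cons [X in _ + X]big_seq [X in _ + X]big1 => [|b' bs]; last first.
  by rewrite vs // scaler0.
rewrite addr0 big1 ?scale1r // => i _; exact: expr1n.
Qed.

End Dedekind.

Section CanonicalMorphisms.
Variables (X : weyl_type) (n : nat) (K : fieldType) (t0 u0 v0 : K).
Local Notation H := (hecke X n t0 u0 v0).

Fact of_skew_rel l r : skew_rel (fun i : 'I_n => freegen K i) l r ->
  free_eval (fun i => heckegen t0 u0 v0 (hgen_e X i)) l =
  free_eval (fun i => heckegen t0 u0 v0 (hgen_e X i)) r.
Proof.
move=> [j k jk].
have E : @hecke_rel X n K t0 u0 v0 _ _ := hecke_skew _ _ _ (@skew_anti _ _ _ j k jk).
rewrite rmorphN !rmorphM /= !free_eval_gen.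
apply: etrans (esym (aclassM _ _ _)) (etrans (aclass_rel E) _).
exact: etrans (aclassN _ _) (congr1 -%R (aclassM _ _ _)).
Qed.

Fact of_cliff_rel l r : cliff_rel (fun i : 'I_n => freegen K i) l r ->
  free_eval (fun i => heckegen t0 u0 v0 (hgen_c X i)) l =
  free_eval (fun i => heckegen t0 u0 v0 (hgen_c X i)) r.
Proof.
move=> [j|j k jk].
  have E : @hecke_rel X n K t0 u0 v0 _ _ := hecke_cliff _ _ _ (@cliff_sq _ _ _ j).
  rewrite rmorphM rmorph1 /= free_eval_gen.
  exact: etrans (esym (aclassM _ _ _)) (aclass_rel E).
have E : @hecke_rel X n K t0 u0 v0 _ _ := hecke_cliff _ _ _ (@cliff_anti _ _ _ j k jk).
rewrite rmorphN !rmorphM /= !free_eval_gen.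
apply: etrans (esym (aclassM _ _ _)) (etrans (aclass_rel E) _).
exact: etrans (aclassN _ _) (congr1 -%R (aclassM _ _ _)).
Qed.

Fact of_spin_rel l r : spin_rel (fun k : 'I_(cox_rank X n) => freegen K k) l r ->
  free_eval (fun k => heckegen t0 u0 v0 (hgen_t k)) l =
  free_eval (fun k => heckegen t0 u0 v0 (hgen_t k)) r.
Proof.
move=> [i j].
have E : @hecke_rel X n K t0 u0 v0 _ _ := hecke_spin _ _ _ (@spin_braid _ _ _ _ i j).
rewrite !rmorphXn /= rmorphM rmorphN1 /= !free_eval_gen.
apply: etrans (congr1 (fun z => z ^+ _) (esym (aclassM _ _ _))) _.
apply: etrans (esym (aclassX _ _ _)) (etrans (aclass_rel E) _).
by apply: etrans (aclassX _ _ _) _; rewrite aclassN aclass1.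
Qed.

HB.instance Definition _ := GRing.isLinear.Build K (skewpoly K n) H *:%R
  (@of_skew X n K t0 u0 v0) (pres_map_is_linear of_skew_rel).
HB.instance Definition _ := GRing.isMonoidMorphism.Build (skewpoly K n) H
  (@of_skew X n K t0 u0 v0) (pres_map_is_monoid_morphism of_skew_rel).
HB.instance Definition _ := GRing.isLinear.Build K (clifford K n) H *:%R
  (@of_cliff X n K t0 u0 v0) (pres_map_is_linear of_cliff_rel).
HB.instance Definition _ := GRing.isMonoidMorphism.Build (clifford K n) H
  (@of_cliff X n K t0 u0 v0) (pres_map_is_monoid_morphism of_cliff_rel).
HB.instance Definition _ := GRing.isLinear.Build K (spin_algebra K X n) H *:%R
  (@of_spin X n K t0 u0 v0) (pres_map_is_linear of_spin_rel).
HB.instance Definition _ := GRing.isMonoidMorphism.Build (spin_algebra K X n) H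
  (@of_spin X n K t0 u0 v0) (pres_map_is_monoid_morphism of_spin_rel).

End CanonicalMorphisms.

(** * Functions dual to the normal words *)

Section CoefficientFunctional.
Variables (K : fieldType) (n : nat) (M : lmodType K).
Local Notation L := (letter n).
Local Notation pt := ('I_n * bool -> K).
Implicit Types (u w : seq L) (y z : L).

Definition lrank y : nat := match y with inl i => i | inr i => n + i end.

Lemma lrank_inj : injective lrank.
Proof.
move=> [i|i] [j|j] /= e; first by congr inl; apply: val_inj.
- by have := ltn_ord i; rewrite e ltnNge leq_addr.
- by have := ltn_ord j; rewrite -e ltnNge leq_addr.
by congr inr; apply: val_inj; move/addnI: e.
Qed.

(** The parity of the number of inversions, hence the sign of sorting the word with the [eta] before
    the [c]. Two adjacent equal letters contribute an even number. *)
Fixpoint winv w : bool :=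
  if w is y :: w' then
    odd (count (fun z => lrank z < lrank y)%N w') (+) winv w'
  else false.

(** The invariants of a word under the moves on letters: the multiplicity of each [eta_i], but only
    the parity for [c_i], whose square is 1. *)
Definition content (a : 'I_n -> nat) (d : 'I_n -> bool) w : bool :=
  [forall i, count_mem (inl i) w == a i] && [forall i, odd (count_mem (inr i) w) == d i].

Lemma winv_swap u w y z : y != z ->
  winv (u ++ y :: z :: w) = ~~ winv (u ++ z :: y :: w).
Proof.
move=> yz; elim: u => [|y' u IH] /=; last first.
  rewrite IH addbN; congr (~~ (odd _ (+) _)).
  by apply/seq.permP; rewrite perm_cat2l -[y :: _]/([:: y] ++ [:: z] ++ w) perm_catCA.
have : lrank y != lrank z by rewrite (inj_eq lrank_inj).
rewrite !oddD; case: ltngtP => // _ _ /=.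
  by rewrite addNb addbCA.
by rewrite addNb addbCA negbK.
Qed.

Lemma content_swap a d u w y z :
  content a d (u ++ y :: z :: w) = content a d (u ++ z :: y :: w).
Proof.
have P : perm_eq (u ++ y :: z :: w) (u ++ z :: y :: w).
  by rewrite perm_cat2l -[y :: _]/([:: y] ++ [:: z] ++ w) perm_catCA.
by congr (_ && _); apply: eq_forallb => i; rewrite (seq.permP P).
Qed.

Lemma winv_sq u w y : winv (u ++ y :: y :: w) = winv (u ++ w).
Proof.
elim: u => [|z u IH] /=; last first.
  rewrite IH !count_cat /=; congr (_ (+) _).
  by rewrite !oddD; case: (_ < _)%N; rewrite /= ?addNb ?addbN ?negbK.
by rewrite ltnn add0n addbA addbb.
Qed.

Lemma content_sq a d u w i : content a d (u ++ inr i :: inr i :: w) = content a d (u ++ w).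
Proof.
congr (_ && _); apply: eq_forallb => j; rewrite !count_cat //=.
by congr (_ == _); rewrite !oddD /=; case: (_ == _); rewrite /= ?addNb ?addbN ?negbK.
Qed.

Definition coef_fun a d (m : M) w (x : pt) : M :=
  if content a d w then (-1) ^+ winv w *: m else 0.

Fact coef_ok a d m : word_ok (coef_fun a d m).
Proof.
split=> [u w y z yz|u w i]; apply/funext => x; rewrite /coef_fun.
  rewrite content_swap winv_swap // -[(- _) x]/(- coef_fun a d m _ x) /coef_fun.
  by case: ifP; rewrite ?oppr0 // signrN scaleNr.
by rewrite content_sq winv_sq.
Qed.

Definition coefw a d m : wfun n M := WFun (introT (word_funP _) (coef_ok a d m)).

Lemma coefwE a d m w x : coefw a d m w x = coef_fun a d m w x.
Proof. by []. Qed.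

Definition normal_word (a : 'I_n -> nat) (d : 'I_n -> bool) : seq L :=
  flatten [seq nseq (a i) (inl i) | i <- enum 'I_n] ++
  flatten [seq nseq (d i) (inr i) | i <- enum 'I_n].

Lemma count_flat (T : eqType) (g : 'I_n -> T) (b : 'I_n -> nat) (z : T) :
  count_mem z (flatten [seq nseq (b i) (g i) | i <- enum 'I_n]) =
  (\sum_i (g i == z) * b i)%N.
Proof.
rewrite count_flatten sumnE 2!big_map big_enum; apply: eq_bigr => i _.
by rewrite count_nseq.
Qed.

Lemma count_flat_inj (T : eqType) (g : 'I_n -> T) (b : 'I_n -> nat) j :
  injective g ->
  count_mem (g j) (flatten [seq nseq (b i) (g i) | i <- enum 'I_n]) = b j.
Proof.
move=> gi; rewrite count_flat (bigD1 j) //= eqxx mul1n big1 ?addn0 // => i ij.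
by rewrite (inj_eq gi) (negPf ij).
Qed.

Lemma count_flat0 (T : eqType) (g : 'I_n -> T) (b : 'I_n -> nat) (z : T) :
  (forall i, g i != z) ->
  count_mem z (flatten [seq nseq (b i) (g i) | i <- enum 'I_n]) = 0%N.
Proof. by move=> gz; rewrite count_flat big1 // => i _; rewrite (negPf (gz i)). Qed.

Lemma content_normal_word a d a' d' :
  content a' d' (normal_word a d) = [forall i, a i == a' i] && [forall i, d i == d' i].
Proof.
congr (_ && _); apply: eq_forallb => j; rewrite count_cat.
  rewrite (count_flat_inj _ _ (@inl_inj _ _)) [X in (_ + X)%N]count_flat0 ?addn0 //.
rewrite [X in odd (X + _)]count_flat0 //.
by rewrite (count_flat_inj (fun i => nat_of_bool (d i)) _ (@inr_inj _ _)) add0n oddb.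
Qed.

Definition lops w : rop (wfun n M) := \prod_(y <- w) lop M y.

Lemma lopsE w (f : wfun n M) w' : lops w f w' = f (w ++ w').
Proof.
elim: w f => [|y w IH] f; first by rewrite /lops big_nil.
by rewrite /lops big_cons rop_mulE -/(lops w) IH lopE.
Qed.

Lemma prod_flat (R : pzRingType) (T : Type) (F : T -> R) (g : 'I_n -> T) (b : 'I_n -> nat) :
  \prod_(y <- flatten [seq nseq (b i) (g i) | i <- enum 'I_n]) F y =
  \prod_i F (g i) ^+ b i.
Proof.
rewrite big_flatten big_map enumT [index_enum _]unlock; apply: eq_bigr => i _.
by rewrite big_nseq; elim: (b i) => //= m ->; rewrite exprS.
Qed.

Lemma lops_normal_word a d : lops (normal_word a d) =
  (\prod_i eta_op M i ^+ a i) * (\prod_i c_op M i ^+ d i).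
Proof. by rewrite /lops big_cat /= !prod_flat. Qed.

End CoefficientFunctional.

Lemma rop_wfun_linE (K : fieldType) n (M : lmodType K) (a : K) (F G : rop (wfun n M))
    f w x : (a *: F + G) f w x = a *: F f w x + G f w x.
Proof. by rewrite rop_addE rop_scaleE wfun_addE wfun_scaleE; exact: erefl. Qed.

Lemma rop_wfun0E (K : fieldType) n (M : lmodType K) (f : wfun n M) w x :
  (0 : rop (wfun n M)) f w x = 0.
Proof. by []. Qed.

(** * Evaluating combinations of normal forms *)

Section Independence.
Variables (X : weyl_type) (n : nat).
Hypothesis Xn : valid_size X n.
Variables (K : fieldType) (t0 u0 v0 : K).
Hypothesis K0 : [pchar K] =i pred0.
Local Notation H := (hecke X n t0 u0 v0).
Local Notation S := (spin_algebra K X n).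
Local Notation U := (wfun n S).
Local Notation pt := ('I_n * bool -> K).

Definition spin_gen (k : 'I_(cox_rank X n)) : S := aclass _ (freegen K k).

Definition tau k : rop S := rmul (spin_gen k).

Lemma tau_spin k l :
  (tau k * tau l) ^+ cox_order k l = (-1) ^+ (cox_order k l).+1.
Proof.
rewrite /tau /spin_gen -rmulM -rmulX -rmul_sign -aclassM -aclassX; congr rmul.
rewrite (aclass_rel (@spin_braid _ _ _ _ k l)) aclassX; congr (_ ^+ _).
by rewrite aclassN aclass1.
Qed.

Local Notation xo := (x_op Xn tau_spin t0 u0 v0).
Local Notation eo := (eta_op S).
Local Notation co := (c_op S).
Local Notation to := (t_op Xn tau).

Lemma rcomm_eta_x i j : rcomm (eo i) (xo j) =
  kappa to co (scal_op U t0) (scal_op U u0) (scal_op U v0) (i, false) (j, false).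
Proof. by rewrite /rcomm x_eta_op opprB addrC subrK kappa_opE. Qed.

Definition ind_rep : H -> rop U := hecke_rep xo eo co to.

Fact ind_rep_linear : linear ind_rep.
Proof.
exact: (hecke_rep_is_linear (c_op_sq S) (@c_op_anti _ _ S) (t_spin_op Xn tau_spin)
  (@eta_op_anti _ _ S) (x_op_comm Xn tau_spin t0 u0 v0) (t_c_op Xn tau)
  (c_eta_op S) (c_x_op Xn tau_spin t0 u0 v0) (t_x_op Xn tau_spin t0 u0 v0)
  (t_eta_op Xn tau) rcomm_eta_x).
Qed.

Fact ind_rep_monoid_morphism : monoid_morphism ind_rep.
Proof.
exact: (hecke_rep_is_monoid_morphism (c_op_sq S) (@c_op_anti _ _ S) (t_spin_op Xn tau_spin)
  (@eta_op_anti _ _ S) (x_op_comm Xn tau_spin t0 u0 v0) (t_c_op Xn tau)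
  (c_eta_op S) (c_x_op Xn tau_spin t0 u0 v0) (t_x_op Xn tau_spin t0 u0 v0)
  (t_eta_op Xn tau) rcomm_eta_x).
Qed.

HB.instance Definition _ := GRing.isLinear.Build K H (rop U) *:%R ind_rep ind_rep_linear.
HB.instance Definition _ := GRing.isMonoidMorphism.Build H (rop U) ind_rep ind_rep_monoid_morphism.

Lemma ind_rep_gen g : ind_rep (heckegen t0 u0 v0 g) = hecke_op xo eo co to g.
Proof.
exact: (hecke_rep_gen (c_op_sq S) (@c_op_anti _ _ S) (t_spin_op Xn tau_spin)
  (@eta_op_anti _ _ S) (x_op_comm Xn tau_spin t0 u0 v0) (t_c_op Xn tau)
  (c_eta_op S) (c_x_op Xn tau_spin t0 u0 v0) (t_x_op Xn tau_spin t0 u0 v0)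
  (t_eta_op Xn tau) rcomm_eta_x).
Qed.

Lemma ind_rep_word a d (f : U) :
  ind_rep (skewmon X t0 u0 v0 a * cliffmon X t0 u0 v0 d) f [::] = f (normal_word a d).
Proof.
have -> : ind_rep (skewmon X t0 u0 v0 a * cliffmon X t0 u0 v0 d) = lops S (normal_word a d).
  rewrite rmorphM !rmorph_prod lops_normal_word; congr (_ * _); apply: eq_bigr => i _.
    rewrite [LHS]rmorphXn; congr (_ ^+ _); exact: ind_rep_gen.
  rewrite [LHS]rmorphXn; congr (_ ^+ _); exact: ind_rep_gen.
by rewrite lopsE cats0.
Qed.

(** Reflecting the point has no effect on a constant, so at the empty word only the right
    multiplications by the [spin_gen] remain. *)
Lemma ind_rep_spin z (f : U) (m : S) : (forall x, f [::] x = m) ->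
  forall x, ind_rep (of_spin t0 u0 v0 z) f [::] x = m * z.
Proof.
have of_spinM z1 z2 : of_spin t0 u0 v0 (z1 * z2) =
  of_spin t0 u0 v0 z1 * of_spin t0 u0 v0 z2 :> H by exact: rmorphM.
have of_spinP a z1 z2 : of_spin t0 u0 v0 (a *: z1 + z2) =
  a *: of_spin t0 u0 v0 z1 + of_spin t0 u0 v0 z2 :> H by exact: linearP.
have ind_repP a h1 h2 : ind_rep (a *: h1 + h2) = a *: ind_rep h1 + ind_rep h2.
  exact: linearP.
have opP a (F G : rop U) g x : (a *: F + G) g [::] x = a *: F g [::] x + G g [::] x.
  exact: rop_wfun_linE.
have ind_repM h1 h2 : ind_rep (h1 * h2) = ind_rep h1 * ind_rep h2 by exact: rmorphM.
elim/aclassW: z => p; elim/free_ind: p f m => [|k p IH|a p q IHp IHq] f m fm x.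
- by rewrite aclass1 !rmorph1 mulr1 rop_oneE.
- rewrite aclassM.
  have -> : ind_rep (of_spin t0 u0 v0 (spin_gen k * aclass _ p)) =
      to k * ind_rep (of_spin t0 u0 v0 (aclass _ p)).
    rewrite of_spinM ind_repM; congr (_ * _).
    exact: etrans (congr1 _ (of_spin_gen _ _ _ k)) (ind_rep_gen _).
  rewrite rop_mulE.
  rewrite (IH _ (m * spin_gen k)) ?mulrA // => y.
  by rewrite t_opE /Tfun scale1r /= fm.
rewrite aclassD aclassZ of_spinP ind_repP opP.
apply: etrans (congr2 (fun y z => a *: y + z) (IHp f m fm x) (IHq f m fm x)) _.
by rewrite [RHS]mulrDr; congr (_ + _); exact: aquot_scalerAr.
Qed.

Lemma ind_rep_poly (b : 'I_n -> nat) (f : U) x :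
  ind_rep (polymon X t0 u0 v0 b) f [::] x =
  (\prod_i (x (i, false) - x (i, true)) ^+ b i) *: f [::] x.
Proof.
rewrite rmorph_prod.
elim: (index_enum _) f => [|i r IH] f; first by rewrite !big_nil scale1r.
have e : ind_rep (heckegen t0 u0 v0 (hgen_x X i) ^+ b i) = xo i ^+ b i.
  apply: etrans (rmorphXn _ _ _) _; exact: (congr1 (fun F => F ^+ _) (ind_rep_gen _)).
rewrite !big_cons rop_mulE IH mulrC -scalerA; congr (_ *: _).
apply: etrans (congr1 (fun F : rop U => F f [::] x) e) _.
elim: (b i) f => [|m IHm] f; first by rewrite !expr0 scale1r rop_oneE.
rewrite [in LHS]exprS [in RHS]exprSr rop_mulE IHm -scalerA; congr (_ *: _).
Qed.

Lemma normal_forms_free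
  (s : seq ({ffun 'I_n -> nat} * {ffun 'I_n -> bool} * {ffun 'I_n -> nat}))
  (z : {ffun 'I_n -> nat} * {ffun 'I_n -> bool} * {ffun 'I_n -> nat} -> S) :
  uniq s ->
  \sum_(k <- s) skewmon X t0 u0 v0 k.1.1 * cliffmon X t0 u0 v0 k.1.2 *
    of_spin t0 u0 v0 (z k) * polymon X t0 u0 v0 k.2 = 0 ->
  {in s, forall k, z k = 0}.
Proof.
move=> us H0 [[a d] b] ks.
pose s' := [seq k.2 | k <- s & k.1 == (a, d)].
have us' : uniq s'.
  rewrite map_inj_in_uniq ?filter_uniq // => k k'.
  rewrite !mem_filter => /andP[/eqP e _] /andP[/eqP e' _].
  by case: k k' e e' => [k1 k2] [k1' k2'] /= -> -> ->.
apply: (monomials_free K0 (v := fun b => z (a, d, b)) us') => [y|]; last first.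
  by apply/mapP; exists (a, d, b); rewrite // mem_filter eqxx.
(* The coordinates are differences [x (i, false) - x (i, true)], hence a point with coordinates
   [y i]. *)
pose x (p : 'I_n * bool) := if p.2 then 0 else y p.1.
(* The sign of the normal word is not computed: the relation is multiplied by it, and it cancels
   against the value of [coefw]. *)
pose sg := (-1) ^+ winv (normal_word a d) : K.
have ind_rep0 : ind_rep 0 (coefw a d (1 : S)) [::] x = 0.
  apply: etrans (rop_wfun0E (coefw a d (1 : S)) [::] x).
  exact: (congr1 (fun F : rop U => F (coefw a d (1 : S)) [::] x) (linear0 _)).
have H1 : sg *: ind_rep (\sum_(k <- s) skewmon X t0 u0 v0 k.1.1 * cliffmon X t0 u0 v0 k.1.2 *
    of_spin t0 u0 v0 (z k) * polymon X t0 u0 v0 k.2) (coefw a d (1 : S)) [::] x = 0.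
  by rewrite H0 ind_rep0 scaler0.
rewrite -[RHS]H1.
have repE (k : {ffun 'I_n -> nat} * {ffun 'I_n -> bool} * {ffun 'I_n -> nat}) : ind_rep (skewmon X t0 u0 v0 k.1.1 * cliffmon X t0 u0 v0 k.1.2 *
    of_spin t0 u0 v0 (z k) * polymon X t0 u0 v0 k.2) (coefw a d (1 : S)) [::] x =
  if k.1 == (a, d) then sg *: ((\prod_i y i ^+ k.2 i) *: z k) else 0.
  rewrite rmorphM rop_mulE ind_rep_poly rmorphM rop_mulE.
  rewrite (ind_rep_spin _ (m := @coef_fun K n S a d 1 (normal_word k.1.1 k.1.2) x)); last first.
    by move=> x'; rewrite ind_rep_word coefwE.
  rewrite /coef_fun content_normal_word.
  have -> : [forall i, k.1.1 i == a i] && [forall i, k.1.2 i == d i] = (k.1 == (a, d)).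
    rewrite -pair_eqE /=; congr (_ && _).
      apply/forallP/eqP => [h|-> //]; by apply/ffunP => i; apply/eqP/h.
    apply/forallP/eqP => [h|-> //]; by apply/ffunP => i; apply/eqP/h.
  case: eqP => [e|_]; last by rewrite mul0r scaler0.
  have scale1M (r : K) (g : S) : (r *: (1 : S)) * g = r *: g.
    by rewrite -aquot_scalerAl mul1r.
  rewrite e scale1M scalerA mulrC -scalerA; congr (_ *: (_ *: _)).
  by apply: eq_bigr => i _; rewrite /x /= subr0.
have sumE (r : seq _) (F : _ -> H) : ind_rep (\sum_(k <- r) F k) (coefw a d (1 : S)) [::] x =
    \sum_(k <- r) ind_rep (F k) (coefw a d (1 : S)) [::] x.
  elim: r => [|k r IH]; first by rewrite !big_nil.
  rewrite !big_cons -IH -[ind_rep (F k) _ _ _]scale1r -rop_wfun_linE scale1r.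
  exact: (congr1 (fun F : rop U => F (coefw a d (1 : S)) [::] x) (linearD _ _ _)).
rewrite sumE (eq_bigr _ (fun k _ => repE k)) -big_mkcond /= scaler_sumr.
rewrite big_map big_filter; apply: eq_bigr => k /eqP e.
have -> : forall w : S, sg *: (sg *: w) = w.
  by move=> w; rewrite scalerA -expr2 sqrr_sign scale1r.
by case: k e => k1 k2 /= ->.
Qed.

End Independence.

(** * The normal forms span *)

Lemma lspan_mono (K : fieldType) (V V' : lmodType K) (S : V -> Prop) (S' : V' -> Prop)
    (f : V -> V') : f 0 = 0 -> (forall a u v, f (a *: u + v) = a *: f u + f v) ->
  (forall v, S v -> lspan S' (f v)) -> forall v, lspan S v -> lspan S' (f v).
Proof.
move=> f0 fl fS v; elim=> [|{}v Sv|a u w _ IHu _ IHw].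
- by rewrite f0; apply: lspan0.
- exact: fS.
by rewrite fl; apply: lspan_lin.
Qed.

Lemma lspan_sub (K : fieldType) (V : lmodType K) (S S' : V -> Prop) :
  (forall v, S v -> lspan S' v) -> forall v, lspan S v -> lspan S' v.
Proof. by move=> h; apply: (lspan_mono (f := id)). Qed.

Lemma lspan_sign (K : fieldType) (A : algType K) (rel : A -> A -> Prop)
    (S : aquot rel -> Prop) (b : nat) v : lspan S v -> lspan S ((-1) ^+ b * v).
Proof.
move=> Sv; rewrite -signr_odd mulr_sign; case: odd => //; exact: lspanN.
Qed.

Section WordSorting.
Variables (A : pzRingType) (n : nat) (y : 'I_n -> A).
Hypothesis y_comm : forall i j, exists b : bool, y i * y j = (-1) ^+ b * (y j * y i).

Lemma sign_exp_comm i j m : exists b : bool, y i * y j ^+ m = (-1) ^+ b * (y j ^+ m * y i).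
Proof.
have [b e] := y_comm i j.
elim: m => [|m [b' e']]; first by exists false; rewrite !expr0 !mul1r mulr1.
exists (b (+) b'); rewrite exprS mulrA e -!mulrA e' signr_addb -!mulrA; congr (_ * _).
by rewrite [LHS]mulrA commr_sign -!mulrA.
Qed.

Lemma prod_insert (r : seq 'I_n) (m : 'I_n -> nat) j : uniq r -> j \in r ->
  exists b : bool, y j * \prod_(i <- r) y i ^+ m i =
    (-1) ^+ b * \prod_(i <- r) y i ^+ ((j == i) + m i)%N.
Proof.
elim: r => //= i r IH /andP[ir ur]; rewrite inE.
have [->|ji] /= := eqVneq j i.
  move=> _; exists false; rewrite !big_cons eqxx add1n exprS mul1r mulrA; congr (_ * _).
  apply: eq_big_seq => k kr; case: eqP => [ik|]; last by rewrite add0n.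
  by rewrite ik kr in ir.
move=> jr; have [b e] := IH ur jr; have [b' e'] := sign_exp_comm j i (m i).
exists (b' (+) b); rewrite !big_cons (negPf ji) add0n mulrA e' -!mulrA e signr_addb -!mulrA.
by congr (_ * _); rewrite [LHS]mulrA commr_sign -!mulrA.
Qed.

(** Commutation up to a sign is general enough to sort words in the [eta], in the [c] and in the [x]
    alike. *)
Lemma word_sort (w : seq 'I_n) : exists b : bool,
  \prod_(i <- w) y i = (-1) ^+ b * \prod_i y i ^+ count_mem i w.
Proof.
elim: w => [|j w [b e]].
  by exists false; rewrite big_nil mul1r big1 // => i _; rewrite expr0.
have [b' e'] := prod_insert (fun i => count_mem i w) (index_enum_uniq _) (mem_index_enum j).
exists (b (+) b'); rewrite big_cons e [LHS]mulrA commr_sign -mulrA e'.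
by rewrite mulrA signr_addb.
Qed.

End WordSorting.

Section PresentedWords.
Variables (K : fieldType) (G : choiceType) (rel : freealg K G -> freealg K G -> Prop).

Lemma aclass_mul_rel p q r : rel (p * q) r -> aclass rel p * aclass rel q = aclass rel r.
Proof. by move=> h; apply: etrans (esym (aclassM _ _ _)) (aclass_rel h). Qed.

Lemma aquot_word_span (z : aquot rel) :
  lspan (fun h => exists w : seq G, h = \prod_(g <- w) aclass rel (freegen K g)) z.
Proof.
elim/aclassW: z; elim/free_ind => [|g p IH|a p q IHp IHq].
- by apply: lspan_gen; exists [::]; rewrite big_nil.
- rewrite aclassM.
  apply: (lspan_mono (f := fun z => aclass rel (freegen K g) * z)) IH.
  + exact: mulr0.
  + by move=> a u v; rewrite mulrDr -aquot_scalerAr.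
  by move=> _ [w ->]; apply: lspan_gen; exists (g :: w); rewrite big_cons.
by rewrite aclassD aclassZ; apply: lspan_lin.
Qed.

End PresentedWords.

(** * Predicates inherited by the right-hand sides of the commutators *)

Section BracketClosure.
Variables (K : fieldType) (A : algType K) (P : A -> Prop).
Hypotheses (P1 : P 1) (PM : forall a b, P a -> P b -> P (a * b)).
Hypothesis PL : forall k a b, P a -> P b -> P (k *: a + b).
Variables (X : weyl_type) (n : nat) (c : 'I_n -> A) (t : 'I_(cox_rank X n) -> A).
Hypotheses (Pc : forall i, P (c i)) (Pt : forall k, P (t k)).

Lemma clos0 : P 0. Proof. by rewrite -[0](addNr 1) -scaleN1r; apply: PL. Qed.
Lemma closZ k a : P a -> P (k *: a).
Proof. by move=> Pa; rewrite -[_ *: _]addr0; apply: PL => //; apply: clos0. Qed.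
Lemma closN a : P a -> P (- a). Proof. by rewrite -scaleN1r; apply: closZ. Qed.
Lemma closD a b : P a -> P b -> P (a + b).
Proof. by move=> Pa; rewrite -[a]scale1r; apply: PL. Qed.
Lemma closB a b : P a -> P b -> P (a - b).
Proof. by move=> Pa /closN; apply: closD. Qed.
Lemma clos_sign m : P ((-1) ^+ m).
Proof. by elim: m => // m IH; rewrite exprS; apply: PM => //; apply/closN/P1. Qed.

Lemma clos_tgen k : P (tgen t k).
Proof. by rewrite /tgen; case: insub => [i|] /=; [apply: Pt|apply: clos0]. Qed.
Lemma clos_tup i j : P (tup t i j).
Proof. by rewrite /tup; elim/big_ind: _ => // k _; apply: clos_tgen. Qed.
Lemma clos_tdown i j : P (tdown t i j).
Proof. by rewrite /tdown; elim/big_ind: _ => // k _; apply: clos_tgen. Qed.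

Lemma clos_br i j : P (br t i j).
Proof.
have H a b : P (br_lt t a b).
  by apply: PM (clos_sign _) _; apply: PM; [apply: clos_tdown|apply: clos_tup].
by rewrite /br; case: ifP => _; [apply: H|apply/closN/H].
Qed.

Lemma clos_br_bar i j : P (br_bar t i j).
Proof.
have H a b : P (br_bar_lt t a b).
  rewrite /br_bar_lt; case: X t Pt (clos_tgen) (clos_tup) (clos_tdown) => // t' _ h1 h2 h3.
  - exact: clos0.
  - by apply: PM (clos_sign _) _; do 4![apply: PM => //].
  by apply: PM (clos_sign _) _; do 6![apply: PM => //].
by rewrite /br_bar; case: ifP.
Qed.

Lemma clos_sbr_bar i : P (sbr_bar t i).
Proof.
rewrite /sbr_bar; case: X t (clos_tup) (clos_tdown) => // t' h2 h3; try exact: clos0.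
by apply: PM (clos_sign _) _; apply: PM.
Qed.

Lemma clos_term k l i j : P ((1 + c k * c l) * br t i j - (1 - c k * c l) * br_bar t i j).
Proof.
have Pcc : P (c k * c l) by apply: PM.
apply: closB; apply: PM; [exact: closD|exact: clos_br|exact: closB|exact: clos_br_bar].
Qed.

Lemma clos_eta_x t0 u0 v0 i : P (t0 *: c i
       + u0 *: (\sum_(k < n | k != i)
                  ((1 + c k * c i) * br t k.+1 i.+1
                   - (1 - c k * c i) * br_bar t k.+1 i.+1))
       + v0 *: sbr_bar t i.+1).
Proof.
apply: closD; last exact/closZ/clos_sbr_bar.
apply: PL => //; apply: closZ; elim/big_ind: _ => [|a b|k _].
- exact: clos0.
- exact: closD.
exact: clos_term.
Qed.

End BracketClosure.

Lemma mul_sign_swap (B : pzRingType) m (a b : B) : a * ((-1) ^+ m * b) = (-1) ^+ m * (a * b).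
Proof. by rewrite [LHS]mulrA commr_sign -!mulrA. Qed.

Lemma move_past (B : pzRingType) (I : Type) (y : I -> B) (g : B) (w : seq I) :
  (forall i, exists (b : bool) j, g * y i = (-1) ^+ b * (y j * g)) ->
  exists (b : bool) w', g * (\prod_(i <- w) y i) = (-1) ^+ b * ((\prod_(i <- w') y i) * g).
Proof.
move=> gy; elim: w => [|i w [b [w' IH]]].
  by exists false, [::]; rewrite !big_nil !mul1r mulr1.
have [b' [j e]] := gy i; exists (b' (+) b), (j :: w').
rewrite !big_cons mulrA e -!mulrA IH signr_addb -!mulrA; congr (_ * _).
by rewrite mul_sign_swap.
Qed.

(** * Straightening words *)

Section HeckeSpan.
Variables (X : weyl_type) (n : nat).
Hypothesis Xn : valid_size X n.
Variables (K : fieldType) (t0 u0 v0 : K).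
Local Notation H := (hecke X n t0 u0 v0).
Local Notation S := (spin_algebra K X n).
Local Notation rl := (@hecke_rel X n K t0 u0 v0).
Local Notation x i := (heckegen t0 u0 v0 (hgen_x X i)).
Local Notation e i := (heckegen t0 u0 v0 (hgen_e X i)).
Local Notation c i := (heckegen t0 u0 v0 (hgen_c X i)).
Local Notation t k := (heckegen t0 u0 v0 (hgen_t k)).

Implicit Types (i j : 'I_n) (k : 'I_(cox_rank X n)) (z : S).

Lemma aclass_sign m : aclass rl ((-1) ^+ m) = (-1) ^+ m.
Proof. by rewrite aclassX aclassN aclass1. Qed.

Lemma hecke_ee i j : i != j -> e i * e j = - (e j * e i).
Proof.
move=> ij; apply: etrans (aclass_mul_rel (hecke_skew _ _ _ (skew_anti _ ij))) _.
exact: etrans (aclassN _ _) (congr1 -%R (aclassM _ _ _)).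
Qed.

Lemma hecke_cc i j : i != j -> c i * c j = - (c j * c i).
Proof.
move=> ij; apply: etrans (aclass_mul_rel (hecke_cliff _ _ _ (cliff_anti _ ij))) _.
exact: etrans (aclassN _ _) (congr1 -%R (aclassM _ _ _)).
Qed.

Lemma hecke_cc1 i : c i * c i = 1.
Proof. exact: aclass_mul_rel (hecke_cliff _ _ _ (cliff_sq _ i)). Qed.

Lemma hecke_xx i j : x i * x j = x j * x i.
Proof.
have [->//|ij] := eqVneq i j.
by apply: etrans (aclass_mul_rel (hecke_x _ _ _ _ ij)) _; exact: aclassM.
Qed.

Lemma hecke_c_e i j : c i * e j = - (e j * c i).
Proof.
apply: etrans (aclass_mul_rel (hecke_ce _ _ _ _ i j)) _.
exact: etrans (aclassN _ _) (congr1 -%R (aclassM _ _ _)).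
Qed.

Lemma hecke_c_x i j : c i * x j = (-1) ^+ (i == j) * (x j * c i).
Proof.
apply: etrans (aclass_mul_rel (hecke_cx _ _ _ _ i j)) _.
exact: etrans (aclassM _ _ _) (congr2 *%R (aclass_sign _) (aclassM _ _ _)).
Qed.

Lemma hecke_t_e k j : t k * e j = - (e (unsigned (simple_refl k) j) * t k).
Proof.
apply: etrans (aclass_mul_rel (hecke_te _ _ _ k j)) _.
exact: etrans (aclassN _ _) (congr1 -%R (aclassM _ _ _)).
Qed.

Lemma hecke_t_c k j : exists (b : bool) i, t k * c j = (-1) ^+ b * (c i * t k).
Proof.
exists (~~ (simple_refl k (j, false)).2), (simple_refl k (j, false)).1.
apply: etrans (aclass_mul_rel (hecke_tc _ _ _ k j)) _.
rewrite signrN mulNr; apply: etrans (aclassN _ _) (congr1 -%R _).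
apply: etrans (aclassM _ _ _) _; rewrite mulrA; congr (_ * _).
exact: etrans (aclassM _ _ _) (congr2 *%R (aclass_sign _) erefl).
Qed.

Lemma hecke_x_t k j : exists (b : bool) i, x j * t k = (-1) ^+ b * (t k * x i).
Proof.
pose s := simple_refl k; pose i := (s (j, false)).1.
have ij : (s (i, false)).1 = j.
  have := simple_refl_fst Xn k (i, false) (s (j, false)).
  by rewrite (simple_reflK Xn) eqxx => /eqP.
exists (s (i, false)).2, i.
suff -> : t k * x i = (-1) ^+ (s (i, false)).2 * (x j * t k).
  by rewrite mulrA -expr2 sqrr_sign mul1r.
apply: etrans (aclass_mul_rel (hecke_tx _ _ _ k i)) _.
apply: etrans (aclassM _ _ _) _; rewrite mulrA; congr (_ * _).
rewrite /signed_act -/s ij.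
exact: etrans (aclassM _ _ _) (congr2 *%R (aclass_sign _) erefl).
Qed.

(** Normal forms before sorting: the four kinds of factors are in order, but letters of one kind may
    come in any order and repeat. Moving a generator into place is then separate from sorting. *)
Definition word_forms (h : H) : Prop := exists (ew cw : seq 'I_n) (z : S) (xw : seq 'I_n),
  h = (\prod_(i <- ew) e i) * ((\prod_(i <- cw) c i) * (of_spin t0 u0 v0 z * \prod_(i <- xw) x i)).

Local Notation Q := (lspan word_forms).

(** These elements form a subalgebra, so membership of the [c_i] and [t_k] extends at once to the
    brackets and to the commutators built from them. *)
Definition stab (h : H) : Prop := forall g, Q g -> Q (h * g).

Lemma stab_gen h : (forall g, word_forms g -> Q (h * g)) -> stab h.
Proof.
move=> hw g; apply: (lspan_mono (f := fun g => h * g)) => //; first exact: mulr0.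
by move=> a u v; rewrite mulrDr -aquot_scalerAr.
Qed.

Lemma stab1 : stab 1. Proof. by move=> g; rewrite mul1r. Qed.

Lemma stabM g h : stab g -> stab h -> stab (g * h).
Proof. by move=> Pg Ph z Qz; rewrite -mulrA; apply/Pg/Ph. Qed.

Lemma stabL a g h : stab g -> stab h -> stab (a *: g + h).
Proof.
by move=> Pg Ph z Qz; rewrite mulrDl -aquot_scalerAl; apply: lspan_lin; [apply: Pg|apply: Ph].
Qed.

Lemma stab_e i : stab (e i).
Proof.
apply: stab_gen => _ [ew [cw [z [xw ->]]]]; apply: lspan_gen.
by exists (i :: ew), cw, z, xw; rewrite big_cons mulrA.
Qed.

Lemma stab_c i : stab (c i).
Proof.
apply: stab_gen => _ [ew [cw [z [xw ->]]]].
have [|b [ew' E]] := @move_past _ _ (fun i => e i) (c i) ew.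
  by move=> j; exists true, j; rewrite expr1 mulN1r; apply: hecke_c_e.
rewrite mulrA E -!mulrA; apply/lspan_sign/lspan_gen.
by exists ew', (i :: cw), z, xw; rewrite big_cons !mulrA.
Qed.

Lemma stab_t k : stab (t k).
Proof.
apply: stab_gen => _ [ew [cw [z [xw ->]]]].
have [|b [ew' E]] := @move_past _ _ (fun i => e i) (t k) ew.
  by move=> j; exists true, (unsigned (simple_refl k) j); rewrite expr1 mulN1r; apply: hecke_t_e.
have [|b' [cw' E']] := @move_past _ _ (fun i => c i) (t k) cw.
  by move=> j; apply: hecke_t_c.
rewrite mulrA E -!mulrA; apply/lspan_sign.
rewrite (mulrA (t k)) E' -!mulrA mul_sign_swap; apply/lspan_sign/lspan_gen.
exists ew', cw', (aclass _ (freegen K k) * z), xw.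
have -> : of_spin t0 u0 v0 (aclass _ (freegen K k) * z) = t k * of_spin t0 u0 v0 z.
  apply: etrans (rmorphM _ _ _) _; congr (_ * _); exact: of_spin_gen.
by rewrite !mulrA.
Qed.

Lemma aclassP a p q : aclass rl (a *: p + q) = a *: aclass rl p + aclass rl q.
Proof. by rewrite aclassD aclassZ. Qed.

(** The commutator is a polynomial in the [c] and [t], whose stability precedes that of the [x];
    this is what keeps the argument for [x j] from being circular. *)
Lemma stab_rcomm i j : stab (e i * x j - x j * e i).
Proof.
have E : e i * x j - x j * e i =
    aclass rl (rcomm (freegen K (hgen_e X i)) (freegen K (hgen_x X j))).
  apply: esym; apply: etrans (aclassD _ _ _) _; congr (_ + _); first exact: aclassM.
  exact: etrans (aclassN _ _) (congr1 -%R (aclassM _ _ _)).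
rewrite E; pose P p := stab (aclass rl p).
have P1 : P 1 by rewrite /P aclass1; apply: stab1.
have PM a b : P a -> P b -> P (a * b) by rewrite /P aclassM; apply: stabM.
have PL (r : K) a b : P a -> P b -> P (r *: a + b) by rewrite /P aclassP; apply: stabL.
have Pc i' : P (freegen K (hgen_c X i')) by apply: stab_c.
have Pt k : P (freegen K (hgen_t k)) by apply: stab_t.
have [<-|ij] := eqVneq i j; last first.
  rewrite (aclass_rel (hecke_ex _ t0 u0 v0 ij)) -/(P _); apply: (closZ P1 PL).
  exact: (clos_term P1 PM PL Pc Pt).
rewrite (aclass_rel (hecke_exi X t0 u0 v0 i)) -/(P _).
exact: (clos_eta_x P1 PM PL Pc Pt).
Qed.

Lemma x_spin_span j z xw : Q (x j * (of_spin t0 u0 v0 z * \prod_(i <- xw) x i)).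
Proof.
have of_spinM z1 z2 : of_spin t0 u0 v0 (z1 * z2) =
  of_spin t0 u0 v0 z1 * of_spin t0 u0 v0 z2 :> H by exact: rmorphM.
have of_spinP a z1 z2 : of_spin t0 u0 v0 (a *: z1 + z2) =
  a *: of_spin t0 u0 v0 z1 + of_spin t0 u0 v0 z2 :> H by exact: linearP.
elim/aclassW: z => p; elim/free_ind: p j => [|k p IH|a p q IHp IHq] j.
- rewrite aclass1 rmorph1 mul1r; apply: lspan_gen.
  exists [::], [::], 1, (j :: xw); rewrite rmorph1 !big_nil !mul1r.
  by rewrite big_cons.
- rewrite aclassM of_spinM of_spin_gen -mulrA mulrA.
  have [b [i ->]] := hecke_x_t k j.
  by rewrite -!mulrA; apply/lspan_sign/stab_t/IH.
rewrite aclassD aclassZ of_spinP.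
move: (of_spin _ _ _ _) (of_spin _ _ _ _) (IHp j) (IHq j) => g h Qg Qh.
by rewrite mulrDl mulrDr -aquot_scalerAl -aquot_scalerAr; apply: lspan_lin.
Qed.

(** Induction on the [eta] letters: passing one of them leaves the commutator applied to a form with
    fewer letters. *)
Lemma stab_x j : stab (x j).
Proof.
apply: stab_gen => _ [ew [cw [z [xw ->]]]].
elim: ew => [|i ew IH].
  rewrite big_nil mul1r; elim: cw => [|i cw IH].
    by rewrite big_nil mul1r; apply: x_spin_span.
  rewrite big_cons -mulrA mulrA.
  have -> : x j * c i = (-1) ^+ (i == j) * (c i * x j).
    by rewrite hecke_c_x mulrA -expr2 sqrr_sign mul1r.
  by rewrite -!mulrA; apply/lspan_sign/stab_c.
have key h : Q h -> Q (x j * h) -> Q (x j * (e i * h)).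
  move=> Qh Qxh.
  have -> : x j * (e i * h) = e i * (x j * h) - (e i * x j - x j * e i) * h.
    by rewrite mulrBl opprB addrCA !mulrA subrr addr0.
  by apply: lspanB; [exact: stab_e|exact: stab_rcomm].
rewrite big_cons -mulrA; apply: key IH.
by apply: lspan_gen; exists ew, cw, z, xw.
Qed.

Lemma word_forms_span h : Q h.
Proof.
elim/aclassW: h; elim/free_ind => [|g p IH|a p q IHp IHq].
- apply: lspan_gen; exists [::], [::], 1, [::].
  by rewrite !big_nil rmorph1 !mul1r.
- rewrite aclassM; case: g => [[i|i]|[i|k]].
  + exact: stab_x.
  + exact: stab_e.
  + exact: stab_c.
  exact: stab_t.
by rewrite aclassP; apply: lspan_lin.
Qed.

End HeckeSpan.

(** * Tensor products and the main theorem *)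

Section Combinations.
Variables (K : fieldType) (I : eqType) (S V : lmodType K) (F : I -> S -> V).
Hypothesis F_lin : forall k, linear (F k).

Lemma big_undup_sub (s d : seq I) (G : I -> V) : uniq s -> uniq d -> {subset s <= d} ->
  \sum_(k <- d) (if k \in s then G k else 0) = \sum_(k <- s) G k.
Proof.
move=> us ud sd; rewrite -big_mkcond /= -big_filter; apply: perm_big.
apply: uniq_perm => [|//|k]; first exact: filter_uniq.
by rewrite mem_filter; case ks: (k \in s) => //=; apply: sd.
Qed.

Let F0 k : F k 0 = 0.
Proof. by have := F_lin k (-1) 0 0; rewrite !scaleN1r !addNr. Qed.

(** Terms with the same [k] are merged by linearity of [F k], so that the keys become distinct, as
    independence over the spin algebra requires. *)
Lemma lspan_combination v : lspan (fun v => exists k z, v = F k z) v ->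
  exists (s : seq I) (z : I -> S), uniq s /\ v = \sum_(k <- s) F k (z k).
Proof.
elim=> [|_ [k [z ->]]|a u w _ [s1 [z1 [u1 ->]]] _ [s2 [z2 [u2 ->]]]].
- by exists [::], (fun _ => 0); rewrite big_nil.
- by exists [:: k], (fun _ => z); rewrite big_seq1.
pose d := undup (s1 ++ s2).
exists d, (fun k => a *: (if k \in s1 then z1 k else 0) + (if k \in s2 then z2 k else 0)).
split; first exact: undup_uniq.
rewrite -(big_undup_sub (d := d) (fun k => F k (z1 k)) u1); first last.
- by move=> k ks; rewrite mem_undup mem_cat ks.
- exact: undup_uniq.
rewrite -(big_undup_sub (d := d) (fun k => F k (z2 k)) u2); first last.
- by move=> k ks; rewrite mem_undup mem_cat ks orbT.
- exact: undup_uniq.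
rewrite scaler_sumr -big_split /=; apply: eq_bigr => k _; rewrite F_lin.
by congr (_ *: _ + _); case: ifP.
Qed.

Lemma sum_by_key (J : eqType) (r : seq J) (key : J -> I) (val : J -> S) :
  \sum_(j <- r) F (key j) (val j) =
  \sum_(k <- undup (map key r)) F k (\sum_(j <- r | key j == k) val j).
Proof.
have F_sum k (P : pred J) : F k (\sum_(j <- r | P j) val j) = \sum_(j <- r | P j) F k (val j).
  apply: (big_morph (F k) _ (F0 k)) => u v.
  by have := F_lin k 1 u v; rewrite !scale1r.
under [RHS]eq_bigr => k _ do rewrite F_sum.
rewrite (exchange_big_dep xpredT) //=; apply: eq_big_seq => j jr.
under eq_bigl => k do rewrite eq_sym.
by rewrite -big_filter filter_pred1_uniq ?big_seq1 ?undup_uniq // mem_undup map_f.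
Qed.

End Combinations.

(** * Universal property of the tensor product *)

Section TensorLift.
Variables (K : fieldType) (U V W : lmodType K) (b : U -> V -> W).
Hypotheses (b_l : forall v, linear (b^~ v)) (b_r : forall u, linear (b u)).

Lemma tens_l a u u' (v : V) : tens (a *: u + u' : U) v = a *: tens u v + tens u' v.
Proof. by rewrite /tens -lquot_piZ -lquot_piD; apply/lquot_eq/lspan_gen; exact: bilin_l. Qed.

Lemma tens_r a (u : U) v v' : tens u (a *: v + v' : V) = a *: tens u v + tens u v'.
Proof. by rewrite /tens -lquot_piZ -lquot_piD; apply/lquot_eq/lspan_gen; exact: bilin_r. Qed.

Lemma tens_span (z : tensor U V) : lspan (fun z => exists u v, z = tens u v) z.
Proof.
elim/lquotW: z => p; rewrite (monalgE p); elim/big_ind: _ => [|p1 p2 h1 h2|[u v] _].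
- by rewrite -[0](scale0r (0 : {malg K[(U * V)%type]})) lquot_piZ scale0r; apply: lspan0.
- by rewrite lquot_piD; apply: lspanD.
have -> : << p@_(u, v) *g (u, v) >> = p@_(u, v) *: << (u, v) >> :> {malg K[(U * V)%type]}.
  by apply/malgP => k; rewrite mcoeffZ !mcoeffU mulr_natr.
by rewrite lquot_piZ; apply/lspanZ/lspan_gen; exists u, v.
Qed.

Definition tens_lift (z : tensor U V) : W := lin_ext (fun uv => b uv.1 uv.2) (repr z).

Lemma tens_liftE p : tens_lift (\pi_(lquot _) p) = lin_ext (fun uv => b uv.1 uv.2) p.
Proof.
apply/eqP; rewrite -subr_eq0 -linearB; apply/eqP.
elim: (lquot_repr (@bilin_rel K U V) p) => [|_ [a u u' v|a u v v']|a q r _ q0 _ r0].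
- exact: linear0.
- by rewrite linearB linearP /= !lin_extU !scale1r /= b_l subrr.
- by rewrite linearB linearP /= !lin_extU !scale1r /= b_r subrr.
by rewrite linearP /= q0 r0 scaler0 addr0.
Qed.

Lemma tens_lift_tens u v : tens_lift (tens u v) = b u v.
Proof. by rewrite tens_liftE lin_extU scale1r. Qed.

Lemma tens_lift_is_linear : linear tens_lift.
Proof.
move=> a p q; elim/lquotW: p => p; elim/lquotW: q => q.
by rewrite -lquot_piZ -lquot_piD !tens_liftE linearP.
Qed.

End TensorLift.

Section NormalForms.
Variables (X : weyl_type) (n : nat).
Hypothesis Xn : valid_size X n.
Variables (K : fieldType) (t0 u0 v0 : K).
Local Notation H := (hecke X n t0 u0 v0).
Local Notation S := (spin_algebra K X n).
Local Notation key := ({ffun 'I_n -> nat} * {ffun 'I_n -> bool} * {ffun 'I_n -> nat})%type.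

(** The spin factor is kept as a coefficient instead of being expanded in a basis: the tensor
    product statement refers to none, and an arbitrary basis can be substituted afterwards. *)
Definition normal_form (k : key) (z : S) : H :=
  skewmon X t0 u0 v0 k.1.1 * cliffmon X t0 u0 v0 k.1.2 * of_spin t0 u0 v0 z *
  polymon X t0 u0 v0 k.2.

Lemma normal_form_is_linear k : linear (normal_form k).
Proof.
have of_spinP a z1 z2 : of_spin t0 u0 v0 (a *: z1 + z2) =
  a *: of_spin t0 u0 v0 z1 + of_spin t0 u0 v0 z2 :> H by exact: linearP.
move=> a z1 z2; rewrite /normal_form of_spinP.
by rewrite mulrDr mulrDl -aquot_scalerAr -aquot_scalerAl.
Qed.

Lemma expr_odd_sqr1 (A : pzRingType) (c : A) m : c * c = 1 -> c ^+ m = c ^+ odd m.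
Proof.
by move=> c2; rewrite -[in LHS](odd_double_half m) exprD -mul2n exprM expr2 c2 expr1n mulr1.
Qed.

Lemma normal_form_words ew cw z xw : exists (b : bool) k,
  (\prod_(i <- ew) heckegen t0 u0 v0 (hgen_e X i)) *
  ((\prod_(i <- cw) heckegen t0 u0 v0 (hgen_c X i)) *
   (of_spin t0 u0 v0 z * \prod_(i <- xw) heckegen t0 u0 v0 (hgen_x X i))) =
  (-1) ^+ b * normal_form k z.
Proof.
have comm_of_anti (y : 'I_n -> H) : (forall i j, i != j -> y i * y j = - (y j * y i)) ->
    forall i j, exists b : bool, y i * y j = (-1) ^+ b * (y j * y i).
  move=> ya i j; have [->|ij] := eqVneq i j; first by exists false; rewrite mul1r.
  by exists true; rewrite expr1 mulN1r; apply: ya.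
have [|b1 E1] := @word_sort _ n (fun i => heckegen t0 u0 v0 (hgen_e X i)) _ ew.
  by apply: comm_of_anti => i j; apply: hecke_ee.
have [|b2 E2] := @word_sort _ n (fun i => heckegen t0 u0 v0 (hgen_c X i)) _ cw.
  by apply: comm_of_anti => i j; apply: hecke_cc.
have [|b3 E3] := @word_sort _ n (fun i => heckegen t0 u0 v0 (hgen_x X i)) _ xw.
  by move=> i j; exists false; rewrite mul1r; apply: hecke_xx.
exists (b1 (+) (b2 (+) b3)), ([ffun i => count_mem i ew], [ffun i => odd (count_mem i cw)],
  [ffun i => count_mem i xw]).
have -> : normal_form ([ffun i => count_mem i ew], [ffun i => odd (count_mem i cw)],
    [ffun i => count_mem i xw]) z =
  (\prod_i heckegen t0 u0 v0 (hgen_e X i) ^+ count_mem i ew) *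
  ((\prod_i heckegen t0 u0 v0 (hgen_c X i) ^+ count_mem i cw) *
  (of_spin t0 u0 v0 z * \prod_i heckegen t0 u0 v0 (hgen_x X i) ^+ count_mem i xw)).
  rewrite /normal_form /skewmon /cliffmon /polymon -!mulrA; congr (_ * (_ * (_ * _))).
  - by apply: eq_bigr => i _; rewrite ffunE.
  - apply: eq_bigr => i _; rewrite ffunE; apply/esym/expr_odd_sqr1; exact: hecke_cc1.
  by apply: eq_bigr => i _; rewrite ffunE.
rewrite E1 E2 E3 (mul_sign_swap b3) -!mulrA !signr_addb -!mulrA; congr (_ * _).
by rewrite (mul_sign_swap b2) (mul_sign_swap b3 (\prod_i _)) (mul_sign_swap b3).
Qed.

Lemma normal_form_span h : lspan (fun h => exists k z, h = normal_form k z) h.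
Proof.
apply: lspan_sub (word_forms_span Xn h) => _ [ew [cw [z [xw ->]]]].
have [b [k ->]] := normal_form_words ew cw z xw.
by apply/lspan_sign/lspan_gen; exists k, z.
Qed.

End NormalForms.

From mathcomp Require Import mpoly.
(* [monalg] gives this notation another meaning in [type_scope]. *)
Local Notation "{ 'mpoly' T [ n ] }" := (mpoly n T) : type_scope.

Section PolynomialMap.
Variables (X : weyl_type) (n : nat) (K : fieldType) (t0 u0 v0 : K).
Local Notation H := (hecke X n t0 u0 v0).

Lemma of_polyEw (d : seq 'X_{1..n}) (p : {mpoly K[n]}) : uniq d -> {subset msupp p <= d} ->
  of_poly X t0 u0 v0 p = \sum_(m <- d) p@_m *: polymon X t0 u0 v0 m.
Proof.
move=> ud pd; rewrite /of_poly -(big_undup_sub _ (msupp_uniq p) ud pd).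
apply: eq_bigr => m _; case: ifP => // /negbT mp.
by rewrite memN_msupp_eq0 // scale0r.
Qed.

Lemma of_poly_is_linear : linear (@of_poly X n K t0 u0 v0).
Proof.
move=> a p q; pose d := undup (msupp p ++ msupp q ++ msupp (a *: p + q)).
have ud : uniq d by apply: undup_uniq.
rewrite !(@of_polyEw d) //; try by move=> m mp; rewrite mem_undup !mem_cat mp ?orbT.
rewrite scaler_sumr -big_split; apply: eq_bigr => m _ /=.
by rewrite mcoeffD mcoeffZ scalerDl scalerA.
Qed.

Lemma of_polyX (m : 'X_{1..n}) : of_poly X t0 u0 v0 'X_[m] = polymon X t0 u0 v0 m.
Proof. by rewrite /of_poly msuppX big_seq1 mcoeffX eqxx scale1r. Qed.

End PolynomialMap.

Lemma tens_linl (K : fieldType) (U V : lmodType K) (SU : U -> Prop) (P : tensor U V -> Prop) (v : V) u :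
  (forall u, SU u -> lspan P (tens u v)) -> lspan SU u -> lspan P (tens u v).
Proof.
move=> h; apply: (lspan_mono (f := fun u => tens u v)) => // [|a u1 u2]; last exact: tens_l.
by have := tens_l (-1) (0 : U) 0 v; rewrite !scaleN1r !addNr.
Qed.

Lemma tens_linr (K : fieldType) (U V : lmodType K) (SV : V -> Prop) (P : tensor U V -> Prop) (u : U) v :
  (forall v, SV v -> lspan P (tens u v)) -> lspan SV v -> lspan P (tens u v).
Proof.
move=> h; apply: (lspan_mono (f := fun v => tens u v)) => // [|a v1 v2]; last exact: tens_r.
by have := tens_r (-1) u (0 : V) 0; rewrite !scaleN1r !addNr.
Qed.

Lemma tens_span2 (K : fieldType) (U V : lmodType K) (SU : U -> Prop) (SV : V -> Prop) :
  (forall u, lspan SU u) -> (forall v, lspan SV v) ->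
  forall z : tensor U V, lspan (fun z => exists u v, [/\ SU u, SV v & z = tens u v]) z.
Proof.
move=> hU hV z; apply: lspan_sub (tens_span z) => _ [u [v ->]].
apply: tens_linl (hU u) => {}u Su; apply: tens_linr (hV v) => {}v Sv.
by apply: lspan_gen; exists u, v.
Qed.

(** * The multiplication map on the tensor product *)

Section TensorMap.
Variables (X : weyl_type) (n : nat).
Hypothesis Xn : valid_size X n.
Variables (K : fieldType) (t0 u0 v0 : K).
Hypothesis K0 : [pchar K] =i pred0.
Local Notation H := (hecke X n t0 u0 v0).
Local Notation E := (skewpoly K n).
Local Notation C := (clifford K n).
Local Notation S := (spin_algebra K X n).
Local Notation key := ({ffun 'I_n -> nat} * {ffun 'I_n -> bool} * {ffun 'I_n -> nat})%type.
Local Notation T := (tensor (tensor (tensor E C) S) {mpoly K[n]}).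

Let hecke_mul_lin (U V : lmodType K) (g : U -> H) (h : V -> H) : linear g -> linear h ->
  (forall v, linear (fun u => g u * h v)) /\ (forall u, linear (fun v => g u * h v)).
Proof.
move=> gl hl; split=> [v a u u'|u a v v'].
  by rewrite gl mulrDl -aquot_scalerAl.
by rewrite hl mulrDr -aquot_scalerAr.
Qed.

Definition tens_ec := tens_lift (fun (e : E) (c : C) =>
  of_skew X t0 u0 v0 e * of_cliff X t0 u0 v0 c).
Definition tens_ecs := tens_lift (fun (ec : tensor E C) (s : S) =>
  tens_ec ec * of_spin t0 u0 v0 s).
Definition tens_hecke : T -> H := tens_lift (fun (ecs : tensor (tensor E C) S) p =>
  tens_ecs ecs * of_poly X t0 u0 v0 p).

Fact of_skew_is_linear : linear (@of_skew X n K t0 u0 v0). Proof. exact: linearP. Qed.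
Fact of_cliff_is_linear : linear (@of_cliff X n K t0 u0 v0). Proof. exact: linearP. Qed.
Fact of_spin_is_linear : linear (@of_spin X n K t0 u0 v0). Proof. exact: linearP. Qed.

Fact tens_ec_is_linear : linear tens_ec.
Proof.
have [bl br] := hecke_mul_lin of_skew_is_linear of_cliff_is_linear.
exact: tens_lift_is_linear.
Qed.

Fact tens_ecs_is_linear : linear tens_ecs.
Proof.
have [bl br] := hecke_mul_lin tens_ec_is_linear of_spin_is_linear.
exact: tens_lift_is_linear.
Qed.

Fact tens_hecke_is_linear : linear tens_hecke.
Proof.
have [bl br] := hecke_mul_lin tens_ecs_is_linear (of_poly_is_linear X t0 u0 v0).
exact: tens_lift_is_linear.
Qed.

Definition tens_hecke_linear : {linear T -> H} :=
  HB.pack tens_hecke (GRing.isLinear.Build K T H *:%R tens_hecke tens_hecke_is_linear).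

Lemma tens_hecke_tens e c s p : tens_hecke (tens (tens (tens e c) s) p) =
  of_skew X t0 u0 v0 e * of_cliff X t0 u0 v0 c * of_spin t0 u0 v0 s * of_poly X t0 u0 v0 p.
Proof.
have [bl br] := hecke_mul_lin of_skew_is_linear of_cliff_is_linear.
have [bl' br'] := hecke_mul_lin tens_ec_is_linear of_spin_is_linear.
have [bl'' br''] := hecke_mul_lin tens_ecs_is_linear (of_poly_is_linear X t0 u0 v0).
rewrite /tens_hecke (tens_lift_tens bl'' br'') /tens_ecs (tens_lift_tens bl' br').
by rewrite /tens_ec (tens_lift_tens bl br).
Qed.

Definition skewpoly_mon (a : 'I_n -> nat) : E := \prod_i aclass _ (freegen K i) ^+ a i.
Definition clifford_mon (d : 'I_n -> bool) : C := \prod_i aclass _ (freegen K i) ^+ d i.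

Lemma of_skew_mon a : of_skew X t0 u0 v0 (skewpoly_mon a) = skewmon X t0 u0 v0 a.
Proof.
apply: etrans (rmorph_prod _ _ _ _) _; apply: eq_bigr => i _.
apply: etrans (rmorphXn _ _ _) _; congr (_ ^+ _); exact: of_skew_gen.
Qed.

Lemma of_cliff_mon d : of_cliff X t0 u0 v0 (clifford_mon d) = cliffmon X t0 u0 v0 d.
Proof.
apply: etrans (rmorph_prod _ _ _ _) _; apply: eq_bigr => i _.
apply: etrans (rmorphXn _ _ _) _; congr (_ ^+ _); exact: of_cliff_gen.
Qed.

Lemma skewpoly_mon_span e : lspan (fun e => exists a : {ffun 'I_n -> nat}, e = skewpoly_mon a) e.
Proof.
apply: lspan_sub (aquot_word_span e) => _ [w ->].
have [|b ->] := @word_sort _ n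
    (fun i => aclass (skew_rel (fun i : 'I_n => freegen K i)) (freegen K i)) _ w.
  move=> i j; have [->|ij] := eqVneq i j; first by exists false; rewrite mul1r.
  exists true; rewrite expr1 mulN1r; apply: etrans (aclass_mul_rel (skew_anti _ ij)) _.
  exact: etrans (aclassN _ _) (congr1 -%R (aclassM _ _ _)).
apply/lspan_sign/lspan_gen; exists [ffun i => count_mem i w].
by apply: eq_bigr => i _; rewrite ffunE.
Qed.

Lemma clifford_mon_span c : lspan (fun c => exists d : {ffun 'I_n -> bool}, c = clifford_mon d) c.
Proof.
apply: lspan_sub (aquot_word_span c) => _ [w ->].
have [|b ->] := @word_sort _ n
    (fun i => aclass (cliff_rel (fun i : 'I_n => freegen K i)) (freegen K i)) _ w.
  move=> i j; have [->|ij] := eqVneq i j; first by exists false; rewrite mul1r.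
  exists true; rewrite expr1 mulN1r; apply: etrans (aclass_mul_rel (cliff_anti _ ij)) _.
  exact: etrans (aclassN _ _) (congr1 -%R (aclassM _ _ _)).
apply/lspan_sign/lspan_gen; exists [ffun i => odd (count_mem i w)].
apply: eq_bigr => i _; rewrite ffunE; apply: expr_odd_sqr1.
exact: aclass_mul_rel (cliff_sq _ i).
Qed.

Definition tens_form (k : key) (s : S) : T :=
  tens (tens (tens (skewpoly_mon k.1.1) (clifford_mon k.1.2)) s) 'X_[[multinom k.2 i | i < n]].

Lemma tens_form_is_linear k : linear (tens_form k).
Proof. by move=> a s s'; rewrite /tens_form tens_r tens_l. Qed.

Lemma tens_hecke_form k s : tens_hecke (tens_form k s) = normal_form t0 u0 v0 k s.
Proof.
rewrite tens_hecke_tens of_skew_mon of_cliff_mon of_polyX /normal_form; congr (_ * _).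
by apply: eq_bigr => i _; rewrite mnmE.
Qed.

Lemma tens_form_span z : lspan (fun z => exists k s, z = tens_form k s) z.
Proof.
have all_span (s : S) : lspan (fun _ => True) s by apply: lspan_gen.
have mon_span (p : {mpoly K[n]}) : lspan (fun p => exists m, p = 'X_[m]) p.
  rewrite [p]mpolyE; elim/big_ind: _ => [|p1 p2|m _].
  - exact: lspan0.
  - exact: lspanD.
  by apply/lspanZ/lspan_gen; exists m.
apply: lspan_sub (tens_span2 (tens_span2 (tens_span2 skewpoly_mon_span clifford_mon_span)
  all_span) mon_span z).
move=> _ [_ [_ [[_ [s [[_ [_ [[a ->] [d ->] ->]]] _ ->]]] [m ->] ->]]].
apply: lspan_gen; exists (a, d, [ffun i => m i]), s; congr tens; congr 'X_[_].
by apply/mnmP => i; rewrite mnmE ffunE.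
Qed.

Lemma normal_form0 (k : key) : normal_form t0 u0 v0 k (0 : S) = 0 :> H.
Proof.
by have := @normal_form_is_linear X n K t0 u0 v0 k (-1) 0 0; rewrite !scaleN1r !addNr.
Qed.

Lemma normal_formZ c (k : key) (y : S) :
  normal_form t0 u0 v0 k (c *: y) = c *: normal_form t0 u0 v0 k y :> H.
Proof.
by have := @normal_form_is_linear X n K t0 u0 v0 k c y 0; rewrite normal_form0 !addr0.
Qed.

Lemma normal_form_free (s : seq key) (z : key -> S) : uniq s ->
  \sum_(k <- s) normal_form t0 u0 v0 k (z k) = 0 -> {in s, forall k, z k = 0}.
Proof. exact: normal_forms_free K0 _ _. Qed.

(** It suffices that the [tens_form] span the tensor product: their images are normal forms with the
    same spin coefficients, and these vanish by independence in the target. *)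
Lemma tens_hecke_inj : injective tens_hecke.
Proof.
suff inj0 z : tens_hecke z = 0 -> z = 0.
  move=> y z yz; apply/eqP; rewrite -subr_eq0; apply/eqP/inj0.
  by apply: etrans (linearB tens_hecke_linear _ _) _; apply/eqP; rewrite subr_eq0; apply/eqP.
have [s [w [us ->]]] := lspan_combination tens_form_is_linear (tens_form_span z).
rewrite [tens_hecke _](linear_sum tens_hecke_linear) => z0; have w0 : {in s, forall k, w k = 0}.
  apply: normal_form_free us _; rewrite -[RHS]z0.
  by apply: eq_bigr => k _; rewrite -tens_hecke_form.
rewrite big_seq big1 // => k ks; rewrite w0 //.
by have := tens_form_is_linear k (-1) 0 0; rewrite !scaleN1r !addNr.
Qed.

Lemma tens_hecke_surj h : exists z, tens_hecke z = h.
Proof.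
have [s [w [_ ->]]] := lspan_combination (@normal_form_is_linear X n K t0 u0 v0)
  (normal_form_span Xn h).
exists (\sum_(k <- s) tens_form k (w k)).
rewrite [tens_hecke _](linear_sum tens_hecke_linear).
by apply: eq_bigr => k _; rewrite -tens_hecke_form.
Qed.

Lemma tens_hecke_bij : bijective tens_hecke.
Proof.
exists (fun h => projT1 (cid (tens_hecke_surj h))) => [z|h].
  by apply: tens_hecke_inj; case: cid.
by case: cid.
Qed.

Lemma tensor_iso : exists f : {linear T -> H},
  (forall e c s p, f (tens (tens (tens e c) s) p) = of_skew X t0 u0 v0 e *
    of_cliff X t0 u0 v0 c * of_spin t0 u0 v0 s * of_poly X t0 u0 v0 p) /\ bijective f.
Proof.
by exists tens_hecke_linear; split; [exact: tens_hecke_tens|exact: tens_hecke_bij].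
Qed.

(** * The basis attached to a basis of the spin algebra *)

Section Basis.
Variables (I : eqType) (sigma : I -> S).
Hypothesis sigma_basis : lin_basis sigma.
Local Notation index := ({ffun 'I_n -> nat} * {ffun 'I_n -> bool} * I * {ffun 'I_n -> nat})%type.

Definition index_key (j : index) : key := (j.1.1.1, j.1.1.2, j.2).

(** Grouping the indices by key gives a relation with coefficients in the spin algebra. Each
    coefficient vanishes, and each is a combination of distinct [sigma i]. *)
Lemma pbw_free (s : seq index) (r : index -> K) : uniq s ->
  \sum_(j <- s) r j *: normal_form t0 u0 v0 (index_key j) (sigma j.1.2) = 0 ->
  {in s, forall j, r j = 0}.
Proof.
move=> us s0 [[[a d] i] b] js; pose k := (a, d, b) : key.
have nf_lin := @normal_form_is_linear X n K t0 u0 v0.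
have s0' : \sum_(j <- s) normal_form t0 u0 v0 (index_key j) (r j *: sigma j.1.2) = 0.
  by rewrite -[RHS]s0; apply: eq_bigr => j _; rewrite normal_formZ.
rewrite (sum_by_key nf_lin) in s0'.
have := normal_form_free (undup_uniq _) s0'.
move=> /(_ k); rewrite mem_undup => /(_ (map_f index_key js)) k0.
pose si := [seq j.1.2 | j <- s & index_key j == k].
have usi : uniq si.
  rewrite map_inj_in_uniq ?filter_uniq // => j j'.
  rewrite !mem_filter => /andP[/eqP + _] /andP[/eqP + _].
  by case: j j' => [[[a1 d1] i1] b1] [[[a2 d2] i2] b2] [-> -> ->] [-> -> ->] /= ->.
apply: (sigma_basis.1 si (fun i => r (a, d, i, b)) usi); last first.
  by apply/mapP; exists (a, d, i, b); rewrite // mem_filter js eqxx.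
rewrite -[RHS]k0 big_map big_filter; apply: eq_bigr => [[[[a1 d1] i1] b1]].
by move=> /eqP[-> -> ->].
Qed.

Lemma pbw_span h : exists (s : seq index) (r : index -> K),
  h = \sum_(j <- s) r j *: normal_form t0 u0 v0 (index_key j) (sigma j.1.2).
Proof.
(* The field as a module over itself serves as the coefficient space in [lspan_combination]. *)
have lin (j : index) : linear (fun r : K^o =>
    (r : K) *: normal_form t0 u0 v0 (index_key j) (sigma j.1.2)).
  by move=> a r r'; rewrite scalerDl scalerA.
have [|s [r [_ ->]]] := lspan_combination lin (v := h); last by exists s, r.
apply: lspan_sub (normal_form_span Xn h) => _ [k [y ->]].
have [s [r ->]] := sigma_basis.2 y.
elim/big_ind: _ => [|y1 y2 h1 h2|i _].
- by rewrite normal_form0; apply: lspan0.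
- rewrite -[y1]scale1r normal_form_is_linear scale1r; exact: lspanD.
rewrite normal_formZ; apply: lspan_gen; exists (k.1.1, k.1.2, i, k.2), (r i).
by case: k => [[a d] b].
Qed.

End Basis.
End TensorMap.

Theorem theorem4p4 (R : realType) (X : weyl_type) (n : nat) (t u v : R[i]) :
  valid_size X n ->
  (exists f : {linear tensor (tensor (tensor (skewpoly R[i] n)
                                              (clifford R[i] n))
                                      (spin_algebra R[i] X n))
                             {mpoly R[i][n]}
                      -> hecke X n t u v},
     (forall e c s p,
        f (tens (tens (tens e c) s) p)
        = of_skew X t u v e * of_cliff X t u v c * of_spin t u v s
          * of_poly X t u v p) /\
     bijective f) /\
  (forall (I : eqType) (sigma : I -> spin_algebra R[i] X n),
     lin_basis sigma ->
     lin_basis (fun k : {ffun 'I_n -> nat} * {ffun 'I_n -> bool} * I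
                    * {ffun 'I_n -> nat} =>
              let: (a, d, i, b) := k in
              skewmon X t u v a * cliffmon X t u v d * of_spin t u v (sigma i)
              * polymon X t u v b)).
Proof.
move=> Xn; have K0 : [pchar R[i]] =i pred0 by apply: pchar_num.
split; first exact: tensor_iso.
move=> I sigma sb.
have E : (fun k : {ffun 'I_n -> nat} * {ffun 'I_n -> bool} * I * {ffun 'I_n -> nat} =>
    let: (a, d, i, b) := k in
    skewmon X t u v a * cliffmon X t u v d * of_spin t u v (sigma i) * polymon X t u v b) =
    (fun j => normal_form t u v (index_key j) (sigma j.1.2)).
  by apply/funext => [[[[a d] i] b]].
by rewrite E; split; [exact: pbw_free|exact: pbw_span].
Qed.
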